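(* Let $\Omega\subset\mathbb{R}^d$ be a nonempty open set. Then $\mathscr{E}'_t(V(\Omega))\cong N_b(\Omega)=NC_b(\Omega)$ topologically, where the isomorphism $\mathscr{E}'_t(V(\Omega))\to N_b(\Omega)$ is given by $T\mapsto N_T$. That is, $T\mapsto N_T$ is a linear homeomorphism from $\mathscr{E}'_t(V(\Omega))$ onto $N_b(\Omega)$, and the topologies of $N_b(\Omega)$ and $NC_b(\Omega)$ on the space $\{N_T: T\in\mathscr{E}'(V(\Omega))\}$ coincide.
   Context: For $x,y\in\mathbb{R}^d$, $xy=(x_1y_1,\dots,x_dy_d)$. For $T,S\in\mathscr{E}'(\mathbb{R}^d)$, $(T\star S)f=T_x(S_yf(xy))$ for $f\in C^\infty(\mathbb{R}^d)$, and $N_T:S\mapsto T\star S$. For open $U$, $\mathscr{E}'(U)$ is the strong dual of $C^\infty(U)$ and $C'(U)$ the strong dual of $C(U)$ (compactly supported Radon measures in $U$). For $X,Y\subset\mathbb{R}^d$, $V(X,Y)=\{\eta\in\mathbb{R}^d:\eta X\subset Y\}$ and $V(\Omega)=V(\Omega,\Omega)$. For an arbitrary $A\subset\mathbb{R}^d$, $\mathscr{E}'(A)$ as a set consists of the distributions with compact support contained in $A$. Let $\omega_1\subset\subset\omega_2\subset\subset\cdots$ be an exhaustion of $\Omega$ by open sets (each $\overline{\omega_n}$ is compact and contained in $\omega_{n+1}$, and $\bigcup_n\omega_n=\Omega$). Put $U_n=V(\overline{\omega_n},\Omega)$; these are open neighborhoods of $V(\Omega)$, decreasing, with $\bigcap_nU_n=V(\Omega)$.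 Then $\mathscr{E}'_t(V(\Omega)):=\lim\operatorname{proj}_n\mathscr{E}'(U_n)$, i.e. the space $\mathscr{E}'(V(\Omega))=\bigcap_n\mathscr{E}'(U_n)$ with the coarsest topology making all inclusions into $\mathscr{E}'(U_n)$ (strong topology) continuous; this does not depend on the exhaustion. $L_b(E,F)$ is the space of continuous linear maps $E\to F$ with the topology of uniform convergence on bounded subsets of $E$. $N_b(\Omega)$ is the space of all $N\in L(\mathscr{E}'(\Omega),\mathscr{E}'(\Omega))$ of the form $N=N_T$ with $T\in\mathscr{E}'(\mathbb{R}^d)$ (equivalently $T\in\mathscr{E}'(V(\Omega))$), with the topology induced from $L_b(\mathscr{E}'(\Omega),\mathscr{E}'(\Omega))$. $NC_b(\Omega)$ is the same space $\{N_T:T\in\mathscr{E}'(V(\Omega))\}$ with $N_T$ regarded as an element of $L(C'(\Omega),\mathscr{E}'(\Omega))$ and with the topology induced from $L_b(C'(\Omega),\mathscr{E}'(\Omega))$. *)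

(* Defs.v *)
From HB Require Import structures.
From mathcomp Require Import all_boot all_order all_algebra.
From mathcomp Require Import complex.
From mathcomp Require Import all_classical all_reals all_analysis.

Set Implicit Arguments.
Unset Strict Implicit.
Unset Printing Implicit Defensive.

Import Order.TTheory GRing.Theory Num.Theory.
Import numFieldNormedType.Exports.

Local Open Scope classical_set_scope.
Local Open Scope ring_scope.

(* Scalars are real or complex: [scalar_field emb] says that [emb : R -> K]
   is the inclusion of the reals in K = R or in K = R[i]. *)
Variant scalar_field (R : realType) : forall K : numFieldType, (R -> K) -> Prop :=
| RealScalars : @scalar_field R R idfun
| ComplexScalars : @scalar_field R (complex R) (real_complex R).

Section LocallyConvex.
Context {K : numFieldType}.

(* Boundedness in the sense of von Neumann: B is absorbed by every
   neighbourhood of 0. *)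
Definition bounded_subset (E : preTopologicalLmodType K) (B : set E) : Prop :=
  forall W : set E, nbhs 0 W ->
    exists2 r : K, 0 < r & forall t : K, r <= `|t| -> B `<=` *:%R t @` W.

Section Dual.
Context (E : preTopologicalLmodType K).

Definition dual_pred : {pred E -> K^o} :=
  mem [set T : E -> K^o | linear T /\ continuous T].

Record dual := Dual {
  dual_fun :> E -> K^o ;
  _ : dual_fun \in dual_pred }.

HB.instance Definition _ := [isSub for dual_fun].
HB.instance Definition _ := [Choice of dual by <:].

Lemma dual_submod_closed : submod_closed dual_pred.
Proof.
split=> [|a f g].
  apply/mem_set; split=> [b x y|x]; first by rewrite /= scaler0 addr0.
  exact: cst_continuous.
move=> /set_mem[fl fc] /set_mem[gl gc]; apply/mem_set; split.
  move=> b x y.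
  rewrite -[LHS]/(a *: f (b *: x + y) + g (b *: x + y)).
  rewrite -[RHS]/(b *: (a *: f x + g x) + (a *: f y + g y)) fl gl.
  rewrite !scalerDr addrACA; congr (_ + _).
  by rewrite !scalerA [b * a]mulrC.
move=> x; apply: (@continuousD _ _ _ (a \*: f) g); last exact: gc.
by apply: continuousZr; exact: fc.
Qed.

HB.instance Definition _ :=
  GRing.isSubmodClosed.Build _ _ dual_pred dual_submod_closed.
HB.instance Definition _ := [SubChoice_isSubLmodule of dual by <:].

(* [dual E] carries the strong topology: uniform convergence on bounded
   subsets of E. *)
HB.instance Definition _ := Uniform.copy dual (initial_topology
  (dual_fun : dual -> {family bounded_subset (E := E), E -> K^o})).

End Dual.
End LocallyConvex.

Section Spaces.
Context {R : realType} {K : numFieldType} (emb : R -> K) {d : nat}.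
Local Notation V := 'rV[R]_d.
Implicit Types (U : set V) (f g : V -> K^o).

(* For K = R, [partial i f] is the library's ['D_(delta_mx 0 i) f]; the latter
   is not available for complex-valued functions of real variables. *)
Definition dquot (i : 'I_d) f (x : V) (h : R) : K^o :=
  (emb h)^-1 *: (f (x + h *: delta_mx 0 i) - f x).

Definition partial (i : 'I_d) f : V -> K^o :=
  fun x => lim (dquot i f x h @[h --> 0^']).

Definition iter_partial (s : seq 'I_d) f : V -> K^o := foldr partial f s.

(* Partial derivatives of all orders, in any sequence of directions, exist and
   are continuous on U. Here and in the function spaces below U is meant to be
   open; taking U° makes them vector spaces for an arbitrary set U, so that no
   proof of openness has to be carried by the types. *)
Definition smooth_on U f : Prop :=
  forall x, U° x -> forall s : seq 'I_d,
    {for x, continuous (iter_partial s f)} /\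
    forall i, cvg (dquot i (iter_partial s f) x h @[h --> 0^']).

Lemma near_line U (x : V) (i : 'I_d) :
  U° x -> \forall h \near (0 : R)^', U° (x + h *: delta_mx 0 i).
Proof.
move=> Ux; have xh : (fun h : R => x + h *: delta_mx 0 i : V) @ (0 : R) -->
    x + (0 : R) *: (delta_mx 0 i : V).
  by apply: cvgD; [exact: cvg_cst|apply: cvgZr_tmp; exact: cvg_id].
rewrite scale0r addr0 in xh; apply: cvg_within; apply: xh.
by apply: open_nbhs_nbhs; split => //; exact: open_interior.
Qed.

Lemma dquot_local U f g (i : 'I_d) (x : V) : (forall y, U° y -> f y = g y) ->
  U° x -> dquot i f x h @[h --> 0^'] = dquot i g x h @[h --> 0^'].
Proof.
move=> fg Ux; rewrite eqEsubset; split; apply: near_eq_cvg;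
  near=> h; rewrite /dquot !fg//; near: h; exact: near_line.
Unshelve. all: by end_near. Qed.

Lemma iter_partial_local U f g s : (forall y, U° y -> f y = g y) ->
  forall y, U° y -> iter_partial s f y = iter_partial s g y.
Proof.
by move=> fg; elim: s => //= i s ih y Uy; rewrite /partial (dquot_local i ih).
Qed.

Lemma continuous_local U f g x : (forall y, U° y -> f y = g y) -> U° x ->
  {for x, continuous f} -> {for x, continuous g}.
Proof.
move=> fg Ux; rewrite /prop_for /continuous_at -fg//; apply: cvg_trans.
have Ux' : nbhs x U° by apply: open_nbhs_nbhs; split=> //; exact: open_interior.
by apply: (@near_eq_cvg _ _ (nbhs x)); near=> y; apply: fg; near: y.
Unshelve. all: by end_near.
Qed.

Lemma smooth_on_local U f g : (forall y, U° y -> f y = g y) ->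
  smooth_on U f -> smooth_on U g.
Proof.
move=> fg fU x Ux s; have [fc fd] := fU x Ux s.
have fgs := iter_partial_local s fg.
split; first exact: continuous_local fgs _ fc.
by move=> i; rewrite -(dquot_local i fgs Ux).
Qed.

Lemma dquotP a f g i x h :
  dquot i (a *: f + g) x h = a *: dquot i f x h + dquot i g x h.
Proof.
rewrite /dquot -[LHS]/((emb h)^-1 *: (a *: f _ + g _ - (a *: f _ + g _))).
by rewrite opprD addrACA -scalerBr scalerDr !scalerA mulrC.
Qed.

Lemma iter_partialP U a f g s : smooth_on U f -> smooth_on U g ->
  forall y, U° y ->
  iter_partial s (a *: f + g) y = (a *: iter_partial s f + iter_partial s g) y.
Proof.
move=> fU gU; elim: s => //= i s ih y Uy.
rewrite {1}/partial (dquot_local i ih Uy).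
have [_ /(_ i) fd] := fU y Uy s; have [_ /(_ i) gd] := gU y Uy s.
under eq_fun do rewrite dquotP.
by apply/cvg_lim => //; apply: cvgD => //; exact: cvgZl_tmp.
Qed.

Lemma smooth_onP U a f g :
  smooth_on U f -> smooth_on U g -> smooth_on U (a *: f + g).
Proof.
move=> fU gU x Ux s.
have fgs y : U° y -> (a *: iter_partial s f + iter_partial s g) y =
    iter_partial s (a *: f + g) y by move=> Uy; rewrite (iter_partialP _ _ fU gU).
have [fc fd] := fU x Ux s; have [gc gd] := gU x Ux s.
split=> [|i].
  apply: (continuous_local fgs Ux).
  apply: (@continuousD _ _ _ (a \*: iter_partial s f)) => //.
  exact: continuousZr.
rewrite -(dquot_local i fgs Ux); under eq_fun do rewrite dquotP.
by apply: is_cvgD => //; exact: is_cvgZl_tmp.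
Qed.

Lemma smooth_on0 U : smooth_on U 0.
Proof.
move=> x Ux; have p0 s y : iter_partial s 0 y = 0.
  elim: s y => //= i s ih y; apply/cvg_lim => //.
  rewrite /dquot; under eq_fun do rewrite !ih subrr scaler0; exact: cvg_cst.
move=> s; have -> : iter_partial s 0 = cst 0 by apply/funext => y; exact: p0.
split=> [|i]; first exact: cst_continuous.
by rewrite /dquot; under eq_fun do rewrite subrr scaler0; exact: is_cvg_cst.
Qed.

Definition compacts_in U : set (set V) := [set L | compact L /\ L `<=` U°].

Section SmoothFun.
Context (U : set V).

(* C^infty(U): a function on U is represented by its extension by 0 to R^d, so
   that equality in [smoothfun] is equality on U. The topology, given below, is
   that of uniform convergence of all partial derivatives on the compact
   subsets of U. *)
Definition smoothfun_pred : {pred V -> K^o} :=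
  mem [set f | smooth_on U f /\ forall x, ~ U° x -> f x = 0].

Record smoothfun := SmoothFun {
  smoothfun_fun :> V -> K^o ;
  _ : smoothfun_fun \in smoothfun_pred }.

HB.instance Definition _ := [isSub for smoothfun_fun].
HB.instance Definition _ := [Choice of smoothfun by <:].

Lemma smoothfun_submod_closed : submod_closed smoothfun_pred.
Proof.
split=> [|a f g /set_mem[fU f0] /set_mem[gU g0]].
  by apply/mem_set; split=> //; exact: smooth_on0.
apply/mem_set; split=> [|x Ux]; first exact: smooth_onP.
by rewrite -[LHS]/(a *: f x + g x) f0// g0// scaler0 addr0.
Qed.

HB.instance Definition _ :=
  GRing.isSubmodClosed.Build _ _ smoothfun_pred smoothfun_submod_closed.
HB.instance Definition _ := [SubChoice_isSubLmodule of smoothfun by <:].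

Definition jet (f : smoothfun) :
    prod_topology (fun _ : seq 'I_d => {family compacts_in U, V -> K^o}) :=
  fun s => iter_partial s f.

HB.instance Definition _ := Uniform.copy smoothfun (initial_topology jet).

(* C(U), encoded in the same way, with uniform convergence on the compact
   subsets of U; [dual contfun] is C'(U), [dual smoothfun] is E'(U). *)
Definition contfun_pred : {pred V -> K^o} :=
  mem [set f | (forall x, U° x -> {for x, continuous f}) /\
               forall x, ~ U° x -> f x = 0].

Record contfun := ContFun {
  contfun_fun :> V -> K^o ;
  _ : contfun_fun \in contfun_pred }.

HB.instance Definition _ := [isSub for contfun_fun].
HB.instance Definition _ := [Choice of contfun by <:].

Lemma contfun_submod_closed : submod_closed contfun_pred.
Proof.
split=> [|a f g /set_mem[fU f0] /set_mem[gU g0]].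
  by apply/mem_set; split=> // x _; exact: cst_continuous.
apply/mem_set; split=> x Ux.
  apply: (@continuousD _ _ _ (a \*: f)); last exact: gU.
  by apply: continuousZr; exact: fU.
by rewrite -[LHS]/(a *: f x + g x) f0// g0// scaler0 addr0.
Qed.

HB.instance Definition _ :=
  GRing.isSubmodClosed.Build _ _ contfun_pred contfun_submod_closed.
HB.instance Definition _ := [SubChoice_isSubLmodule of contfun by <:].

HB.instance Definition _ := Uniform.copy contfun (initial_topology
  (contfun_fun : contfun -> {family compacts_in U, V -> K^o})).

Lemma smoothfun_contfun (f : smoothfun) : (f : V -> K^o) \in contfun_pred.
Proof.
have /set_mem[fU f0] := valP f; apply/mem_set; split=> // x Ux.
by have [] := fU x Ux [::].
Qed.

Definition incl (f : smoothfun) : contfun := ContFun (smoothfun_contfun f).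

Lemma incl_linear : linear incl.
Proof. by move=> a f g; apply/val_inj. Qed.

Lemma incl_continuous : continuous incl.
Proof.
apply: continuous_comp_initial.
have -> : (contfun_fun : _ -> {family compacts_in U, V -> K^o}) \o incl =
    (fun f : smoothfun => jet f [::]) by [].
move=> f; apply: (@continuous_comp _ _ _ jet (fun p => p [::])).
  exact: initial_continuous.
exact: proj_continuous.
Qed.

Lemma measure_distr_dual (mu : dual contfun) :
  ((mu : contfun -> K^o) \o incl) \in dual_pred (E := smoothfun).
Proof.
have /set_mem[mul muc] := valP mu; apply/mem_set; split.
  by move=> a f g; rewrite /= incl_linear mul.
by move=> f; apply: continuous_comp; [exact: incl_continuous|exact: muc].
Qed.

(* The inclusion of C'(U) in E'(U). *)
Definition measure_distr (mu : dual contfun) : dual smoothfun :=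
  Dual (measure_distr_dual mu).

(* The restriction to U of a function g that is smooth on U, as an element of
   C^infty(U), see [to_smoothE]. It is 0 if g is not smooth on U. *)
Definition to_smooth (g : V -> K^o) : smoothfun :=
  insubd (0 : smoothfun) (patch (fun=> 0) U° g).

Lemma to_smoothE g x : smooth_on U g -> U° x -> to_smooth g x = g x.
Proof.
move=> gU Ux; have gE y : U° y -> g y = patch (fun=> 0) U° g y.
  by move=> Uy; rewrite patchT// inE.
rewrite gE//; suff gP : patch (fun=> 0) U° g \in smoothfun_pred.
  by rewrite -[LHS]/(val (to_smooth g) x) insubdK.
apply/mem_set; split; first exact: smooth_on_local gE gU.
by move=> y Uy; rewrite /patch; case: ifPn => // /set_mem.
Qed.

End SmoothFun.

End Spaces.

Arguments contfun {R} K {d} U.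
Arguments smoothfun {R K} emb {d} U.
Arguments to_smooth {R K} emb {d} U g.
Arguments measure_distr {R K} emb {d} U mu.

Section Hadamard.
Context {R : realType} {K : numFieldType} (emb : R -> K) {d : nat}.
Local Notation V := 'rV[R]_d.
Local Notation distr U := (dual (smoothfun emb U)).
Local Notation testfun := (smoothfun emb (@setT V)).
Local Notation distrT := (distr (@setT V)).

Definition vanishes_on (T : distrT) (W : set V) : Prop :=
  forall f : testfun, let F := closure [set x | f x != 0] in
    compact F -> F `<=` W -> T f = 0.

Definition supp (T : distrT) : set V :=
  ~` \bigcup_(W in [set W : set V | open W /\ vanishes_on T W]) W.

Section DistrOn.
Context (A : set V).

(* E'(A) for an arbitrary subset A of R^d. *)
Definition distr_on_pred : {pred distrT} :=
  mem [set T : distrT | compact (supp T) /\ supp T `<=` A].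

Record distr_on := DistrOn {
  distr_on_val :> distrT ;
  _ : distr_on_val \in distr_on_pred }.

HB.instance Definition _ := [isSub for distr_on_val].
HB.instance Definition _ := [Choice of distr_on by <:].

Lemma closed_supp T : closed (supp T).
Proof. by apply: open_closedC; apply: bigcup_open => W []. Qed.

Lemma supp0 : supp 0 = set0.
Proof.
rewrite /supp -subset0 => x /= + ; apply; exists setT => //.
by split; [exact: openT|move=> f].
Qed.

Lemma suppP a T S : supp (a *: T + S) `<=` supp T `|` supp S.
Proof.
rewrite /supp -setCI; apply: subsetC => x [[W1 [Wo1 v1] W1x] [W2 [Wo2 v2] W2x]].
exists (W1 `&` W2) => //; split; first exact: openI.
move=> f /= cf; rewrite subsetI => -[f1 f2].
by rewrite -[LHS]/(a *: T f + S f) v1// v2// scaler0 addr0.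
Qed.

Lemma distr_on_submod_closed : submod_closed distr_on_pred.
Proof.
split=> [|a T S /set_mem[cT TA] /set_mem[cS SA]]; apply/mem_set.
  by rewrite /= supp0; split; [exact: compact0|exact: sub0set].
split.
  apply: (@subclosed_compact _ _ (supp T `|` supp S)).
  - exact: closed_supp.
  - exact: compactU.
  - exact: suppP.
by apply: subset_trans (@suppP a T S) _; rewrite subUset.
Qed.

HB.instance Definition _ :=
  GRing.isSubmodClosed.Build _ _ distr_on_pred distr_on_submod_closed.
HB.instance Definition _ := [SubChoice_isSubLmodule of distr_on by <:].

End DistrOn.

(* The functional u on C^infty(R^d) is the distribution S in E'(U), considered
   as an element of E'(R^d): u f = S (f|U). There is at most one such S, because
   the restrictions f|U are dense in C^infty(U), and for u in E'(R^d) there is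
   one as soon as the support of u is contained in the open set U. *)
Definition represents U (S : distr U) (u : testfun -> K) : Prop :=
  forall f : testfun, u f = S (to_smooth emb U f).

Definition extension U (u : testfun -> K) : distr U :=
  xget (0 : distr U) [set S | represents S u].

Definition hadamard (x y : V) : V := \row_i (x 0 i * y 0 i).

(* (T * S) f = T_x (S_y f(xy)), for S in E'(U). The functions y |-> f(xy) and
   x |-> S_y f(xy) are smooth, so that [to_smooth] only restricts them. *)
Definition mconv U (T : distrT) (S : distr U) (f : testfun) : K :=
  T (to_smooth emb setT
       (fun x => S (to_smooth emb U (fun y => f (hadamard x y))))).

(* V(X, Y) *)
Definition dilations (X Y : set V) : set V :=
  [set eta | forall x, X x -> Y (hadamard eta x)].

Definition exhaustion (Omega : set V) (omega : nat -> set V) : Prop :=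
  [/\ forall n, open (omega n),
      forall n, compact (closure (omega n)),
      forall n, closure (omega n) `<=` omega n.+1 &
      \bigcup_n omega n = Omega].

Section ProjectiveTopology.
Context (Omega : set V) (omega : nat -> set V).

(* The inclusions of E'(V(Omega)) in the spaces E'(U_n), where
   U_n = V(closure omega_n, Omega). *)
Definition proj_map (T : distr_on (dilations Omega Omega)) :
    prod_topology (fun n => distr (dilations (closure (omega n)) Omega)) :=
  fun n => extension (dilations (closure (omega n)) Omega) (T : distrT).

(* E'_t(V(Omega)) *)
Definition distr_proj := initial_topology proj_map.

HB.instance Definition _ := Uniform.on distr_proj.
HB.instance Definition _ := GRing.Lmodule.copy distr_proj
  (distr_on (dilations Omega Omega)).

End ProjectiveTopology.

Section Operators.
Context (Omega : set V).

(* N = N_T *)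
Definition is_mconv_op (T : distrT) (N : distr Omega -> distr Omega) : Prop :=
  forall S, represents (N S) (mconv T S).

Definition mconv_op_pred : {pred distr Omega -> distr Omega} :=
  mem [set N : distr Omega -> distr Omega |
    [/\ linear N, continuous N & exists T, is_mconv_op T N]].

Record mconv_op := MConvOp {
  mconv_op_fun :> distr Omega -> distr Omega ;
  _ : mconv_op_fun \in mconv_op_pred }.

HB.instance Definition _ := [isSub for mconv_op_fun].
HB.instance Definition _ := [Choice of mconv_op by <:].

(* N_b(Omega) *)
Definition Nb := initial_topology (mconv_op_fun : mconv_op ->
  {family bounded_subset (E := distr Omega), distr Omega -> distr Omega}).

HB.instance Definition _ := Uniform.on Nb.

(* NC_b(Omega): the same operators, topologized through their restrictions to
   C'(Omega). *)
Definition NCb := initial_topology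
  ((fun N mu => N (measure_distr emb Omega mu)) : mconv_op ->
  {family bounded_subset (E := dual (contfun K Omega)),
     dual (contfun K Omega) -> distr Omega}).

HB.instance Definition _ := Uniform.on NCb.

End Operators.
End Hadamard.

Arguments distr_on {R K} emb {d} A.
Arguments distr_proj {R K} emb {d} Omega omega.
Arguments mconv_op {R K} emb {d} Omega.
Arguments Nb {R K} emb {d} Omega.
Arguments NCb {R K} emb {d} Omega.

(* Main.v *)
Require Import Defs.
From mathcomp Require Import all_boot all_order all_algebra.
From mathcomp Require Import complex ring lra zify.
From mathcomp Require Import all_classical all_reals all_analysis.

Set Implicit Arguments.
Unset Strict Implicit.
Unset Printing Implicit Defensive.

Import Order.TTheory GRing.Theory Num.Theory.
Import numFieldNormedType.Exports.

Local Open Scope classical_set_scope.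
Local Open Scope ring_scope.

(** T is recovered from N_T by means of point masses: (N_T delta_y) f is T_x f(xy),
    and x |-> xy is invertible if y has no zero coordinates ([op_dirac]).

    If supp T is contained in V(Omega), then f |-> T_x f(xy) is a continuous map of
    C^infty(Omega) to itself, and its transpose is N_T ([Nop_mconv]) by Fubini's theorem
    T_x S_y f(xy) = S_y T_x f(xy). That holds because both sides are continuous in f,
    and it is immediate for polynomials f, which are dense by Bernstein approximation
    of all derivatives ([fubini], [tensor_dense]). Conversely, bounded sets of
    distributions are equicontinuous, hence supported in one compact set
    ([equicontinuous]). Applied to the images of delta_y' for all y' near a point y
    of Omega, this shows that y supp T is contained in Omega if N_T is a continuous
    map of E'(Omega) ([supp_dilations]).

    T |-> N_T is continuous: a bounded set of distributions S comes from one omega_n,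
    and (N_T S) f is T applied to x |-> S_y f(xy), which stays in a bounded subset of
    C^infty(U_n) ([Nop_bound]).

    The inverse is continuous even for the topology of NC_b(Omega). Given a bounded set
    of functions g in C^infty(U_n), one has to bound T g by means of N_T on a bounded
    set of measures and a bounded set of functions. If g(x) = f(xy), then T g is
    (N_T delta_y) f; but f, which lives on y supp g, must not become large on compact
    subsets of Omega as supp g approaches the boundary of U_n. Now a point x near the
    boundary of U_n maps some point y of closure omega_n close to the boundary of Omega
    or far away, and with this choice of y the function f vanishes near any given
    compact subset of Omega. So there are boxes that cover U_n and points y_j of
    omega_(n+1) for which the products of y_j with the j-th box leave every compact
    subset of Omega ([adapted_cover]). A partition of unity writes g as a sum of
    functions f_j(x y_j) for which all the functions 2^(j+1) f_j form a bounded set, and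
    if N_T is at most 1 on these and the measures delta_(y_j), then T g is at most the
    sum of all 2^-(j+1), that is, at most 1 ([dirac_estimate]).

    Finally N_b(Omega) -> NC_b(Omega) is continuous, as bounded sets of measures are
    bounded sets of distributions. So in the cycle
    E'_t(V(Omega)) -> N_b(Omega) -> NC_b(Omega) -> E'_t(V(Omega)) all maps are continuous
    and the composition is the identity: all three topologies agree.

    Continuity and boundedness in all these spaces are expressed by the seminorms
    [cn_le] on C^infty(U), and real and complex scalars are treated together through
    the real-valued absolute value [nrm]. *)

(* Type class inference then supplies this hypothesis to the lemmas below. *)
Existing Class scalar_field.

(** * Real and complex scalars *)

Section Scalars.
Context {R : realType} {K : numFieldType} {emb : R -> K}.
Context {hK : scalar_field emb}.

(** The two cases of [scalar_field] at once: facts about R and R[i] carry over to K. *)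
Let embP (P : forall K : numFieldType, (R -> K) -> Prop) :
  P R idfun -> P (complex R) (real_complex R) -> P K emb.
Proof. by case: hK. Qed.

Lemma emb0 : emb 0 = 0. Proof. exact: (embP (P := fun K e => e 0 = 0)). Qed.

Lemma emb1 : emb 1 = 1. Proof. exact: (embP (P := fun K e => e 1 = 1)). Qed.

Lemma embD x y : emb (x + y) = emb x + emb y.
Proof.
apply: (embP (P := fun K e => e (x + y) = e x + e y)) => //.
by rewrite -rmorphD.
Qed.

Lemma embN x : emb (- x) = - emb x.
Proof.
apply: (embP (P := fun K e => e (- x) = - e x)) => //.
by rewrite -rmorphN.
Qed.

Lemma embB x y : emb (x - y) = emb x - emb y.
Proof. by rewrite embD embN. Qed.

Lemma embM x y : emb (x * y) = emb x * emb y.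
Proof.
apply: (embP (P := fun K e => e (x * y) = e x * e y)) => //.
by rewrite -rmorphM.
Qed.

Lemma emb_nat n : emb n%:R = n%:R.
Proof. by elim: n => [|n ih]; rewrite ?emb0// -!natr1 embD ih emb1. Qed.

Lemma ltr_emb x y : (emb x < emb y) = (x < y).
Proof.
apply: (embP (P := fun K e => (e x < e y) = (x < y))) => //.
exact: ltcR.
Qed.

Lemma emb_inj : injective emb.
Proof.
by apply: (embP (P := fun K e => injective e)) => [//|]; exact: complexI.
Qed.

Lemma emb_eq0 x : (emb x == 0) = (x == 0).
Proof. by rewrite -emb0 (inj_eq emb_inj). Qed.

Lemma embV x : emb x^-1 = (emb x)^-1.
Proof.
have [->|x0] := eqVneq x 0; first by rewrite !(invr0, emb0).
apply: (@mulfI _ (emb x)); first by rewrite emb_eq0.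
by rewrite -embM !divff// ?emb1// emb_eq0.
Qed.

Lemma ler_emb x y : (emb x <= emb y) = (x <= y).
Proof. by rewrite !le_eqVlt ltr_emb (inj_eq emb_inj). Qed.

Lemma norm_real (z : K) : exists r, emb r = `|z|.
Proof.
apply: (embP (P := fun K e => forall z : K, exists r, e r = `|z|)) => z'.
  by exists `|z'|.
by eexists; rewrite normc_def.
Qed.

(** The absolute value of a scalar as a real number, so that all estimates
    take place in the ordered field [R]. *)
Definition nrm (z : K) : R := xget 0 [set r | emb r = `|z|].

Lemma nrmE z : emb (nrm z) = `|z|.
Proof.
by rewrite /nrm; case: xgetP => [x -> //|h]; have [r /h] := norm_real z.
Qed.

Lemma nrm_ge0 z : 0 <= nrm z.
Proof. by rewrite -ler_emb emb0 nrmE. Qed.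

Lemma nrm0 : nrm 0 = 0.
Proof. by apply: emb_inj; rewrite nrmE normr0 emb0. Qed.

Lemma nrm_eq0 z : (nrm z == 0) = (z == 0).
Proof. by rewrite -emb_eq0 nrmE normr_eq0. Qed.

Lemma nrmD x y : nrm (x + y) <= nrm x + nrm y.
Proof. by rewrite -ler_emb embD !nrmE ler_normD. Qed.

Lemma nrmN x : nrm (- x) = nrm x.
Proof. by apply: emb_inj; rewrite !nrmE normrN. Qed.

Lemma nrmB x y : nrm (x - y) <= nrm x + nrm y.
Proof. by rewrite -[nrm y]nrmN nrmD. Qed.

Lemma nrm_distC x y : nrm (x - y) = nrm (y - x).
Proof. by rewrite -nrmN opprB. Qed.

Lemma nrmM x y : nrm (x * y) = nrm x * nrm y.
Proof. by apply: emb_inj; rewrite embM !nrmE normrM. Qed.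

Lemma nrmV x : nrm x^-1 = (nrm x)^-1.
Proof. by apply: emb_inj; rewrite embV !nrmE normfV. Qed.

Lemma nrm_emb x : nrm (emb x) = `|x|.
Proof.
apply: emb_inj; rewrite nrmE.
apply: (embP (P := fun K e => `|e x| = e `|x|)) => //.
by rewrite normc_def /= expr0n addr0 sqrtr_sqr.
Qed.

(** In the order of R[i] positive elements are real. *)
Lemma emb_pos (e : K) : 0 < e -> exists2 r : R, 0 < r & emb r = e.
Proof.
move=> e0; exists (nrm e); last by rewrite nrmE gtr0_norm.
by rewrite -ltr_emb emb0 nrmE gtr0_norm.
Qed.

Lemma nrm_small0 z : (forall e, 0 < e -> nrm z <= e) -> z = 0.
Proof.
move=> h; apply/eqP; rewrite -nrm_eq0 eq_le nrm_ge0 andbT leNgt.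
apply/negP => z0; have := h (nrm z / 2) (divr_gt0 z0 (ltr0Sn _ 1)).
by apply/negP; rewrite -ltNge; lra.
Qed.

(** Real and imaginary part treat both kinds of scalars alike, if the imaginary
    part is taken to be 0 when K = R. *)
Lemma re_im_parts : exists re im : K -> R,
  [/\ forall a x y, re (emb a * x + y) = a * re x + re y,
      forall a x y, im (emb a * x + y) = a * im x + im y,
      forall z, `|re z| <= nrm z, forall z, `|im z| <= nrm z &
      forall z, nrm z <= `|re z| + `|im z|].
Proof.
suff : exists re im : K -> R,
  [/\ forall a x y, re (emb a * x + y) = a * re x + re y,
      forall a x y, im (emb a * x + y) = a * im x + im y,
      forall z, emb `|re z| <= `|z|, forall z, emb `|im z| <= `|z| &
      forall z, `|z| <= emb (`|re z| + `|im z|)].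
  move=> [re [im [h1 h2 h3 h4 h5]]]; exists re, im; split=> // z;
  by rewrite -ler_emb nrmE.
apply: (embP (P := fun K emb => exists re im : K -> R,
  [/\ forall a x y, re (emb a * x + y) = a * re x + re y,
      forall a x y, im (emb a * x + y) = a * im x + im y,
      forall z, emb `|re z| <= `|z|, forall z, emb `|im z| <= `|z| &
      forall z, `|z| <= emb (`|re z| + `|im z|)])).
  exists idfun, (fun=> 0); split=> //= *; rewrite ?mulr0 ?addr0//.
    by rewrite normr0.
  by rewrite normr0 addr0.
exists (@complex.Re R), (@complex.Im R); split.
- by move=> a [x1 x2] [y1 y2] /=; rewrite !mul0r subr0.
- by move=> a [x1 x2] [y1 y2] /=; rewrite !mul0r addr0.
- move=> z; rewrite normc_def lecR -sqrtr_sqr ler_wsqrtr//.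
  by rewrite lerDl sqr_ge0.
- move=> z; rewrite normc_def lecR -sqrtr_sqr ler_wsqrtr//.
  by rewrite lerDr sqr_ge0.
- move=> z; rewrite normc_def lecR.
  rewrite -[leRHS]ger0_norm ?addr_ge0// -[leRHS]sqrtr_sqr ler_wsqrtr//.
  rewrite sqrrD !real_normK ?num_real// lerD2r lerDl.
  by rewrite mulrn_wge0// mulr_ge0.
Qed.

Lemma nbhs_nrm (z : K^o) (A : set K^o) :
  nbhs z A <-> exists2 e : R, 0 < e & forall w, nrm (w - z) < e -> A w.
Proof.
split.
  move=> /(nbhs_ballP z A)[e /= /emb_pos[r r0 <-] h].
  exists r => // w wz; apply: h; rewrite -ball_normE /= -nrmE ltr_emb.
  by rewrite nrm_distC.
move=> [e e0 h]; apply/(nbhs_ballP z A); exists (emb e) => /=.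
  by rewrite -emb0 ltr_emb.
move=> w; rewrite -ball_normE /= -nrmE ltr_emb nrm_distC => wz; exact: h.
Qed.

Lemma cvg_nrmP T (F : set_system T) {FF : Filter F} (f : T -> K^o) (l : K^o) :
  f @ F --> l <-> forall e : R, 0 < e -> \forall x \near F, nrm (f x - l) < e.
Proof.
split=> [fl e e0|h A /nbhs_nrm[e e0 eA]].
  by apply: (fl [set w | nrm (w - l) < e]); apply/nbhs_nrm; exists e.
by apply: filterS (h e e0) => x; exact: eA.
Qed.

Lemma entourage_nrm (E : set (K^o * K^o)) :
  entourage E <-> exists2 e : R, 0 < e & forall z w, nrm (w - z) < e -> E (z, w).
Proof.
rewrite -entourage_ballE; split.
  move=> [e /= /emb_pos[r r0 <-] h].
  exists r => // z w wz; apply: h; rewrite -ball_normE /= -nrmE ltr_emb.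
  by rewrite nrm_distC.
move=> [e e0 h]; exists (emb e) => /=; first by rewrite -emb0 ltr_emb.
move=> [z w] /=; rewrite -ball_normE /= -nrmE ltr_emb nrm_distC => wz; exact: h.
Qed.

End Scalars.

(** * Smooth functions *)

Section Calculus.
Context {R : realType} {K : numFieldType} {emb : R -> K}.
Context {hK : scalar_field emb} {d : nat}.
Local Notation V := 'rV[R]_d.
Local Notation dquot := (@dquot R K emb d).
Local Notation partial := (@partial R K emb d).
Local Notation iter_partial := (@iter_partial R K emb d).
Local Notation smooth_on := (@smooth_on R K emb d).
Local Notation dir i := (delta_mx 0 i : V).
Local Notation pd i f x l :=
  (dquot i f x h @[h --> (0 : R)^'] --> (l : K^o)).
Implicit Types (U : set V) (f g : V -> K^o) (x y : V).

Lemma nbhs_rV x (A : set V) :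
  nbhs x A <->
  exists2 e : R, 0 < e & forall y, (forall i, `|y 0 i - x 0 i| < e) -> A y.
Proof.
split=> [/nbhs_ballP[e /= e0 h]|[e e0 h]].
  exists e => // y xy; apply: h; split=> // i j; rewrite (ord1 i).
  by rewrite -ball_normE /= distrC.
apply/nbhs_ballP; exists e => //= y [_ xy]; apply: h => i.
by have := xy 0 i; rewrite -ball_normE /= distrC.
Qed.

Lemma cvg_rV T (F : set_system T) {FF : Filter F} (f : T -> V) (l : V) :
  (forall i, f t 0 i @[t --> F] --> l 0 i) -> f @ F --> l.
Proof.
move=> h A /nbhs_rV[e e0 eA].
have : \forall t \near F, forall i, `|f t 0 i - l 0 i| < e.
  apply: filter_forall => i; have /cvgrPdist_lt/(_ e e0) := h i.
  by apply: filterS => t; rewrite distrC.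
by apply: filterS => t; exact: eA.
Qed.

Lemma addZdirE x i h j : (x + h *: dir i) 0 j = x 0 j + h * (j == i)%:R.
Proof. by rewrite !mxE eqxx /= eq_sym. Qed.

Lemma cvg_line x i : x + h *: dir i @[h --> (0 : R)] --> x.
Proof.
have -> : nbhs x = nbhs (x + (0 : R) *: dir i) by rewrite scale0r addr0.
by apply: cvgD; [exact: cvg_cst|apply: cvgZr_tmp; exact: cvg_id].
Qed.

Lemma cvg_line' x i : x + h *: dir i @[h --> (0 : R)^'] --> x.
Proof.
by apply: cvg_trans (@cvg_line x _); apply: cvg_app; exact: cvg_within.
Qed.

Lemma pd_lim i f x (l : K) : pd i f x l -> partial i f x = l.
Proof. by move=> h; apply/cvg_lim => //; exact: norm_hausdorff. Qed.

Lemma smooth_pd U i f x : smooth_on U f -> U° x -> pd i f x (partial i f x).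
Proof. by move=> fU Ux; have [_ /(_ i)] := fU x Ux [::]. Qed.

Lemma smooth_cont U f x : smooth_on U f -> U° x -> {for x, continuous f}.
Proof. by move=> fU Ux; have [] := fU x Ux [::]. Qed.

Lemma iter_partial_rcons s i f :
  iter_partial (rcons s i) f = iter_partial s (partial i f).
Proof. by rewrite /iter_partial foldr_rcons. Qed.

Lemma iter_partial_cat s t f :
  iter_partial (s ++ t) f = iter_partial s (iter_partial t f).
Proof. by rewrite /iter_partial foldr_cat. Qed.

Lemma smooth_iter U s f : smooth_on U f -> smooth_on U (iter_partial s f).
Proof. by move=> fU x Ux t; have := fU x Ux (t ++ s); rewrite iter_partial_cat. Qed.

Lemma smooth_partial U i f : smooth_on U f -> smooth_on U (partial i f).
Proof. exact: (@smooth_iter U [:: i]). Qed.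

Lemma smooth_sub U W f : U° `<=` W° -> smooth_on W f -> smooth_on U f.
Proof. by move=> UW fW x Ux; exact: fW (UW _ Ux). Qed.

(** Coinduction: to prove smoothness, choose a class of functions that contains
    its own partial derivatives, instead of computing iterated ones. *)
Lemma smooth_coind U (P : (V -> K^o) -> Prop) :
  (forall f, P f -> (forall x, U° x -> {for x, continuous f}) /\
     forall i, exists2 g, P g & forall x, U° x -> pd i f x (g x)) ->
  forall f, P f -> smooth_on U f.
Proof.
move=> h f Pf x Ux s.
have [g [Pg gE]] : exists g, P g /\
    forall y, U° y -> g y = iter_partial s f y.
  elim: s => [|i s [g [Pg gE]]]; first by exists f.
  have [_ /(_ i)[g' Pg' gg']] := h _ Pg; exists g'; split=> // y Uy.
  apply/esym/cvg_lim; first exact: norm_hausdorff.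
  by rewrite -(dquot_local emb i gE Uy); exact: gg'.
split; first by apply: (continuous_local gE Ux); have [/(_ x Ux)] := h _ Pg.
move=> i; rewrite -(dquot_local emb i gE Ux).
by have [_ /(_ i)[g' _ /(_ x Ux)]] := h _ Pg; move=> k; apply/cvg_ex; exists (g' x).
Qed.

Lemma pdD i f g x (l m : K) : pd i f x l -> pd i g x m -> pd i (f + g) x (l + m).
Proof.
move=> fl gm; have -> : dquot i (f + g) x = fun h => dquot i f x h + dquot i g x h.
  apply/funext => h; rewrite /dquot -scalerDr; congr (_ *: _).
  by rewrite -[(f + g) _]/(f _ + g _) -[(f + g) x]/(f x + g x) opprD addrACA.
exact: cvgD.
Qed.

Lemma pdB i f g x (l m : K) : pd i f x l -> pd i g x m ->
  pd i (fun y => f y - g y) x (l - m).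
Proof.
move=> fl gm; have -> : dquot i (fun y => f y - g y) x =
    fun h => dquot i f x h - dquot i g x h.
  by apply/funext => h; rewrite /dquot -scalerBr; congr (_ *: _); ring.
exact: cvgB.
Qed.

Lemma cvgMK T (F : set_system T) {FF : Filter F} (f g : T -> K) (a b : K) :
  f @ F --> (a : K^o) -> g @ F --> (b : K^o) -> f t * g t @[t --> F] --> (a * b : K^o).
Proof. exact: (@cvgM K). Qed.

Lemma pdM i f g x (l m : K) : {for x, continuous g} ->
  pd i f x l -> pd i g x m -> pd i (f * g) x (l * g x + f x * m).
Proof.
move=> gc fl gm; have -> : dquot i (f * g) x =
    fun h => (dquot i f x h : K) * g (x + h *: dir i) + (f x : K) * dquot i g x h.
  apply/funext => h; rewrite /dquot -[(f * g) _]/(f _ * g _ : K) -[(f * g) x]/(f x * g x : K).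
  by rewrite /GRing.scale /=; ring.
apply: (@cvgD _ K^o); last by apply: cvgMK => //; exact: cvg_cst.
apply: cvgMK => //; exact: (@cvg_comp _ _ _ (fun h => x + h *: dir i) g _ _ _ (@cvg_line' x i) gc).
Qed.

Lemma pd_cst i (c : K^o) x : pd i (fun=> c) x 0.
Proof. by rewrite /dquot; under eq_fun do rewrite subrr scaler0; exact: cvg_cst. Qed.

Lemma cvg_near_eq T (F : set_system T) {FF : Filter F} (f g : T -> K^o) (l : K^o) :
  (\forall t \near F, f t = g t) -> g @ F --> l -> f @ F --> l.
Proof.
move=> fg gl; apply: cvg_trans gl; apply: near_eq_cvg.
by apply: filterS fg => t ->.
Qed.

Lemma near0_neq : \forall h \near (0 : R)^', h != 0.
Proof. exact: nbhs_dnbhs_neq. Qed.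

Lemma pd_near i f x (l : K) :
  (\forall h \near (0 : R)^', dquot i f x h = l) -> pd i f x l.
Proof.
by move=> h; apply: cvg_near_eq h _; exact: cvg_cst.
Qed.

Lemma pd_coord i j x : pd i (fun z => emb (z 0 j)) x (j == i)%:R.
Proof.
apply: pd_near; apply: filterS near0_neq => h h0.
rewrite /dquot addZdirE embD addrC addKr /GRing.scale /= embM mulKf ?emb_eq0//.
exact: emb_nat.
Qed.

Lemma cvg_emb T (F : set_system T) {FF : Filter F} (f : T -> R) (l : R) :
  f @ F --> l -> emb (f t) @[t --> F] --> (emb l : K^o).
Proof.
move=> /cvgrPdist_lt h; apply/cvg_nrmP => e /h; apply: filterS => t.
by rewrite -embB nrm_emb distrC.
Qed.

Lemma continuous_coord j : continuous (fun z : V => emb (z 0 j) : K^o).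
Proof.
move=> x; apply: (@cvg_emb _ (nbhs (x : V)) (nbhs_filter (x : V)) (fun z : V => z 0 j) (x 0 j)).
exact: (@coord_continuous R 1 d 0 j x).
Qed.

(** Partial derivatives of f often are sums of products of functions of the class
    of f, by the product and chain rules; the class has to be closed under these
    operations before [smooth_coind] applies. *)
Inductive generated (P : (V -> K^o) -> Prop) : (V -> K^o) -> Prop :=
| GenBase f : P f -> generated P f
| GenAdd f g : generated P f -> generated P g -> generated P (f + g)
| GenMul f g : generated P f -> generated P g ->
    generated P ((f : V -> K) * (g : V -> K)).

Lemma generated_smooth U (P : (V -> K^o) -> Prop) :
  (forall f, P f -> (forall x, U° x -> {for x, continuous f}) /\
     forall i, exists2 g, generated P g & forall x, U° x -> pd i f x (g x)) ->
  forall f, generated P f -> smooth_on U f.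
Proof.
move=> h; apply: smooth_coind => f; elim=> {f} [f /h//|f g _ [fc fd] _ [gc gd]|
    f g Pf [fc fd] Pg [gc gd]]; split.
- by move=> x Ux; apply: (@continuousD _ K^o); [exact: fc|exact: gc].
- move=> i; have [[f' Pf' fE] [g' Pg' gE]] := (fd i, gd i).
  exists (f' + g'); first exact: GenAdd.
  by move=> x Ux; apply: pdD; [exact: fE|exact: gE].
- by move=> x Ux; apply: (@continuousM K); [exact: fc|exact: gc].
- move=> i; have [[f' Pf' fE] [g' Pg' gE]] := (fd i, gd i).
  exists ((f' : V -> K) * (g : V -> K) + (f : V -> K) * (g' : V -> K)).
    by apply: GenAdd; exact: GenMul.
  by move=> x Ux; apply: pdM; [exact: gc|exact: fE|exact: gE].
Qed.

Lemma smoothM U f g : smooth_on U f -> smooth_on U g ->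
  smooth_on U ((f : V -> K) * (g : V -> K)).
Proof.
move=> fU gU; apply: (@generated_smooth U (smooth_on U)).
  move=> u uU; split=> [x|i]; first exact: smooth_cont.
  exists (partial i u); first by apply: GenBase; exact: smooth_partial.
  by move=> x; exact: smooth_pd.
by apply: GenMul; exact: GenBase.
Qed.

Lemma smoothD U f g : smooth_on U f -> smooth_on U g -> smooth_on U (f + g).
Proof. by move=> fU gU; have := smooth_onP 1 fU gU; rewrite scale1r. Qed.

Lemma smoothZ U a f : smooth_on U f -> smooth_on U (a *: f).
Proof. by move=> fU; have := smooth_onP a fU (@smooth_on0 _ _ _ _ U); rewrite addr0. Qed.

Lemma smoothN U f : smooth_on U f -> smooth_on U (- f).
Proof. by move=> fU; rewrite -scaleN1r; exact: smoothZ. Qed.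

Lemma smoothB U f g : smooth_on U f -> smooth_on U g -> smooth_on U (f - g).
Proof. by move=> fU gU; apply: smoothD => //; exact: smoothN. Qed.

Lemma smooth_cst U (c : K^o) : smooth_on U (fun=> c).
Proof.
apply: (@generated_smooth U (fun f => exists c, f = fun=> c)); last first.
  by apply: GenBase; exists c.
move=> _ [a ->]; split=> [x _|i]; first exact: cst_continuous.
exists (fun=> 0); first by apply: GenBase; exists 0.
by move=> x _; exact: pd_cst.
Qed.

Lemma smooth_coord U j : smooth_on U (fun z => emb (z 0 j)).
Proof.
apply: (@generated_smooth U (fun f => smooth_on U f \/ f = fun z => emb (z 0 j))).
  move=> f [fU|->]; split=> [x Ux|i].
  - exact: smooth_cont fU Ux.
  - exists (partial i f); first by apply: GenBase; left; exact: smooth_partial.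
    by move=> x; exact: smooth_pd.
  - exact: continuous_coord.
  - exists (fun=> (j == i)%:R); first by apply: GenBase; left; exact: smooth_cst.
    by move=> x _; exact: pd_coord.
by apply: GenBase; right.
Qed.

End Calculus.

(** * The mean value inequality and the symmetry of derivatives *)

Section MeanValue.
Context {R : realType} {K : numFieldType} {emb : R -> K}.
Context {hK : scalar_field emb} {d : nat}.
Local Notation V := 'rV[R]_d.
Local Notation nrm := (@nrm R K emb).
Local Notation dquot := (@dquot R K emb d).
Local Notation partial := (@partial R K emb d).
Local Notation iter_partial := (@iter_partial R K emb d).
Local Notation smooth_on := (@smooth_on R K emb d).
Local Notation dir i := (delta_mx 0 i : V).
Local Notation pd i f x l :=
  (dquot i f x h @[h --> (0 : R)^'] --> (l : K^o)).
Implicit Types (U : set V) (f g : V -> K^o) (x y : V).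

Lemma dnbhs0P (P : R -> Prop) :
  (\forall h \near (0 : R)^', P h) <->
  exists2 e : R, 0 < e & forall h, h != 0 -> `|h| < e -> P h.
Proof.
split.
  move=> /nbhs_ballP[e /= e0 h]; exists e => // t t0 te; apply: h => //.
  by rewrite -ball_normE /= sub0r normrN.
move=> [e e0 h]; apply/nbhs_ballP; exists e => //= t; rewrite -ball_normE /=.
by rewrite sub0r normrN => te t0; exact: h.
Qed.

Lemma pd_rescale i f x (l : K) (a : R) : pd i f x l ->
  (emb s)^-1 * (f (x + (s * a) *: dir i) - f x) @[s --> (0 : R)^'] -->
    (emb a * l : K^o).
Proof.
move=> /cvg_nrmP fl; apply/cvg_nrmP => e e0.
have [->|a0] := eqVneq a 0.
  apply: nearW => s; rewrite mulr0 scale0r addr0 subrr mulr0 emb0 mul0r subr0.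
  by rewrite nrm0.
have a0' : 0 < `|a| by rewrite normr_gt0.
have /fl/dnbhs0P[r r0 h] : 0 < e / `|a| by rewrite divr_gt0.
apply/dnbhs0P; exists (r / `|a|) => [|s s0 sr]; first by rewrite divr_gt0.
have := h (s * a); rewrite mulf_neq0// normrM -ltr_pdivlMr// => /(_ isT sr).
rewrite ltr_pdivlMr// mulrC -(nrm_emb (emb := emb)) -nrmM; congr (nrm _ < _).
rewrite mulrBr /dquot embM; congr (_ - _).
by rewrite /GRing.scale /=; field; rewrite !emb_eq0 s0 a0.
Qed.

Lemma mvt_real (u v : R -> R) (a b : R) : a <= b ->
  (forall t, a <= t <= b ->
     h^-1 * (u (t + h) - u t) @[h --> (0 : R)^'] --> v t) ->
  exists2 c, a <= c <= b & u b - u a = v c * (b - a).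
Proof.
move=> ab uv.
have du t : a <= t <= b -> is_derive (t : R) 1 u (v t).
  move=> tab; have ut := uv t tab.
  have E : (fun h : R => h^-1 *: ((u \o shift t) (h *: (1 : R)) - u t)) =
      (fun h => h^-1 * (u (t + h) - u t)).
    by apply/funext => h; rewrite /= /GRing.scale /= mulr1 addrC [t + h]addrC addrC.
  split; first by rewrite /derivable E; apply/cvg_ex; exists (v t).
  by rewrite /derive E; apply/cvg_lim => //; exact: ut.
have := @MVT_segment R u v a b ab; case.
- by move=> t; rewrite in_itv /= => /andP[/ltW ta /ltW tb]; apply: du; rewrite ta.
- apply: derivable_within_continuous => t; rewrite in_itv /= => tab.
  by have [] := du t tab.
- by move=> c; rewrite in_itv /= => cab ->; exists c.
Qed.

(** The mean value theorem fails for complex values; applied to the real and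
    imaginary parts it still yields this estimate. *)
Lemma mvt_ineq (u v : R -> K) (a b e : R) : a <= b ->
  (forall t, a <= t <= b ->
     (emb h)^-1 * (u (t + h) - u t) @[h --> (0 : R)^'] --> (v t : K^o)) ->
  (forall t, a <= t <= b -> nrm (v t) <= e) ->
  nrm (u b - u a) <= 2 * e * (b - a).
Proof.
move=> ab uv ve.
have [re [im [reP imP re_le im_le le_parts]]] := @re_im_parts R K emb hK.
have part (p : K -> R) :
    (forall a (x y : K), p (emb a * x + y) = a * p x + p y) ->
    (forall z, `|p z| <= nrm z) -> `|p (u b - u a)| <= e * (b - a).
  move=> pP ple.
  have p0 : p 0 = 0.
    have := pP 1 0 0; rewrite mulr0 addr0 mul1r => /eqP.
    by rewrite -subr_eq0 opprD addNKr oppr_eq0 => /eqP.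
  have pD (x y : K) : p (x + y) = p x + p y by have := pP 1 x y; rewrite emb1 !mul1r.
  have pZ t (x : K) : p (emb t * x) = t * p x by rewrite -[_ * x]addr0 pP p0 addr0.
  have pB (x y : K) : p (x - y) = p x - p y.
    by rewrite -[- y]mulN1r -(emb1 (emb := emb)) -embN pD pZ mulN1r.
  have [|c cab /= E] := @mvt_real (p \o u) (p \o v) a b ab; last first.
    rewrite pB E normrM [`|b - a|]ger0_norm ?subr_ge0// ler_wpM2r ?subr_ge0//.
    exact: le_trans (ple _) (ve c cab).
  move=> t /uv/cvg_nrmP h; apply/cvgrPdist_lt => r /h; apply: filterS => s sr.
  rewrite distrC; apply: le_lt_trans sr.
  by rewrite /= -pB -pZ embV -pB; exact: ple.
apply: le_trans (le_parts _) _.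
have := part re reP re_le; have := part im imP im_le; lra.
Qed.

(** First order expansion along a coordinate line: f minus its linear
    approximation has the derivative g - A along the line. *)
Lemma mvt_line i f (g : R -> K) x h (A : K) e :
  (forall t, 0 <= t <= 1 -> pd i f (x + (t * h) *: dir i) (g t)) ->
  (forall t, 0 <= t <= 1 -> nrm (g t - A) <= e) ->
  nrm (f (x + h *: dir i) - f x - emb h * A) <= 2 * e * `|h|.
Proof.
move=> fg ge.
pose u t : K := f (x + (t * h) *: dir i) - emb (t * h) * A.
pose v t : K := emb h * (g t - A).
have := @mvt_ineq u v 0 1 (e * `|h|) ler01; rewrite subr0 mulr1 mulrA.
rewrite /u !mul1r !mul0r scale0r addr0 emb0 mul0r subr0 addrAC; apply.
  move=> t t01; rewrite /v mulrBr.
  have E s : s != 0 -> (emb s)^-1 * (u (t + s) - u t) =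
    (emb s)^-1 * (f (x + (t * h) *: dir i + (s * h) *: dir i) -
      f (x + (t * h) *: dir i)) - emb h * A.
    move=> s0; rewrite /u mulrDl scalerDl addrA embD !embM.
    by field; rewrite emb_eq0.
  apply: (cvg_near_eq (g := fun s => (emb s)^-1 *
    (f (x + (t * h) *: dir i + (s * h) *: dir i) -
      f (x + (t * h) *: dir i)) - emb h * A)).
    by apply: filterS near0_neq => s /E.
  by apply: (@cvgB _ K^o); [exact: pd_rescale (fg t t01)|exact: cvg_cst].
move=> t t01; rewrite /v nrmM nrm_emb mulrC ler_wpM2r//; exact: ge.
Qed.

Lemma near_box x (P : set V) : nbhs x P ->
  exists2 e : R, 0 < e & forall i j s t, `|s| <= e -> `|t| <= e ->
    P (x + s *: dir i + t *: dir j).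
Proof.
move=> /nbhs_rV[r r0 rP]; exists (r / 3) => [|i j s t sr tr].
  by rewrite divr_gt0.
apply: rP => k; rewrite !addZdirE.
rewrite [X in `|X|](_ : _ = s * (k == i)%:R + t * (k == j)%:R); last by ring.
have b01 (b : bool) (z : R) : `|z * b%:R| <= `|z|.
  by case: b; rewrite ?mulr1// mulr0 normr0.
apply: le_lt_trans (ler_normD _ _) _.
have := b01 (k == i) s; have := b01 (k == j) t; lra.
Qed.

(** The mean value inequality, first in the direction i for the difference of f in
    the direction j, then in the direction j for the partial derivative of f. *)
Lemma second_difference U i j f x e : smooth_on U f -> U° x -> 0 < e ->
  \forall h \near (0 : R)^',
    nrm (f (x + h *: dir i + h *: dir j) - f (x + h *: dir i)
      - f (x + h *: dir j) + f x - emb (h ^+ 2) * partial j (partial i f) x)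
      <= 4 * e * h ^+ 2.
Proof.
move=> fU Ux e0; pose B := partial j (partial i f) x.
have fi := smooth_partial i fU.
have : nbhs x [set y | U° y /\ nrm (partial j (partial i f) y - B) <= e].
  apply: filterI.
    by apply: open_nbhs_nbhs; split=> //; exact: open_interior.
  have /cvg_nrmP/(_ e e0) := smooth_cont (smooth_partial j fi) Ux.
  by apply: filterS => y /ltW.
move=> /near_box[r r0 rP]; apply/dnbhs0P; exists r => // h h0 /ltW hr.
have tr t : 0 <= t <= 1 -> `|t * h| <= r.
  move=> /andP[t0 t1]; apply: le_trans hr; rewrite normrM ger0_norm//.
  by rewrite ler_piMl.
pose F y : K := f (y + h *: dir j) - f y.
have := @mvt_line i F (fun t => partial i f (x + (t * h) *: dir i + h *: dir j)
  - partial i f (x + (t * h) *: dir i)) x h (emb h * B) (2 * e * `|h|).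
rewrite /F (_ : 2 * (2 * e * `|h|) * `|h| = 4 * e * h ^+ 2); last first.
  by rewrite -(real_normK (num_real h)); ring.
rewrite mulrA -embM -expr2 => H.
rewrite (_ : _ - _ + f x = f (x + h *: dir i + h *: dir j) -
  f (x + h *: dir i) - (f (x + h *: dir j) - f x)); last by ring.
apply: H => t /tr th; have Px s : `|s| <= r -> _ := fun sr => rP i j (t * h) s th sr.
  have U0 : U° (x + (t * h) *: dir i).
    have : `|0 : R| <= r by rewrite normr0 ltW.
    by move=> /Px[+ _]; rewrite scale0r addr0.
  have [U1 _] := Px h hr.
  apply: (pdB (f := fun y => f (y + h *: dir j)) (g := f));
    last exact: smooth_pd fU U0.
  have -> : dquot i (fun y => f (y + h *: dir j)) (x + (t * h) *: dir i) =
      dquot i f (x + (t * h) *: dir i + h *: dir j).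
    by apply/funext => s; rewrite /dquot addrAC.
  exact: smooth_pd fU U1.
apply: (@mvt_line j (partial i f)
  (fun s => partial j (partial i f) (x + (t * h) *: dir i + (s * h) *: dir j))).
  by move=> s /tr sh; apply: (smooth_pd fi); exact: (Px _ sh).1.
move=> s /tr sh; exact: (Px _ sh).2.
Qed.

(** Schwarz: both mixed derivatives are limits of the same second difference
    quotient. *)
Lemma partialC U i j f x : smooth_on U f -> U° x ->
  partial i (partial j f) x = partial j (partial i f) x.
Proof.
move=> fU Ux; apply/eqP; rewrite -subr_eq0; apply/eqP.
apply: (@nrm_small0 _ _ emb) => e e0.
have e8 : 0 < e / 8 by rewrite divr_gt0.
have H1 := @second_difference U i j f x _ fU Ux e8.
have H2 := @second_difference U j i f x _ fU Ux e8.
have [h [[h0 {}H1] {}H2]] := filter_ex (filterI (filterI near0_neq H1) H2).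
have h2 : 0 < h ^+ 2 by rewrite exprn_even_gt0.
move: H1 H2; rewrite [x + h *: dir j + h *: dir i]addrAC.
move: (partial i (partial j f) x) (partial j (partial i f) x) => A B.
move: (f (x + _ + _)) (f (x + h *: dir i)) (f (x + h *: dir j)) (f x).
move=> a b c k H1 H2.
rewrite -(ler_pM2r h2) -[X in _ * X <= _](ger0_norm (ltW h2)).
rewrite -(nrm_emb (emb := emb)) -nrmM.
rewrite (_ : (A - B) * _ = (a - b - c + k - emb (h ^+ 2) * B) -
    (a - c - b + k - emb (h ^+ 2) * A)); last first.
  by move: (emb (h ^+ 2)) => t; rewrite mulrC; ring.
apply: le_trans (nrmB _ _) (le_trans (lerD H1 H2) _).
by rewrite le_eqVlt -subr_eq0; apply/orP; left; apply/eqP; field.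
Qed.

Lemma iter_partial_front U s i t f x : smooth_on U f -> U° x ->
  iter_partial (s ++ i :: t) f x = iter_partial (i :: s ++ t) f x.
Proof.
move=> fU; elim: s x => [//|j s ih] x Ux.
rewrite cat_cons [LHS]/= /partial (dquot_local emb j ih Ux) -/(partial _ _ _).
rewrite -[LHS]/(partial j (partial i (iter_partial (s ++ t) f)) x).
by rewrite (partialC _ _ (smooth_iter (s ++ t) fU)).
Qed.

Lemma iter_partial_perm U s t f x : smooth_on U f -> U° x -> perm_eq s t ->
  iter_partial s f x = iter_partial t f x.
Proof.
move=> fU; elim: s t x => [|i s ih] t x Ux st.
  by move: st; rewrite perm_sym => /perm_nilP ->.
have : i \in t by rewrite -(perm_mem st) mem_head.
move=> /splitPr H; case: H st => t1 t2 st.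
rewrite (@iter_partial_front U t1 i t2 f x fU Ux) /= /partial.
rewrite (@dquot_local _ _ emb _ U _ (iter_partial (t1 ++ t2) f))// => y Uy.
apply: ih => //; rewrite -(perm_cons i) (perm_trans st)//.
by rewrite -cat1s perm_catCA.
Qed.

End MeanValue.

(** * Flat functions *)

Section FlatFunctions.
Context {R : realType}.

(** The derivative of exp(-1/t) is a combination of t^-k exp(-1/t), and these
    functions have derivatives of the same kind, also at 0. *)
Definition flat (k : nat) (t : R) : R :=
  if 0 < t then t^-1 ^+ k * expR (- t^-1) else 0.

Lemma flat_gt0 t : 0 < t -> 0 < flat 0 t.
Proof. by move=> t0; rewrite /flat t0 expr0 mul1r expR_gt0. Qed.

Lemma flat_le0 k t : t <= 0 -> flat k t = 0.
Proof. by move=> t0; rewrite /flat ltNge t0. Qed.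

Lemma flatS k t : flat k.+1 t = t^-1 * flat k t.
Proof. by rewrite /flat; case: ifP; rewrite ?mulr0// exprS mulrA. Qed.

(** As exp(u) >= u^(k+1) / (k+1)! for u = 1/t > 0; this gives the derivative at 0. *)
Lemma flat_bound k t : `|flat k t| <= (k.+1)`!%:R * `|t|.
Proof.
rewrite /flat; case: ifPn => t0; last by rewrite normr0 mulr_ge0.
have u0 : 0 < t^-1 by rewrite invr_gt0.
rewrite !ger0_norm ?mulr_ge0 ?exprn_ge0 ?expR_ge0 ?(ltW u0) ?(ltW t0)//.
have f0 : 0 < (k.+1)`!%:R :> R by rewrite ltr0n fact_gt0.
have h : t^-1 ^+ k.+1 <= (k.+1)`!%:R * expR t^-1.
  rewrite mulrC -ler_pdivrMr//; apply: le_trans (expR_ge1Dxn k (ltW u0)).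
  by rewrite lerDr.
rewrite (_ : t^-1 ^+ k * _ = t^-1 ^+ k.+1 * expR (- t^-1) * t); last first.
  by rewrite exprS; field; rewrite gt_eqF.
by rewrite ler_pM2r// expRN ler_pdivrMr ?expR_gt0.
Qed.

Lemma is_derive_flat k t :
  is_derive (t : R) (1 : R) (flat k) (flat k.+2 t - k%:R * flat k.+1 t).
Proof.
have [t0|t0|->] := ltgtP t 0.
- apply: (@near_eq_is_derive _ _ _ (cst 0)).
    near=> s; rewrite flat_le0//; apply: ltW; near: s; exact: lt_nbhsl.
  by rewrite !flat_le0 ?ltW// mulr0 subrr; exact: is_derive_cst.
- apply: (@near_eq_is_derive _ _ _
     ((fun s => s^-1) ^+ k * (expR \o (- (fun s => s^-1))))).
    near=> s; rewrite /flat ifT; last by near: s; exact: lt_nbhsr.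
    by rewrite -[LHS]/(((fun s => s^-1) ^+ k) s * _) fctE /=.
  have dV : is_derive t 1 (fun s : R => s^-1) (- t ^- 2 *: (1 : R)).
    have t0' : t != 0 by rewrite gt_eqF.
    exact: (@is_deriveV R id t 1 1 t0' (is_derive_id _ _)).
  have dN := is_deriveN dV.
  have dE : is_derive ((- (fun s : R => s^-1)) t) 1 expR (expR (- t^-1)).
    exact: is_derive_expR.
  have H := is_deriveM (is_deriveX k dV) (is_derive1_comp dE dN).
  apply: (is_derive_eq H); rewrite !flatS /flat t0 /GRing.scale /= !fctE /= exprVn.
  case: k {H} => [|k]; first by rewrite /=; field; rewrite gt_eqF.
  rewrite /= -exprVn -!natr1 !exprS; field; by rewrite gt_eqF.
- suff h : (flat k (s + 0) - flat k 0) / s @[s --> (0 : R)^'] --> (0 : R).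
    have E : (fun h : R => h^-1 *: ((flat k \o shift 0) (h *: (1 : R)) - flat k 0)) =
        (fun s => (flat k (s + 0) - flat k 0) / s).
      by apply/funext => s; rewrite /= /GRing.scale /= mulr1 mulrC.
    rewrite !flat_le0// mulr0 subrr; split.
      by rewrite /derivable E; apply/cvg_ex; exists 0.
    by rewrite /derive E; apply/cvg_lim.
  apply/cvgrPdist_lt => e e0.
  have f0 : 0 < (k.+2)`!%:R :> R by rewrite ltr0n fact_gt0.
  apply/dnbhs0P; exists (e / (k.+2)`!%:R); first by rewrite divr_gt0.
  move=> s s0 se; rewrite sub0r normrN addr0 (flat_le0 _ (lexx 0)) subr0.
  rewrite mulrC -flatS; apply: le_lt_trans (flat_bound _ _) _.
  by rewrite mulrC -ltr_pdivlMr.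
Unshelve. all: by end_near. Qed.

Lemma continuous_flat k : continuous (flat k).
Proof.
move=> t; apply: differentiable_continuous; apply/derivable1_diffP.
by have [] := is_derive_flat k t.
Qed.

(** Composing [flat 0] with itself gives a function that is constant on either
    side of [0, 1], without division of functions or integration. *)
Definition step (t : R) : R :=
  flat 0 (flat 0 1 - flat 0 (1 - t)) / flat 0 (flat 0 1).

Lemma step1 t : 1 <= t -> step t = 1.
Proof.
move=> t1; rewrite /step (flat_le0 _ (t := 1 - t)) ?subr_le0// subr0 divff//.
by rewrite gt_eqF// !flat_gt0.
Qed.

Lemma step0 t : t <= 0 -> step t = 0.
Proof.
move=> t0; rewrite /step flat_le0 ?mul0r// subr_le0 /flat.
rewrite ltr01 ifT; last by lra.
by rewrite !expr0 !mul1r ler_expR lerN2 invr1 invf_le1; lra.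
Qed.

End FlatFunctions.

Section Bumps.
Context {R : realType} {K : numFieldType} {emb : R -> K}.
Context {hK : scalar_field emb} {d : nat}.
Local Notation V := 'rV[R]_d.
Local Notation dquot := (@dquot R K emb d).
Local Notation smooth_on := (@smooth_on R K emb d).
Local Notation dir i := (delta_mx 0 i : V).
Implicit Types (U : set V) (x y : V).

(** Contains the plateau functions, as [flat k] is composed only with elements of
    the class; real-valued, so that the chain rule for [flat k] applies. *)
Inductive elementary : (V -> R) -> Prop :=
| ElemCst c : elementary (cst c)
| ElemCoord j : elementary (fun x => x 0 j)
| ElemAdd f g : elementary f -> elementary g -> elementary (fun x => f x + g x)
| ElemMul f g : elementary f -> elementary g -> elementary (fun x => f x * g x)
| ElemFlat k f : elementary f -> elementary (flat k \o f).

Lemma elementary_continuous u : elementary u -> continuous u.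
Proof.
elim=> {u} [c|j|f g _ fc _ gc|f g _ fc _ gc|k f _ fc] x.
- exact: cst_continuous.
- exact: (@coord_continuous R 1 d 0 j x).
- by apply: continuousD; [exact: fc|exact: gc].
- by apply: continuousM; [exact: fc|exact: gc].
- by apply: continuous_comp; [exact: fc|exact: continuous_flat].
Qed.

Lemma elementary_derive u i : elementary u ->
  exists2 v, elementary v &
    forall x, is_derive (0 : R) 1 (fun h => u (x + h *: dir i)) (v x).
Proof.
elim=> {u} [c|j|f g ef [f' ef' fd] eg [g' eg' gd]|
  f g ef [f' ef' fd] eg [g' eg' gd]|k f ef [f' ef' fd]].
- by exists (cst 0); [exact: ElemCst|move=> x; exact: is_derive_cst].
- exists (cst (j == i)%:R); first exact: ElemCst.
  move=> x; under eq_fun do rewrite addZdirE.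
  have := @is_deriveD _ _ _ (cst (x 0 j)) ((j == i)%:R \*: id) (0 : R) 1 _ _
    (is_derive_cst _ _ _) (is_deriveZ _ (is_derive_id _ _)).
  rewrite add0r [_%:R *: _]mulr1; congr (is_derive _ _ _ _).
  by apply/funext => h; rewrite -[LHS]/(x 0 j + (j == i)%:R * h) mulrC.
- exists (fun x => f' x + g' x); first exact: ElemAdd.
  by move=> x; exact: is_deriveD.
- exists (fun x => f x * g' x + g x * f' x).
    by apply: ElemAdd; exact: ElemMul.
  move=> x; have := is_deriveM (fd x) (gd x).
  by rewrite scale0r addr0.
- exists (fun x => (flat k.+2 (f x) + (- k%:R) * flat k.+1 (f x)) * f' x).
    apply: ElemMul => //; apply: (ElemAdd (f := flat k.+2 \o f)); first exact: ElemFlat.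
    by apply: (ElemMul (g := flat k.+1 \o f)); [exact: ElemCst|exact: ElemFlat].
  move=> x; have := is_derive_flat k (f (x + (0 : R) *: dir i)).
  move=> /is_derive1_comp /(_ (fd x)).
  by rewrite scale0r addr0 mulNr.
Qed.

Lemma elementary_smooth U u : elementary u -> smooth_on U (emb \o u).
Proof.
move=> eu; apply: (smooth_coind
  (P := fun f => exists2 u, elementary u & f = emb \o u)); last by exists u.
move=> _ [{eu}u eu ->]; split=> [x _|i].
  exact: (@cvg_emb _ _ _ _ _ (nbhs x) (nbhs_filter x) u (u x) (@elementary_continuous _ eu x)).
have [v ev uv] := elementary_derive i eu.
exists (emb \o v); first by exists v.
move=> x _; have [] := uv x; rewrite /derivable /derive => du dv.
have : h^-1 *: (u (x + h *: dir i) - u x) @[h --> (0 : R)^'] --> v x.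
  rewrite -dv; move: du; rewrite scale0r addr0 /=.
  by under eq_fun do rewrite addr0 [_ *: 1]mulr1.
move=> /cvg_emb; rewrite /dquot.
by under eq_fun do rewrite /GRing.scale /= embM embV embB.
Qed.

End Bumps.

(** * Boxes and cutoff functions *)

Section Cutoffs.
Context {R : realType} {K : numFieldType} {emb : R -> K}.
Context {hK : scalar_field emb} {d : nat}.
Local Notation V := 'rV[R]_d.
Local Notation smooth_on := (@smooth_on R K emb d).
Implicit Types (U L : set V) (f g : V -> K^o) (x y a : V).

Definition box a (r : R) : set V := [set x | forall i, `|x 0 i - a 0 i| < r].
Definition cbox a (r : R) : set V := [set x | forall i, `|x 0 i - a 0 i| <= r].

Lemma box_nbhs a r : 0 < r -> nbhs a (box a r).
Proof. by move=> r0; apply/nbhs_rV; exists r. Qed.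

Lemma nbhs_cbox x (A : set V) : nbhs x A -> exists2 r, 0 < r & cbox x r `<=` A.
Proof.
move=> /nbhs_rV[e e0 eA]; exists (e / 2); first by rewrite divr_gt0.
move=> y xy; apply: eA => i; apply: le_lt_trans (xy i) _.
by rewrite ltr_pdivrMr// ltr_pMr// ltr1n.
Qed.

Lemma box_open a r : open (box a r).
Proof.
rewrite openE => x ax; rewrite /interior.
apply: (@filter_forall _ _ (fun i => [set y : V | `|y 0 i - a 0 i| < r]) (nbhs x)).
move=> i; apply/nbhs_rV; exists (r - `|x 0 i - a 0 i|) => [|y /(_ i) xy /=].
  by rewrite subr_gt0.
rewrite (_ : _ - _ = y 0 i - x 0 i + (x 0 i - a 0 i)); last by ring.
by apply: le_lt_trans (ler_normD _ _) _; lra.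
Qed.

Lemma cbox_compact a r : compact (cbox a r).
Proof.
have -> : cbox a r = [set x : V | forall i, `[a 0 i - r, a 0 i + r]%classic (x ord0 i)].
  apply/seteqP; split=> x /= h i; have := h i; rewrite ?in_itv /=.
    by rewrite ler_distl.
  by rewrite ler_distl.
by apply: (@rV_compact R d (fun i => `[a 0 i - r, a 0 i + r]%classic)) => i; exact: segment_compact.
Qed.

(** T is a type of data to be remembered along with each box. *)
Lemma finite_box_cover (T : choiceType) (P : V -> R -> T -> Prop) L :
  compact L -> (forall x, L x -> exists r t, 0 < r /\ P x r t) ->
  exists l : seq (V * R * T),
    (forall p, p \in l -> 0 < p.1.2 /\ P p.1.1 p.1.2 p.2) /\
    forall x, L x -> exists2 p, p \in l & box p.1.1 p.1.2 x.
Proof.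
rewrite compact_cover => cL h.
pose D := [set p : V * R * T | 0 < p.1.2 /\ P p.1.1 p.1.2 p.2].
have [|x Lx|D' D'D LD'] := cL _ D (fun p => box p.1.1 p.1.2).
- by move=> p _; exact: box_open.
- have [r [t [r0 Pr]]] := h x Lx; exists (x, r, t) => //.
  by move=> i /=; rewrite subrr normr0.
exists (finmap.enum_fset D'); split.
  by move=> p pD; have /set_mem := D'D p pD.
by move=> x /LD'[p pD px]; exists p.
Qed.

(** The argument of [step] is at least 1 for |x_i - a_i| <= r and at most 0 for
    |x_i - a_i| >= 2 r. *)
Definition plateau a r x : K^o :=
  emb (\prod_i step ((4 * r ^+ 2 - (x 0 i - a 0 i) ^+ 2) / (3 * r ^+ 2))).

Lemma elementary_step (u : V -> R) :
  elementary u -> elementary (fun x => step (u x)).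
Proof.
move=> eu; apply: ElemMul; last exact: ElemCst.
apply: ElemFlat; apply: ElemAdd; first exact: ElemCst.
have -> : (fun x => - flat 0 (1 - u x)) = (fun x => -1 * flat 0 (1 - u x)).
  by apply/funext => x; rewrite mulN1r.
apply: ElemMul; first exact: ElemCst.
apply: (@ElemFlat _ _ 0%N (fun x => 1 - u x)); apply: ElemAdd; first exact: ElemCst.
have -> : (fun x => - u x) = (fun x => -1 * u x).
  by apply/funext => x; rewrite mulN1r.
by apply: ElemMul => //; exact: ElemCst.
Qed.

Lemma plateau_smooth U a r : smooth_on U (plateau a r).
Proof.
apply: elementary_smooth.
have E i : elementary
    (fun x => step ((4 * r ^+ 2 - (x 0 i - a 0 i) ^+ 2) / (3 * r ^+ 2))).
  apply: elementary_step; apply: ElemMul; last exact: ElemCst.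
  apply: ElemAdd; first exact: ElemCst.
  have -> : (fun x => - (x 0 i - a 0 i) ^+ 2) =
      (fun x => -1 * ((x 0 i - a 0 i) * (x 0 i - a 0 i))).
    by apply/funext => x; rewrite mulN1r expr2.
  apply: ElemMul; first exact: ElemCst.
  by apply: ElemMul; apply: ElemAdd; do ?[exact: ElemCst|exact: ElemCoord].
rewrite /plateau; elim: (index_enum _) => [|i s ih].
  by under eq_fun do rewrite big_nil; exact: ElemCst.
by under eq_fun do rewrite big_cons; exact: ElemMul.
Qed.

Lemma plateau1 a r x : 0 < r -> cbox a r x -> plateau a r x = 1.
Proof.
move=> r0 ax; rewrite /plateau big1 ?emb1// => i _; apply: step1.
rewrite ler_pdivlMr ?mulr_gt0 ?exprn_gt0// mul1r.
have : (x 0 i - a 0 i) ^+ 2 <= r ^+ 2.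
  by rewrite -(real_normK (num_real _)) lerXn2r ?nnegrE ?(ltW r0).
lra.
Qed.

Lemma plateau0 a r x : 0 < r -> ~ box a (2 * r) x -> plateau a r x = 0.
Proof.
move=> r0 /existsNP[i /negP]; rewrite -leNgt => ax.
rewrite /plateau (bigD1 i)//= step0 ?mul0r ?emb0//.
rewrite pmulr_lle0 ?invr_gt0 ?mulr_gt0 ?exprn_gt0// subr_le0.
rewrite (_ : 4 * r ^+ 2 = (2 * r) ^+ 2); last by ring.
rewrite -[leRHS](real_normK (num_real _)) lerXn2r ?nnegrE ?mulr_ge0//.
exact: ltW.
Qed.

Lemma smooth_glue U f : (forall x, U° x -> exists2 W, nbhs x W & smooth_on W f) ->
  smooth_on U f.
Proof. by move=> h x /h[W Wx fW]; exact: fW. Qed.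

Lemma smooth_eq U f g : (forall y, U° y -> f y = g y) -> smooth_on U f ->
  smooth_on U g.
Proof. exact: smooth_on_local. Qed.

(** Near each point the product is either zero or a product of smooth functions. *)
Lemma smooth_extension U (F : set V) f g :
  closed F -> F `<=` U° -> (forall x, ~ F x -> f x = 0) ->
  smooth_on setT f -> smooth_on U g -> smooth_on setT ((f : V -> K) * (g : V -> K)).
Proof.
move=> cF FU f0 fS gU; apply: smooth_glue => x _.
have [Ux|nUx] := pselect (U° x).
  exists U; first by [].
  by apply: smoothM => //; apply: smooth_sub fS => y _; rewrite interiorT.
exists (~` F).
  by apply: open_nbhs_nbhs; split; [exact: closed_openC|move/FU].
apply: smooth_eq (@smooth_on0 _ _ _ _ _) => y /interior_subset Fy.
by rewrite -[RHS]/((f y : K) * g y) f0// mul0r.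
Qed.

Section Lists.
Context {T : Type}.
Implicit Type l : seq (V * R * T).

(** A product over a list can be compared with the product over its prefixes, which
    cuts a function into finitely many pieces, one for each box. *)
Definition outside l x : K^o := \prod_(p <- l) (1 - (plateau p.1.1 p.1.2 x : K)).

Lemma outside_nil x : outside [::] x = 1.
Proof. by rewrite /outside big_nil. Qed.

Lemma outside_rcons l p x :
  outside (rcons l p) x = (outside l x : K) * (1 - (plateau p.1.1 p.1.2 x : K)).
Proof. by rewrite /outside big_rcons/= mulrC. Qed.

Lemma outside_smooth U l : smooth_on U (outside l).
Proof.
elim/last_ind: l => [|l p ih].
  have -> : outside [::] = fun=> 1 by apply/funext => x; rewrite outside_nil.
  exact: smooth_cst.
have -> : outside (rcons l p) = (outside l : V -> K) *
    ((fun=> 1) - (plateau p.1.1 p.1.2 : V -> K^o) : V -> K).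
  by apply/funext => x; rewrite outside_rcons.
by apply: smoothM => //; apply: smoothB; [exact: smooth_cst|exact: plateau_smooth].
Qed.

End Lists.

Lemma outside0 (T : eqType) (l : seq (V * R * T)) p x : p \in l -> 0 < p.1.2 ->
  cbox p.1.1 p.1.2 x -> outside l x = 0.
Proof.
move=> pl p0 px; rewrite /outside (big_rem p)//= plateau1//.
by rewrite subrr mul0r.
Qed.

Lemma outside1 (T : eqType) (l : seq (V * R * T)) x :
  (forall p, p \in l -> 0 < p.1.2 /\ ~ box p.1.1 (2 * p.1.2) x) -> outside l x = 1.
Proof.
move=> h; rewrite /outside big_seq big1// => p /h[p0 px].
by rewrite plateau0// subr0.
Qed.

Lemma cbox_closed a r : closed (cbox a r).
Proof. by apply: compact_closed; [exact: norm_hausdorff|exact: cbox_compact]. Qed.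

Lemma box_cbox a r : box a r `<=` cbox a r.
Proof. by move=> x h i; apply: ltW. Qed.

(** One minus the product of the functions 1 - plateau over a finite cover of L by
    boxes such that the boxes of twice the size are contained in U. *)
Lemma cutoff L U : compact L -> open U -> L `<=` U ->
  exists (f : V -> K^o) (W F : set V), [/\ smooth_on setT f,
    open W /\ L `<=` W, (forall x, W x -> f x = 1),
    compact F /\ F `<=` U & forall x, ~ F x -> f x = 0].
Proof.
move=> cL oU LU.
have [|l [lU lL]] := @finite_box_cover unit (fun a r _ => cbox a (2 * r) `<=` U) L cL.
  move=> x /LU Ux; have [r r0 rU] := nbhs_cbox (open_nbhs_nbhs (conj oU Ux)).
  exists (r / 2), tt; split; first by rewrite divr_gt0.
  by rewrite mulrC divfK.
exists (fun x => 1 - (outside l x : K)).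
exists (\bigcup_(p in [set` l]) box p.1.1 p.1.2).
exists (\bigcup_(p in [set` l]) cbox p.1.1 (2 * p.1.2)).
split.
- have -> : (fun x => 1 - (outside l x : K)) = (fun=> 1 : K^o) - outside l by [].
  by apply: smoothB; [exact: smooth_cst|exact: outside_smooth].
- split; first by apply: bigcup_open => p _; exact: box_open.
  by move=> x /lL[p pl px]; exists p.
- move=> x [p pl px]; rewrite (outside0 pl) ?subr0//; first by have [] := lU p pl.
  exact: box_cbox.
- split; last by move=> x [p /lU[_]]; exact.
  by rewrite bigcup_seq; apply: bigsetU_compact => p _; exact: cbox_compact.
- move=> x nFx; rewrite outside1 ?subrr// => p pl; split; first by have [] := lU p pl.
  by move=> /box_cbox px; apply: nFx; exists p.
Qed.

End Cutoffs.

(** * Initial topologies and topologies of uniform convergence *)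

Section InitialTopologies.

Lemma cvg_initial (S : choiceType) (T : topologicalType) (f : S -> T)
    (F : set_system S) (x : S) : Filter F ->
  f @ F --> f x -> F --> (x : initial_topology f).
Proof.
move=> FF fx U [_ /= [[W oW <-] Wx] sU]; apply: filterS sU _.
by apply: fx; exact: open_nbhs_nbhs.
Qed.

Lemma cvg_prod_topology (I : Type) (T : I -> topologicalType)
    (F : set_system (forall i, T i)) (f : forall i, T i) : Filter F ->
  (forall i, (fun g => g i) @ F --> f i) -> F --> (f : prod_topology T).
Proof. by move=> FF h; apply/cvg_sup => i; apply: cvg_initial; exact: h. Qed.

(** The entourages of this form generate the uniform structure. *)
Lemma family_entourage_sub (U : choiceType) (V : uniformType)
    (fam : set U -> Prop) (G : set_system ((U -> V) * (U -> V))) : Filter G ->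
  (forall A E, fam A -> entourage E ->
     G [set fg | forall t, A t -> E (fg.1 t, fg.2 t)]) ->
  @entourage {family fam, U -> V} `<=` G.
Proof.
move=> FG h E [D [J _ <-] JE]; apply: filterS JE _ => /=.
apply: filter_bigI => -[[[A fA] P] /= /asboolP] + _.
rewrite /= uniform_entourage => -[Q entQ QP].
by apply: filterS (h A Q fA entQ) => -[f g] /= fg; exact: QP.
Qed.

Lemma family_entourage (U : choiceType) (V : uniformType)
    (fam : set U -> Prop) A E : fam A -> entourage E ->
  @entourage {family fam, U -> V} [set fg | forall t, A t -> E (fg.1 t, fg.2 t)].
Proof.
move=> fA entE; pose P := [set fg : (U -> V) * (U -> V) | forall t, A t -> E (fg.1 t, fg.2 t)].
have entP : @entourage {uniform` A -> V} P by rewrite uniform_entourage; exists E.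
exists P => //.
set D := [set: _].
have Pi : `[< @entourage {uniform` projT1 (existT fam A fA) -> V} P >] by apply/asboolP.
exact: (@finI_from1 _ _ D _ (exist _ (existT fam A fA, P) Pi) Logic.I).
Qed.

Lemma initial_entourage (S : choiceType) (U : uniformType) (f : S -> U) E :
  entourage E -> @entourage (initial_topology f) [set xy | E (f xy.1, f xy.2)].
Proof. by move=> entE; exists E. Qed.

End InitialTopologies.

(** * The topology of C^infty(U) *)

Section SmoothFunctions.
Context {R : realType} {K : numFieldType} {emb : R -> K}.
Context {hK : scalar_field emb} {d : nat}.
Local Notation V := 'rV[R]_d.
Local Notation nrm := (@nrm R K emb).
Local Notation smooth_on := (@smooth_on R K emb d).
Local Notation iter_partial := (@iter_partial R K emb d).
Implicit Types (U L : set V) (x y : V).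

Lemma smoothfun_smooth U (f : smoothfun emb U) : smooth_on U f.
Proof. by have /set_mem[] := valP f. Qed.

Lemma smoothfun_out U (f : smoothfun emb U) x : ~ U° x -> f x = 0.
Proof. by have /set_mem[_] := valP f; apply. Qed.

Lemma smoothfunP U (f g : smoothfun emb U) :
  (forall x, U° x -> f x = g x) -> f = g.
Proof.
move=> fg; apply/val_inj/funext => x /=.
by have [/fg//|nU] := pselect (U° x); rewrite !smoothfun_out.
Qed.

Lemma smoothfunDE U (f g : smoothfun emb U) x : (f + g) x = f x + g x.
Proof. by []. Qed.

Lemma smoothfunZE U a (f : smoothfun emb U) x : (a *: f) x = a * f x :> K.
Proof. by []. Qed.

Lemma smoothfunBE U (f g : smoothfun emb U) x : (f - g) x = f x - g x.
Proof. by []. Qed.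

Lemma iter_to_smooth U g s x : smooth_on U g -> U° x ->
  iter_partial s (to_smooth emb U g) x = iter_partial s g x.
Proof. by move=> gU Ux; apply: iter_partial_local Ux => y; exact: to_smoothE. Qed.

Lemma to_smooth_id U (f : smoothfun emb U) : to_smooth emb U f = f.
Proof. by apply: smoothfunP => x Ux; rewrite to_smoothE//; exact: smoothfun_smooth. Qed.

Lemma iter_partial0 s x : iter_partial s 0 x = 0.
Proof.
elim: s x => //= i s ih x; apply/cvg_lim; first exact: norm_hausdorff.
by rewrite /dquot; under eq_fun do rewrite !ih subrr scaler0; exact: cvg_cst.
Qed.

Lemma iter_smoothZ U a (f : smoothfun emb U) s x : U° x ->
  iter_partial s (a *: f) x = a * iter_partial s f x :> K.
Proof.
move=> Ux; have := iter_partialP a s (@smoothfun_smooth U f) (@smooth_on0 _ _ emb _ U) Ux.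
rewrite addr0 => ->; rewrite -[LHS]/(a * iter_partial s f x + iter_partial s 0 x).
by rewrite iter_partial0 addr0.
Qed.

Lemma iter_smoothD U (f g : smoothfun emb U) s x : U° x ->
  iter_partial s (f + g) x = iter_partial s f x + iter_partial s g x :> K.
Proof.
move=> Ux; have := iter_partialP 1 s (@smoothfun_smooth U f) (@smoothfun_smooth U g) Ux.
by rewrite !scale1r.
Qed.

Lemma iter_smoothB U (f g : smoothfun emb U) s x : U° x ->
  iter_partial s (f - g) x = iter_partial s f x - iter_partial s g x :> K.
Proof. by move=> Ux; rewrite iter_smoothD// -scaleN1r iter_smoothZ// mulN1r. Qed.

(** The bounds m for the seminorm of f given by L and k. As a relation it needs no
    supremum, and no finiteness of one. *)
Definition cn_le L (k : nat) (f : V -> K^o) (m : R) : Prop :=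
  forall s : seq 'I_d, (size s <= k)%N -> forall x, L x -> nrm (iter_partial s f x) <= m.

Lemma cn_le_trans L k f m m' : m <= m' -> cn_le L k f m -> cn_le L k f m'.
Proof. by move=> mm' h s sk x Lx; exact: le_trans (h s sk x Lx) mm'. Qed.

Lemma cn_le_sub L L' k k' f m : L `<=` L' -> (k <= k')%N ->
  cn_le L' k' f m -> cn_le L k f m.
Proof.
by move=> LL' kk' h s sk x Lx; apply: h; [exact: leq_trans sk kk'|exact: LL'].
Qed.

Lemma cn_leZ U L k (f : smoothfun emb U) a m : compacts_in U L ->
  cn_le L k f m -> cn_le L k (a *: f) (nrm a * m).
Proof.
move=> [_ LU] h s sk x Lx; rewrite iter_smoothZ ?nrmM; last exact: LU.
by rewrite ler_wpM2l ?nrm_ge0//; exact: h.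
Qed.

(** There are only finitely many derivatives up to a given order. *)
Lemma near_all_seq n k T (F : set_system T) (FF : Filter F)
    (P : seq 'I_n -> T -> Prop) : (forall s, \forall t \near F, P s t) ->
  \forall t \near F, forall s, (size s <= k)%N -> P s t.
Proof.
move=> h; pose J := {i : 'I_k.+1 & (i.-tuple 'I_n)}.
have := @filter_forall _ J (fun j => P (tagged j)) F FF (fun j => h (tagged j)).
apply: filterS => t ht s sk; have sk' : (size s < k.+1)%N by [].
exact: (ht (Tagged (fun i : 'I_k.+1 => i.-tuple 'I_n)
  (in_tuple s : (Ordinal sk').-tuple 'I_n))).
Qed.

Lemma smooth_nbhs U (f : smoothfun emb U) L k e : compacts_in U L -> 0 < e ->
  nbhs f [set g : smoothfun emb U | cn_le L k (g - f) e].
Proof.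
move=> cL e0; have H (s : seq 'I_d) : nbhs f
   [set g : smoothfun emb U | forall x, L x -> nrm (iter_partial s (g - f) x) <= e].
  have jc : {for f, continuous (fun f : smoothfun emb U => jet f s)}.
    apply: (@continuous_comp _ _ _ (@jet _ _ emb d U) (fun p => p s)).
      exact: (@initial_continuous _ _ (@jet R K emb d U)).
    exact: proj_continuous.
  have := @fam_nbhs _ K^o (compacts_in U) L [set zw | nrm (zw.2 - zw.1) < e]
    (iter_partial s f).
  have ent : entourage [set zw : K^o * K^o | nrm (zw.2 - zw.1) < e].
    by apply/entourage_nrm; exists e.
  move=> /(_ ent cL)/jc H; apply: (@filterS _ (nbhs f) (nbhs_filter f) _ _ _ H).
  move=> g gf x Lx.
  rewrite iter_smoothB ?ltW//; first exact: gf.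
  exact: (cL.2 x Lx).
by have := near_all_seq k (nbhs_filter f) H.
Qed.

(** The filter generated by the seminorms around f converges to f for each of the
    topologies from which that of C^infty(U) is made. *)
Lemma smooth_nbhs_basis U (f : smoothfun emb U) (W : set (smoothfun emb U)) :
  nbhs f W -> exists L k e, [/\ compacts_in U L, 0 < e &
    forall g, cn_le L k (g - f) e -> W g].
Proof.
pose D := [set p : set V * nat * R | compacts_in U p.1.1 /\ 0 < p.2].
pose B p := [set g : smoothfun emb U | cn_le p.1.1 p.1.2 (g - f) p.2].
have FF : Filter (filter_from D B).
  apply: filter_from_filter.
    exists (set0, 0%N, 1); split; last exact: ltr01.
    by split; [exact: compact0|exact: sub0set].
  move=> [[L k] e] [[L' k'] e'] [/= [cL LU] e0] [/= [cL' LU'] e0'].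
  exists (L `|` L', maxn k k', Num.min e e').
    split; last by rewrite /= lt_min e0.
    by split; [exact: compactU|rewrite subUset].
  move=> g /= h; split; apply: cn_le_trans (cn_le_sub _ _ h).
  - by rewrite ge_min lexx.
  - exact: subsetUl.
  - exact: leq_maxl.
  - by rewrite ge_min lexx orbT.
  - exact: subsetUr.
  - exact: leq_maxr.
suff cvF : filter_from D B --> f.
  by move=> /cvF[[[L k] e] [/= cL e0] BW]; exists L, k, e; split=> // g; exact: BW.
apply: cvg_initial; apply: cvg_prod_topology => s.
apply/fam_cvgP => L cL W' /uniform_nbhs[E [/entourage_nrm[e e0 eE] EW]].
exists (L, size s, e / 2); first by split=> //=; rewrite divr_gt0.
move=> g /= gf; apply: EW => x Lx; apply: eE; rewrite -iter_smoothB ?cL.2//.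
  by apply: le_lt_trans (gf s (leqnn _) x Lx) _; rewrite ltr_pdivrMr// ltr_pMr// ltr1n.
exact: (cL.2 x Lx).
Qed.

(** For linear u this is continuity, in a quantitative form that can be uniform over
    a set of functionals. *)
Definition dominated U L k (C : R) (u : smoothfun emb U -> K) : Prop :=
  forall (f : smoothfun emb U) m, 0 <= m -> cn_le L k f m -> nrm (u f) <= C * m.

Lemma dual_linear (E : preTopologicalLmodType K) (T : dual E) : linear (T : E -> K^o).
Proof. by have /set_mem[] := valP T. Qed.

Lemma dual_continuous (E : preTopologicalLmodType K) (T : dual E) :
  continuous (T : E -> K^o).
Proof. by have /set_mem[] := valP T. Qed.

Lemma dualD (E : preTopologicalLmodType K) (T : dual E) f g : T (f + g) = T f + T g.
Proof. by have := dual_linear T 1 f g; rewrite !scale1r. Qed.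

Lemma dual0 (E : preTopologicalLmodType K) (T : dual E) : T 0 = 0.
Proof. by apply: (addrI (T 0)); rewrite -dualD !addr0. Qed.

Lemma dualZ (E : preTopologicalLmodType K) (T : dual E) a f : T (a *: f) = a * T f :> K.
Proof. by have := dual_linear T a f 0; rewrite !addr0 dual0 addr0. Qed.

Lemma dualN (E : preTopologicalLmodType K) (T : dual E) f : T (- f) = - T f.
Proof. by rewrite -scaleN1r dualZ mulN1r. Qed.

Lemma dualB (E : preTopologicalLmodType K) (T : dual E) f g : T (f - g) = T f - T g.
Proof. by rewrite dualD dualN. Qed.

Lemma dual_scaleE (E : preTopologicalLmodType K) a (T : dual E) f :
  (a *: T) f = a * T f :> K.
Proof. by []. Qed.

Lemma dualP (E : preTopologicalLmodType K) (T S : dual E) :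
  (forall f, T f = S f) -> T = S.
Proof. by move=> h; apply/val_inj/funext. Qed.

(** By homogeneity; when the seminorm of f is 0, by scaling f up arbitrarily. *)
Lemma dominated_scaling U L k (u : smoothfun emb U -> K) e : compacts_in U L ->
  0 < e -> (forall a f, u (a *: f) = a * u f) ->
  (forall f : smoothfun emb U, cn_le L k f e -> nrm (u f) <= 1) ->
  dominated L k e^-1 u.
Proof.
move=> cL e0 uZ h f m m0 fm.
have {}h r : 0 < r -> m <= r -> nrm (u f) <= e^-1 * r.
  move=> r0 mr; have er0 : 0 < e / r by rewrite divr_gt0.
  have H : cn_le L k (emb (e / r) *: f) e -> e / r * nrm (u f) <= 1.
    by move=> /h; rewrite uZ nrmM nrm_emb (gtr0_norm er0).
  rewrite (_ : e^-1 * r = (e / r)^-1 * 1); last by rewrite invf_div mulr1 mulrC.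
  rewrite ler_pdivlMl//; apply: H; have := cn_leZ (emb (e / r)) cL fm.
  apply: cn_le_trans; rewrite nrm_emb (gtr0_norm er0).
  by rewrite -mulrA ler_piMr ?(ltW e0)// ler_pdivrMl// mulr1.
have [m00|m00] := ltrP 0 m; first exact: h.
have {m00 m0}m0 : m = 0 by apply/eqP; rewrite eq_le m00.
rewrite m0 mulr0; apply/ler_addgt0Pr => r r0; rewrite add0r.
have er0 : 0 < e * r by rewrite mulr_gt0.
by have := h _ er0; rewrite mulKf ?gt_eqF//; apply; rewrite m0 ltW.
Qed.

Lemma linear_continuous_dominated U (u : smoothfun emb U -> K^o) :
  linear u -> continuous u ->
  exists L k C, [/\ compacts_in U L, 0 <= C & dominated L k C u].
Proof.
move=> ul uc.
have u0 : u 0 = 0 by apply: (addrI (u 0)); have := ul 1 0 0; rewrite !scale1r !addr0.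
have uZ a f : u (a *: f) = a * u f by have := ul a f 0; rewrite !addr0 u0 addr0.
have : nbhs (0 : smoothfun emb U) [set f | nrm (u f) < 1].
  have /cvg_nrmP/(_ 1 ltr01) := uc 0.
  by apply: filterS => f; rewrite u0 subr0.
move=> /smooth_nbhs_basis[L [k [e [cL e0 h]]]]; exists L, k, e^-1; split=> //.
  by rewrite invr_ge0 ltW.
apply: dominated_scaling => // f fe; apply: ltW; apply: h.
by rewrite subr0.
Qed.

Lemma dual_dominated U (T : dual (smoothfun emb U)) :
  exists L k C, [/\ compacts_in U L, 0 <= C & dominated L k C T].
Proof.
apply: linear_continuous_dominated; [exact: dual_linear|exact: dual_continuous].
Qed.

Lemma dominated_continuous U (u : smoothfun emb U -> K^o) L k C :
  linear u -> compacts_in U L -> 0 <= C -> dominated L k C u -> continuous u.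
Proof.
move=> ul cL C0 uC f.
apply: (iffRL (@cvg_nrmP _ _ emb _ _ (nbhs f) (nbhs_filter f) u (u f))) => e e0.
have uB f' g' : u (f' - g') = u f' - u g'.
  by rewrite addrC -scaleN1r ul scaleN1r addrC.
have C1 : 0 < C + 1 by rewrite ltr_wpDl.
have e1 : 0 < e / (C + 1) by rewrite divr_gt0.
apply: (@filterS _ (nbhs f) (nbhs_filter f) _ _ _ (smooth_nbhs f k cL e1)) => g gf.
rewrite -uB; apply: le_lt_trans (uC _ _ (ltW e1) gf) _.
by rewrite mulrA ltr_pdivrMr// [C * e]mulrC ltr_pM2l// ltrDl.
Qed.

End SmoothFunctions.

(** * Bounded sets and the strong topology of a dual space *)

Section BoundedSets.
Context {R : realType} {K : numFieldType} {emb : R -> K}.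
Context {hK : scalar_field emb}.
Local Notation nrm := (@nrm R K emb).
Implicit Types E F : preTopologicalLmodType K.

Lemma bounded_absorb E (B : set E) (W : set E) : bounded_subset B -> nbhs 0 W ->
  exists2 r : R, 0 < r & forall f, B f -> exists2 w, W w & f = emb r *: w.
Proof.
move=> bB /bB[_ /(emb_pos (emb := emb))[r r0 <-] h]; exists r => // f Bf.
have er : emb r <= `|emb r| by rewrite -(nrmE (emb := emb)) ler_emb nrm_emb ler_norm.
by have [w Ww <-] := h _ er f Bf; exists w.
Qed.

Lemma absorb_bounded E (B : set E) :
  (forall W, nbhs 0 W -> exists2 r : R, 0 < r &
     forall t f, r <= nrm t -> B f -> W (t^-1 *: f)) -> bounded_subset B.
Proof.
move=> h W /h[r r0 rW]; exists (emb r); first by rewrite -(emb0 (emb := emb)) ltr_emb.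
move=> t; rewrite -(nrmE (emb := emb)) ler_emb => rt f Bf.
exists (t^-1 *: f); first exact: rW.
rewrite scalerA divff ?scale1r// -(nrm_eq0 (emb := emb)) gt_eqF//.
exact: lt_le_trans rt.
Qed.

Lemma bounded_subset0 E : bounded_subset (set0 : set E).
Proof. by move=> W _; exists 1 => // t _; exact: sub0set. Qed.

Lemma bounded_subsetU E (B B' : set E) :
  bounded_subset B -> bounded_subset B' -> bounded_subset (B `|` B').
Proof.
move=> bB bB' W W0; have [r r0 h] := bB W W0; have [r' r0' h'] := bB' W W0.
exists (r + r'); first exact: addr_gt0.
move=> t rt; rewrite subUset; split; [apply: h|apply: h']; apply: le_trans rt.
  by rewrite lerDl ltW.
by rewrite lerDr ltW.
Qed.

Lemma bounded_image E F (u : E -> F) (B : set E) :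
  (forall a f, u (a *: f) = a *: u f) -> {for 0, continuous u} ->
  bounded_subset B -> bounded_subset (u @` B).
Proof.
move=> uZ uc bB W W0.
have u0 : u 0 = 0 by rewrite -(scale0r 0) uZ scale0r.
have /bB[r r0 h] : nbhs 0 (u @^-1` W) by apply: uc; rewrite u0.
by exists r => // t /h tB _ [f /tB[w Ww <-] <-];  exists (u w) => //; rewrite uZ.
Qed.

Lemma dual_entourage E (B : set E) (e : R) : bounded_subset B -> 0 < e ->
  entourage [set TS : dual E * dual E | forall f, B f -> nrm (TS.2 f - TS.1 f) < e].
Proof.
move=> bB e0; apply: (@initial_entourage _ {family bounded_subset (E := E), E -> K^o}
  (@dual_fun K E) [set fg | forall t, B t -> nrm (fg.2 t - fg.1 t) < e]).
apply: (family_entourage (E := [set zw : K^o * K^o | nrm (zw.2 - zw.1) < e])) => //.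
by apply/entourage_nrm; exists e.
Qed.

Lemma dual_nbhs E (T : dual E) (B : set E) (e : R) : bounded_subset B -> 0 < e ->
  nbhs T [set S : dual E | forall f, B f -> nrm (S f - T f) < e].
Proof.
move=> bB e0; have := nbhs_entourage T (dual_entourage bB e0).
by apply: filterS => S /xsectionP.
Qed.

Lemma dual_entourage_basis E (X : set (dual E * dual E)) : entourage X ->
  exists B e, [/\ bounded_subset B, 0 < e & forall T S : dual E,
    (forall f, B f -> nrm (S f - T f) < e) -> X (T, S)].
Proof.
pose D := [set p : set E * R | bounded_subset p.1 /\ 0 < p.2].
pose G p := [set fg : (E -> K^o) * (E -> K^o) |
  forall f, p.1 f -> nrm (fg.2 f - fg.1 f) < p.2].
have FF : Filter (filter_from D G).
  apply: filter_from_filter.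
    by exists (set0, 1); split; [exact: bounded_subset0|exact: ltr01].
  move=> [B e] [B' e'] [/= bB e0] [/= bB' e0'].
  exists (B `|` B', Num.min e e').
    by split; [exact: bounded_subsetU|rewrite /= lt_min e0].
  by move=> fg /= h; split=> f /= Bf; [have := h f (or_introl Bf)|
    have := h f (or_intror Bf)]; rewrite lt_min => /andP[].
move=> [Y entY YX].
have /(_ _ entY)[[B e] [/= bB e0] BY] :
    @entourage {family bounded_subset (E := E), E -> K^o} `<=` filter_from D G.
  apply: family_entourage_sub => A P bA /entourage_nrm[e e0 eP].
  by exists (A, e) => // fg /= h t /h; exact: eP.
by exists B, e; split=> // T S h; apply: YX; exact: BY.
Qed.

Lemma dual_nbhs_basis E (T : dual E) (W : set (dual E)) : nbhs T W ->
  exists B e, [/\ bounded_subset B, 0 < e & forall S : dual E,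
    (forall f, B f -> nrm (S f - T f) < e) -> W S].
Proof.
rewrite -nbhs_entourageE => -[X /dual_entourage_basis[B [e [bB e0 BX]]] XW].
by exists B, e; split=> // S /BX XTS; apply: XW; apply/xsectionP.
Qed.

Lemma dual_boundedP E (B' : set (dual E)) : bounded_subset B' <->
  forall B : set E, bounded_subset B ->
    exists m, forall (T : dual E) f, B' T -> B f -> nrm (T f) <= m.
Proof.
split=> [bB' B bB|h].
  have [r r0 h] := bounded_absorb bB' (dual_nbhs 0 bB ltr01).
  exists r => T f /h[S + ->] Bf => /(_ f Bf); rewrite subr0 => Sf.
  rewrite dual_scaleE nrmM nrm_emb gtr0_norm// -[leRHS]mulr1.
  by rewrite ler_wpM2l ?(ltW r0)// ltW.
apply: absorb_bounded => W /dual_nbhs_basis[B [e [bB e0 BW]]].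
have [m hm] := h B bB; exists ((`|m| + 1) / e).
  by rewrite divr_gt0// ltr_wpDl.
move=> t T mt B'T; apply: BW => f Bf; rewrite subr0 dual_scaleE nrmM nrmV.
have t0 : 0 < nrm t by apply: lt_le_trans mt; rewrite divr_gt0// ltr_wpDl.
rewrite mulrC ltr_pdivrMr//; move: mt; rewrite ler_pdivrMr// mulrC => mt.
apply: lt_le_trans mt; have := hm T f B'T Bf; have := ler_norm m; lra.
Qed.

End BoundedSets.

Section BoundedSmooth.
Context {R : realType} {K : numFieldType} {emb : R -> K}.
Context {hK : scalar_field emb} {d : nat}.
Local Notation V := 'rV[R]_d.
Local Notation nrm := (@nrm R K emb).
Local Notation cn_le := (@cn_le R K emb d).
Implicit Types (U L : set V) (x y : V).

Lemma smooth_boundedP U (B : set (smoothfun emb U)) : bounded_subset B <->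
  forall L k, compacts_in U L -> exists m, forall f, B f -> cn_le L k f m.
Proof.
split=> [bB L k cL|h].
  have [r r0 h] := bounded_absorb (emb := emb) bB (smooth_nbhs 0 k cL ltr01).
  exists r => f /h[g /= + ->]; rewrite subr0 => /(cn_leZ (emb r) cL).
  by rewrite nrm_emb gtr0_norm// mulr1.
apply: absorb_bounded => W /smooth_nbhs_basis[L [k [e [cL e0 LW]]]].
have [m hm] := h L k cL; have m1 : 0 < `|m| + 1 by rewrite ltr_wpDl.
exists ((`|m| + 1) / e); first by rewrite divr_gt0.
move=> t f mt Bf; apply: LW; rewrite subr0.
have t0 : 0 < nrm t by apply: lt_le_trans mt; rewrite divr_gt0.
apply: cn_le_trans (cn_leZ t^-1 cL (hm f Bf)); rewrite nrmV mulrC ler_pdivrMr//.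
move: mt; rewrite ler_pdivrMr// mulrC => mt.
apply: le_trans mt; have := ler_norm m; lra.
Qed.

Lemma cont_nbhs U (f : contfun K U) L e : compacts_in U L -> 0 < e ->
  nbhs f [set g : contfun K U | forall x, L x -> nrm (g x - f x) < e].
Proof.
move=> cL e0; have ent : entourage [set zw : K^o * K^o | nrm (zw.2 - zw.1) < e].
  by apply/entourage_nrm; exists e.
have := @fam_nbhs V K^o (compacts_in U) L _ f ent cL.
exact: (@initial_continuous _ _ (@contfun_fun R K d U : _ ->
  {family compacts_in U, V -> K^o})).
Qed.

Lemma cont_bounded U (B : set (contfun K U)) L : bounded_subset B ->
  compacts_in U L -> exists m, forall f x, B f -> L x -> nrm (f x) <= m.
Proof.
move=> bB cL; have [r r0 h] := bounded_absorb (emb := emb) bB (cont_nbhs 0 cL ltr01).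
exists r => f x /h[g gW ->] Lx; rewrite -[_ x]/(emb r * g x) nrmM nrm_emb gtr0_norm//.
by have := gW x Lx; rewrite subr0 => /ltW; rewrite ger_pMr.
Qed.

End BoundedSmooth.

(** * Localization, restriction and support of distributions *)

Section Distributions.
Context {R : realType} {K : numFieldType} {emb : R -> K}.
Context {hK : scalar_field emb} {d : nat}.
Local Notation V := 'rV[R]_d.
Local Notation nrm := (@nrm R K emb).
Local Notation partial := (@partial R K emb d).
Local Notation iter_partial := (@iter_partial R K emb d).
Local Notation smooth_on := (@smooth_on R K emb d).
Local Notation cn_le := (@cn_le R K emb d).
Local Notation distr U := (dual (smoothfun emb U)).
Local Notation testfun := (smoothfun emb (@setT V)).
Local Notation distrT := (dual (smoothfun emb (@setT V))).
Local Notation outside := (@outside R K emb d _).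
Local Notation plateau := (@plateau R K emb d).
Implicit Types (U L : set V) (x y : V).

Lemma interior_open U : open U -> U° = U.
Proof. by move=> /interior_id. Qed.

Lemma cn_le_local U L k (f g : V -> K^o) m : L `<=` U° ->
  (forall y, U° y -> f y = g y) -> cn_le L k f m -> cn_le L k g m.
Proof.
move=> LU fg h s sk x Lx.
by rewrite -(iter_partial_local emb s fg (LU _ Lx)); exact: h.
Qed.

Lemma compact_bound L (f : V -> K^o) : compact L ->
  (forall x, L x -> {for x, continuous f}) ->
  exists2 m, 0 <= m & forall x, L x -> nrm (f x) <= m.
Proof.
move=> cL fc.
have [|l [l0 lL]] := @finite_box_cover R d R (fun a r m =>
   0 <= m /\ forall x, box a r x -> nrm (f x) <= m) L cL.
  move=> x Lx; have := fc x Lx; rewrite /prop_for /continuous_at => /(cvg_nrmP (emb := emb)).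
  move=> /(_ 1 ltr01)/nbhs_rV[e e0 h].
  exists e, (nrm (f x) + 1); split=> //; split; first by rewrite addr_ge0 ?nrm_ge0.
  move=> y xy; rewrite -{1}[f y](subrK (f x)).
  apply: le_trans (nrmD _ _) _; rewrite addrC lerD2l; apply: ltW; exact: h.
have s0 (s : seq (V * R * R)) : {subset s <= l} -> 0 <= \sum_(p <- s) p.2.
  by move=> sl; rewrite big_seq; apply: sumr_ge0 => p /sl/l0[_ []].
exists (\sum_(p <- l) p.2); first exact: s0.
move=> x /lL[p pl px]; rewrite (big_rem p)//=.
have [_ [_ /(_ x px)]] := l0 p pl; move/le_trans; apply.
by rewrite lerDl; apply: s0 => q; exact: mem_rem.
Qed.

Lemma partialM U i (f g : V -> K^o) x : smooth_on U f -> smooth_on U g -> U° x ->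
  partial i ((f : V -> K) * (g : V -> K)) x =
  ((partial i f : V -> K) * (g : V -> K) + (f : V -> K) * (partial i g : V -> K)) x.
Proof.
move=> fU gU Ux; apply: pd_lim; apply: pdM; first exact: smooth_cont gU Ux.
  exact: smooth_pd fU Ux.
exact: smooth_pd gU Ux.
Qed.

(** Induction on k with the Leibniz rule; C does not depend on f. *)
Lemma cn_mul U L k (p : V -> K^o) : smooth_on U p -> compacts_in U L ->
  exists2 C, 0 <= C & forall (f : V -> K^o) m, smooth_on U f -> 0 <= m ->
    cn_le L k f m -> cn_le L k ((p : V -> K) * (f : V -> K)) (C * m).
Proof.
move=> pU [cL LU]; elim: k p pU => [|k ih] p pU.
  have [C C0 pC] := @compact_bound L p cL (fun x Lx => smooth_cont pU (LU x Lx)).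
  exists C => // f m fU m0 fm s; rewrite leqn0 size_eq0 => /eqP -> x Lx.
  rewrite -[X in nrm X]/(p x * f x) nrmM.
  by apply: ler_pM; rewrite ?nrm_ge0//; [exact: pC|exact: (fm [::])].
have [C C0 hC] := ih p pU.
have /choice[D hD] i : exists D, 0 <= D /\
    forall (f : V -> K^o) m, smooth_on U f -> 0 <= m -> cn_le L k f m ->
    cn_le L k ((partial i p : V -> K) * (f : V -> K)) (D * m).
  by have [D D0 hD] := ih _ (smooth_partial i pU); exists D.
exists (C + \sum_i D i); first by rewrite addr_ge0// sumr_ge0// => i _; have [] := hD i.
move=> f m fU m0 fm s sk x Lx.
have CD : C <= C + \sum_i D i by rewrite lerDl sumr_ge0// => i _; have [] := hD i.
case/lastP: s sk => [|s i] sk.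
  have := hC f m fU m0 (cn_le_sub (@subset_refl _ _) (leqnSn k) fm) [::] (leq0n _) x Lx.
  by move/le_trans; apply; rewrite ler_wpM2r.
rewrite iter_partial_rcons; move: sk; rewrite size_rcons ltnS => sk.
pose f1 := (partial i p : V -> K) * (f : V -> K).
pose f2 := (p : V -> K) * (partial i f : V -> K).
have E : iter_partial s (partial i ((p : V -> K) * (f : V -> K))) x =
    iter_partial s f1 x + iter_partial s f2 x :> K.
  have f1U : smooth_on U f1 by apply: smoothM => //; exact: smooth_partial.
  have f2U : smooth_on U f2 by apply: smoothM => //; exact: smooth_partial.
  rewrite (@iter_partial_local _ _ emb _ U _ (1 *: f1 + f2))//; last exact: LU.
    by rewrite (iter_partialP 1 s f1U f2U) ?scale1r//; exact: LU.
  by move=> y Uy; rewrite (partialM i pU fU Uy) scale1r.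
rewrite E; apply: le_trans (nrmD _ _) _; rewrite addrC mulrDl.
have fi : cn_le L k (partial i f) m.
  by move=> t tk y Ly; rewrite -iter_partial_rcons; apply: fm => //; rewrite size_rcons.
have [Di0 hDi] := hD i.
apply: lerD; first exact: hC (smooth_partial i fU) m0 fi s sk x Lx.
apply: le_trans (hDi f m fU m0 (cn_le_sub (@subset_refl _ _) (leqnSn k) fm) s sk x Lx) _.
rewrite ler_wpM2r// (bigD1 i)//= lerDl sumr_ge0// => j _; by have [] := hD j.
Qed.

Lemma to_smoothP U a (f g : V -> K^o) : smooth_on U f -> smooth_on U g ->
  to_smooth emb U (a *: f + g) = a *: to_smooth emb U f + to_smooth emb U g.
Proof.
move=> fU gU; apply: smoothfunP => x Ux; rewrite to_smoothE//; last exact: smooth_onP.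
by rewrite smoothfunDE smoothfunZE !to_smoothE.
Qed.

Lemma smoothfun_sub U U' (f : smoothfun emb U) : U'° `<=` U° -> smooth_on U' f.
Proof. by move=> h; apply: smooth_sub h _; exact: smoothfun_smooth. Qed.

Lemma testfun_smooth U (f : testfun) : smooth_on U f.
Proof. by apply: smoothfun_sub => y _; rewrite interiorT. Qed.

Lemma restrE U (f : testfun) x : U° x -> to_smooth emb U f x = f x.
Proof. by move=> Ux; rewrite to_smoothE//; exact: testfun_smooth. Qed.

Definition MkDual (E : preTopologicalLmodType K) (u : E -> K^o)
  (ul : linear u) (uc : continuous u) : dual E :=
  @Dual K E u (mem_set (conj ul uc) : u \in dual_pred (E := E)).

(** All derivatives of the difference vanish on L. *)
Lemma dominated_germ U L k C (T : distr U) (f g : smoothfun emb U) W :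
  compacts_in U L -> dominated L k C T -> open W -> L `<=` W ->
  (forall x, W x -> f x = g x) -> T f = T g.
Proof.
move=> cL hT oW LW fg; apply/eqP; rewrite -subr_eq0 -dualB; apply/eqP.
apply: (nrm_small0 (emb := emb)) => e e0; apply: le_trans (ltW e0).
rewrite -(mulr0 C); apply: hT => // s sk x Lx.
have Wx : W° x by rewrite interior_open//; exact: LW.
have E y : W° y -> (0 : V -> K^o) y = (f - g) y.
  by move=> /interior_subset/fg; rewrite smoothfunBE => ->; rewrite subrr.
by rewrite -(iter_partial_local emb s E Wx) iter_partial0 nrm0.
Qed.

Definition extend_mul (chi : V -> K^o) U Y (g : smoothfun emb Y) : smoothfun emb U :=
  to_smooth emb U ((chi : V -> K) * (g : V -> K)).

(** [loc] is multiplication with a cutoff function for A in Y, and F is its compact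
    support, so that the derivatives of g on F control those of [loc g]. *)
Lemma localization U Y (A : set V) : open U -> open Y -> Y `<=` U ->
  compact A -> A `<=` Y ->
  exists (loc : smoothfun emb Y -> smoothfun emb U) (W F : set V),
    [/\ linear loc, [/\ open W, A `<=` W & W `<=` Y],
      forall g x, W x -> loc g x = g x, compacts_in Y F &
      forall k, exists2 C, 0 <= C & forall L, compacts_in U L ->
        forall (g : smoothfun emb Y) m, 0 <= m -> cn_le F k g m -> cn_le L k (loc g) (C * m)].
Proof.
move=> oU oY YU cA AY.
have [chi [W [F [chiS [oW AW] chi1 [cF FY] chi0]]]] := @cutoff R K emb _ d A Y cA oY AY.
have FY' : F `<=` Y° by rewrite interior_open.
have clF : closed F by apply: compact_closed => //; exact: norm_hausdorff.
have gU (g : smoothfun emb Y) : smooth_on U ((chi : V -> K) * (g : V -> K)).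
  apply: (@smooth_sub _ _ _ _ U setT); first by move=> y _; rewrite interiorT.
  apply: (smooth_extension clF FY' chi0 chiS); exact: smoothfun_smooth.
have gE (g : smoothfun emb Y) x : U x -> extend_mul chi U g x = chi x * g x :> K.
  by move=> Ux; rewrite /extend_mul to_smoothE// interior_open.
exists (fun g => extend_mul chi U (g : smoothfun emb Y)), (W `&` Y), F; split.
- move=> a f g; rewrite /extend_mul -to_smoothP//; congr (to_smooth emb U _).
  apply/funext => x; rewrite -[LHS]/(chi x * (a * f x + g x)).
  by rewrite -[RHS]/(a * (chi x * f x) + chi x * g x); ring.
- split; [exact: openI| |exact: subIsetr].
  by move=> x Ax; split; [exact: AW|exact: AY].
- by move=> g x [Wx Yx]; rewrite gE ?chi1 ?mul1r//; exact: YU.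
- by split.
move=> k; have chiY : smooth_on Y chi.
  by apply: smooth_sub chiS => y _; rewrite interiorT.
have [C C0 hC] := cn_mul k chiY (conj cF FY' : compacts_in Y F).
exists C => // L [_ LU] g m m0 gm s sk x Lx.
rewrite iter_to_smooth//; last exact: LU.
have [Fx|nFx] := pselect (F x).
  by apply: hC => //; exact: smoothfun_smooth.
have oF : open (~` F) by exact: closed_openC.
have E y : (~` F)° y -> (0 : V -> K^o) y = ((chi : V -> K) * (g : V -> K)) y.
  by move=> /interior_subset Fy; rewrite -[RHS]/(chi y * g y) chi0// mul0r.
rewrite -(iter_partial_local emb s E) ?interior_open//.
by rewrite iter_partial0 nrm0 mulr_ge0.
Qed.

Lemma dual_loc U Y (loc : smoothfun emb Y -> smoothfun emb U) (F : set V) (T : distr U) :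
  linear loc -> compacts_in Y F ->
  (forall k, exists2 C, 0 <= C & forall L, compacts_in U L ->
        forall (g : smoothfun emb Y) m, 0 <= m -> cn_le F k g m -> cn_le L k (loc g) (C * m)) ->
  exists S : distr Y, forall g, S g = T (loc g).
Proof.
move=> ll cF hF; have [L [k [C [cL C0 hT]]]] := dual_dominated T.
have [D D0 hD] := hF k.
have ul : linear (fun g => T (loc g) : K^o).
  by move=> a f g; rewrite ll dual_linear.
have uc : continuous (fun g => T (loc g) : K^o).
  apply: (dominated_continuous (k := k) (C := C * D) ul cF); first exact: mulr_ge0.
  move=> f m m0 fm; rewrite -mulrA; apply: hT; first exact: mulr_ge0.
  exact: hD.
by exists (MkDual ul uc).
Qed.

(** Near the compact sets on which S and S' are dominated, every element of
    C^infty(Y) agrees with a global smooth function. *)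
Lemma represents_unique Y (S S' : distr Y) (u : testfun -> K) : open Y ->
  represents S u -> represents S' u -> S = S'.
Proof.
move=> oY Su S'u; apply: dualP => g.
have [L [k [C [cL _ hS]]]] := dual_dominated S.
have [L' [k' [C' [cL' _ hS']]]] := dual_dominated S'.
have cLL : compact (L `|` L') by apply: compactU; [case: cL|case: cL'].
have LLY : L `|` L' `<=` Y.
  by rewrite subUset -[X in _ `<=` X /\ _](interior_open oY)
    -[X in _ /\ _ `<=` X](interior_open oY); split; [case: cL|case: cL'].
have [loc [W [F [_ [oW LW WY] locE _ _]]]] :=
  @localization setT Y _ openT oY (@subsetT _ _) cLL LLY.
have E x : W x -> g x = to_smooth emb Y (loc g) x.
  by move=> Wx; rewrite restrE ?locE// interior_open//; exact: WY.
rewrite (dominated_germ cL hS oW (subset_trans (@subsetUl _ _ _) LW) E).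
rewrite (dominated_germ cL' hS' oW (subset_trans (@subsetUr _ _ _) LW) E).
by rewrite -Su -S'u.
Qed.

Lemma dominated_supp (T : distrT) L k C : closed L -> compacts_in setT L ->
  dominated L k C T -> supp T `<=` L.
Proof.
move=> clL cL hT x sx; apply: contrapT => nLx; apply: sx.
exists (~` L) => //; split; first exact: closed_openC.
move=> f /= _ fL; rewrite -(dual0 T).
apply: (@dominated_germ setT L k C T f 0 (~` closure [set x | f x != 0]) cL hT).
- exact/closed_openC/closed_closure.
- by move=> y Ly /fL.
- move=> y /= ny; apply/eqP; apply: contrapT => /negP fy; apply: ny.
  exact: subset_closure.
Qed.

Lemma supp_compact (T : distrT) : compact (supp T).
Proof.
have [L [k [C [cL _ hT]]]] := dual_dominated T.
have clL : closed L by apply: compact_closed; [exact: norm_hausdorff|case: cL].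
apply: (@subclosed_compact _ _ L); [exact: closed_supp|by case: cL|].
exact: dominated_supp hT.
Qed.

Definition testmul (f : testfun) (p : V -> K^o) : testfun :=
  to_smooth emb setT ((f : V -> K) * (p : V -> K)).

Lemma testmulE f p x : smooth_on setT p -> testmul f p x = f x * p x :> K.
Proof.
move=> pS; rewrite to_smoothE ?interiorT//; apply: smoothM => //.
exact: smoothfun_smooth.
Qed.

(** A cutoff function makes the support of f compact and disjoint from supp T; then
    f is cut into pieces, each supported in a small box on which T vanishes. *)
Lemma supp_vanish (T : distrT) (f : testfun) W : open W -> supp T `<=` W ->
  (forall x, W x -> f x = 0) -> T f = 0.
Proof.
move=> oW TW f0; have [L [k [C [cL _ hT]]]] := dual_dominated T.
have [chi [W' [F [chiS [oW' LW'] chi1 [cF _] chi0]]]] :=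
  @cutoff R K emb _ d L setT cL.1 openT (@subsetT _ _).
have -> : T f = T (testmul f chi).
  apply: dominated_germ cL hT oW' LW' _ => x W'x.
  by rewrite testmulE// chi1// mulr1.
have cFW : compact (F `\` W).
  apply: (subclosed_compact _ cF); last by move=> x [].
  apply: closedI; last exact: open_closedC.
  by apply: compact_closed => //; exact: norm_hausdorff.
have [|l [l0 lF]] := @finite_box_cover R d unit
    (fun a r _ => exists2 W, vanishes_on T W & cbox a (2 * r) `<=` W) _ cFW.
  move=> x [_ nWx]; have : ~ supp T x by move=> /TW.
  move=> /contrapT[W1 [oW1 vW1] W1x].
  have [r r0 rW] := nbhs_cbox (open_nbhs_nbhs (conj oW1 W1x)).
  exists (r / 2), tt; split; first by rewrite divr_gt0.
  by exists W1 => //; rewrite mulrC divfK.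
suff H (s : seq (V * R * unit)) : {subset s <= l} ->
    T (testmul f chi) = T (testmul (testmul f chi) (outside s)).
  rewrite (H l)// -(dual0 T); congr (T _); apply: smoothfunP => x _.
  rewrite !testmulE//; last exact: outside_smooth.
  have [Fx|nFx] := pselect (F x); last by rewrite chi0// mulr0 mul0r.
  have [Wx|nWx] := pselect (W x); first by rewrite f0// !mul0r.
  have [p pl px] := lF x (conj Fx nWx).
  rewrite (outside0 pl) ?mulr0//; first by have [] := l0 p pl.
  exact: box_cbox.
elim/last_ind: s => [_|s p ih sl].
  congr (T _); apply: smoothfunP => x _.
  by rewrite [RHS]testmulE ?outside_nil ?mulr1//; exact: outside_smooth.
rewrite ih => [|q qs]; last by apply: sl; rewrite mem_rcons inE qs orbT.
have pl : p \in l by apply: sl; rewrite mem_rcons mem_head.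
apply/eqP; rewrite -subr_eq0 -dualB; apply/eqP.
have [p0 [W1 vW1 pW1]] := l0 p pl.
set g := _ - _; have gE x : g x =
    testmul f chi x * outside s x * plateau p.1.1 p.1.2 x :> K.
  rewrite smoothfunBE !testmulE; do ?[exact: outside_smooth|exact: chiS].
  by rewrite outside_rcons; ring.
move: g gE => g gE.
have gF : closure [set x | g x != 0] `<=` cbox p.1.1 (2 * p.1.2).
  rewrite [X in _ `<=` X](closure_id _).1; last exact: cbox_closed.
  apply: closure_subset => y /=; rewrite gE; apply: contraPP => npy.
  apply/negP; rewrite negbK.
  by rewrite plateau0 ?mulr0// => /box_cbox.
apply: vW1 => /=; last exact: subset_trans pW1.
apply: subclosed_compact gF; [exact: closed_closure|exact: cbox_compact].
Qed.

Lemma supp_germ (T : distrT) (f g : testfun) W : open W -> supp T `<=` W ->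
  (forall x, W x -> f x = g x) -> T f = T g.
Proof.
move=> oW TW fg; apply/eqP; rewrite -subr_eq0 -dualB; apply/eqP.
by apply: (supp_vanish oW TW) => x /fg; rewrite smoothfunBE => ->; rewrite subrr.
Qed.

(** S g is T applied to g localized near supp T. The second conclusion evaluates S
    on all those g that are smooth globally up to a change away from supp T. *)
Lemma extension_exists (T : distrT) U : open U -> supp T `<=` U ->
  exists2 S : distr U, represents S T &
    forall (g : smoothfun emb U) (G : testfun) W, open W -> supp T `<=` W ->
      (forall x, W x -> U x -> G x = g x) -> S g = T G.
Proof.
move=> oU TU.
have [loc [W [F [ll [oW TW WU] locE cF hF]]]] :=
  @localization setT U _ openT oU (@subsetT _ _) (@supp_compact T) TU.
have [S SE] := dual_loc T ll cF hF.
have H (g : smoothfun emb U) (G : testfun) W' : open W' -> supp T `<=` W' ->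
    (forall x, W' x -> U x -> G x = g x) -> S g = T G.
  move=> oW' TW' gG; rewrite SE; apply: (@supp_germ _ _ _ (W `&` W')).
  - exact: openI.
  - by move=> x Tx; split; [exact: TW|exact: TW'].
  - by move=> x [Wx W'x]; rewrite locE// gG//; exact: WU.
exists S => // f; apply/esym; apply: (H _ _ U oU TU) => x Ux _.
by rewrite restrE// interior_open.
Qed.

Lemma extension_represents (T : distrT) U : open U -> supp T `<=` U ->
  represents (extension U T) T.
Proof.
move=> oU TU; have [S ST _] := extension_exists oU TU.
by rewrite /extension; case: xgetP => [x _ //|/(_ S)].
Qed.

Lemma extensionE (T : distrT) U (g : smoothfun emb U) (G : testfun) W :
  open U -> supp T `<=` U -> open W -> supp T `<=` W ->
  (forall x, W x -> U x -> G x = g x) -> extension U T g = T G.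
Proof.
move=> oU TU oW TW gG; have [S ST SE] := extension_exists oU TU.
rewrite (represents_unique oU (extension_represents oU TU) ST).
exact: SE gG.
Qed.

End Distributions.

(** * The multiplication map of R^d *)

Section Product.
Context {R : realType} {K : numFieldType} {emb : R -> K}.
Context {hK : scalar_field emb} {d : nat}.
Local Notation V := 'rV[R]_d.
Local Notation V2 := 'rV[R]_(d + d).
Local Notation partial := (@partial R K emb _).
Local Notation smooth_on := (@smooth_on R K emb _).
Local Notation cn_le := (@cn_le R K emb _).
Local Notation dquot := (@dquot R K emb _).
Local Notation pd i f x l :=
  (dquot i f x h @[h --> (0 : R)^'] --> (l : K^o)).
Implicit Types (X Y Z L : set V) (W Q : set V2) (x y : V) (z : V2).

Lemma row_mx_line_l x y i (h : R) :
  row_mx x y + h *: delta_mx 0 (lshift d i) = row_mx (x + h *: delta_mx 0 i) y.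
Proof.
apply/rowP => k; rewrite !mxE; case: splitP => j kj; rewrite ?mxE ?eqxx /=.
  suff -> : (k == lshift d i) = (j == i) by [].
  apply/eqP/eqP => [kE|ji]; apply/val_inj; first by rewrite /= -kj kE.
  by rewrite /= kj ji.
rewrite (_ : (k == lshift d i) = false) ?mulr0 ?addr0//.
apply/eqP => kE; move: kj; rewrite kE /= => ij.
by have := ltn_ord i; rewrite ij -ltn_subRL subnn.
Qed.

Lemma row_mx_line_r x y i (h : R) :
  row_mx x y + h *: delta_mx 0 (rshift d i) = row_mx x (y + h *: delta_mx 0 i).
Proof.
apply/rowP => k; rewrite !mxE; case: splitP => j kj; rewrite ?mxE ?eqxx /=.
  rewrite (_ : (k == rshift d i) = false) ?mulr0 ?addr0//.
  apply/eqP => kE; move: kj; rewrite kE /= => ij.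
  by have := ltn_ord j; rewrite -ij -ltn_subRL subnn.
suff -> : (k == rshift d i) = (j == i) by [].
apply/eqP/eqP => [kE|ji]; last by apply/val_inj; rewrite /= kj ji.
by apply/val_inj/(@addnI d); rewrite -kj kE.
Qed.

Definition mulmap z : V := hadamard (lsubmx z) (rsubmx z).

Lemma mulmap_row x y : mulmap (row_mx x y) = hadamard x y.
Proof. by rewrite /mulmap row_mxKl row_mxKr. Qed.

Lemma hadamardC x y : hadamard x y = hadamard y x.
Proof. by apply/rowP => i; rewrite !mxE mulrC. Qed.

Lemma continuous_mulmap : continuous mulmap.
Proof.
move=> z; apply: (@cvg_rV _ _ _ (nbhs z) (nbhs_filter z)) => i.
have -> : (fun t => mulmap t 0 i) = (fun t : V2 => t 0 (lshift d i) * t 0 (rshift d i)).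
  by apply/funext => t; rewrite !mxE.
rewrite !mxE; apply: (@cvgM R); exact: (@coord_continuous R 1 (d + d) 0 _ z).
Qed.

Lemma mulmap_line_l x y i (h : R) : mulmap (row_mx x y + h *: delta_mx 0 (lshift d i)) =
  mulmap (row_mx x y) + (h * y 0 i) *: delta_mx 0 i.
Proof.
rewrite row_mx_line_l !mulmap_row; apply/rowP => j; rewrite !mxE !eqxx /=.
by case: eqP => [->|_]; rewrite ?mulr1 ?mulr0 ?addr0// mulrDl.
Qed.

Lemma mulmap_line_r x y i (h : R) : mulmap (row_mx x y + h *: delta_mx 0 (rshift d i)) =
  mulmap (row_mx x y) + (h * x 0 i) *: delta_mx 0 i.
Proof.
rewrite row_mx_line_r !mulmap_row; apply/rowP => j; rewrite !mxE !eqxx /=.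
by case: eqP => [->|_]; rewrite ?mulr1 ?mulr0 ?addr0// mulrDr [h * _]mulrC.
Qed.

(** Moving the k-th coordinate of (x, y) moves one coordinate of the product xy, by
    a multiple that is the same coordinate of the other factor. *)
Definition fold_dir (k : 'I_(d + d)) : 'I_d :=
  match fintype.split k with inl i => i | inr i => i end.
Definition other_dir (k : 'I_(d + d)) : 'I_(d + d) :=
  match fintype.split k with inl i => rshift d i | inr i => lshift d i end.

Lemma mulmap_line z k (h : R) : mulmap (z + h *: delta_mx 0 k) =
  mulmap z + (h * z 0 (other_dir k)) *: delta_mx 0 (fold_dir k).
Proof.
rewrite /other_dir /fold_dir -[z]hsubmxK; case: splitP => i ki.
  have -> : k = lshift d i by exact: val_inj.
  by rewrite mulmap_line_l row_mxEr.
have -> : k = rshift d i by exact: val_inj.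
by rewrite mulmap_line_r row_mxEl.
Qed.

Lemma pd_mulmap k (f : V -> K^o) z (l : K) : pd (fold_dir k) f (mulmap z) l ->
  pd k (f \o mulmap) z (emb (z 0 (other_dir k)) * l).
Proof.
move=> fl; apply: cvg_near_eq (pd_rescale (a := z 0 (other_dir k)) fl).
by apply: nearW => h; rewrite /dquot /= mulmap_line.
Qed.

Lemma open_mulmap Z : open Z -> open (mulmap @^-1` Z).
Proof. by move=> oZ; apply: open_comp => // z _; exact: continuous_mulmap. Qed.

Lemma smooth_mulmap Z (f : V -> K^o) : open Z -> smooth_on Z f ->
  smooth_on (mulmap @^-1` Z) (f \o mulmap).
Proof.
move=> oZ fZ; have iZ := interior_open oZ; have iZ' := interior_open (open_mulmap oZ).
apply: (generated_smooth (P := fun g => smooth_on (mulmap @^-1` Z) g \/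
  exists2 f, smooth_on Z f & g = f \o mulmap)); last by apply: GenBase; right; exists f.
move=> g [gS|[{fZ}f fZ ->]]; split=> [z Zz|k].
- exact: smooth_cont gS Zz.
- exists (partial k g); last by move=> z; exact: smooth_pd.
  by apply: GenBase; left; exact: smooth_partial.
- rewrite iZ' in Zz; apply: continuous_comp; first exact: continuous_mulmap.
  by apply: (smooth_cont fZ); rewrite iZ.
- exists ((fun z => emb (z 0 (other_dir k))) * ((partial (fold_dir k) f \o mulmap) : V2 -> K)).
    apply: GenMul; apply: GenBase; first by left; exact: smooth_coord.
    by right; exists (partial (fold_dir k) f) => //; exact: smooth_partial.
  move=> z; rewrite iZ' => Zz; apply: pd_mulmap; apply: smooth_pd fZ _.
  by rewrite iZ.
Qed.

Lemma partial_mulmap Z k (f : V -> K^o) z : open Z -> smooth_on Z f -> Z (mulmap z) ->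
  partial k (f \o mulmap) z = emb (z 0 (other_dir k)) * partial (fold_dir k) f (mulmap z).
Proof.
move=> oZ fZ Zz; apply: pd_lim; apply: pd_mulmap; apply: (smooth_pd fZ).
by rewrite interior_open.
Qed.

(** Induction on k with the chain rule of [partial_mulmap]; C does not depend on f. *)
Lemma cn_mulmap Z Q k : open Z -> compact Q -> Q `<=` mulmap @^-1` Z ->
  exists2 C, 0 <= C & forall (f : V -> K^o) m, smooth_on Z f -> 0 <= m ->
    cn_le (mulmap @` Q) k f m -> cn_le Q k (f \o mulmap) (C * m).
Proof.
move=> oZ cQ QZ; have iZ' := interior_open (open_mulmap oZ).
have cQ' : compacts_in (mulmap @^-1` Z) Q by split; rewrite ?iZ'.
elim: k => [|k [C C0 hC]].
  exists 1 => // f m fZ m0 fm s; rewrite leqn0 size_eq0 => /eqP -> z Qz.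
  by rewrite mul1r; apply: (fm [::]) => //; exists z.
have /choice[D hD] j : exists D, 0 <= D /\
    forall (f : V2 -> K^o) m, smooth_on (mulmap @^-1` Z) f -> 0 <= m -> cn_le Q k f m ->
    cn_le Q k ((fun z => emb (z 0 (other_dir j))) * (f : V2 -> K)) (D * m).
  by have [D D0 hD] := cn_mul k (@smooth_coord R K emb _ _ (mulmap @^-1` Z) (other_dir j)) cQ'; exists D.
have s0 : 0 <= \sum_j D j by rewrite sumr_ge0// => i _; have [] := hD i.
exists (C + \sum_j D j * C).
  by rewrite -mulr_suml addr_ge0// mulr_ge0.
move=> f m fZ m0 fm s sk z Qz.
case/lastP: s sk => [|s j] sk.
  have := hC f m fZ m0 (cn_le_sub (@subset_refl _ _) (leqnSn k) fm) [::] (leq0n _) z Qz.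
  move/le_trans; apply; rewrite ler_wpM2r// lerDl -mulr_suml mulr_ge0//.
rewrite iter_partial_rcons; move: sk; rewrite size_rcons ltnS => sk.
have Zz : (mulmap @^-1` Z)° z by apply: cQ'.2.
have E (y : V2) : (mulmap @^-1` Z)° y -> partial j (f \o mulmap) y =
  ((fun z => emb (z 0 (other_dir j))) * ((partial (fold_dir j) f \o mulmap) : V2 -> K)) y.
  by rewrite iZ' => Zy; rewrite (partial_mulmap _ oZ fZ).
rewrite (iter_partial_local emb s E Zz).
have [Dj0 hDj] := hD j.
have fj : cn_le (mulmap @` Q) k (partial (fold_dir j) f) m.
  by move=> t tk y Qy; rewrite -iter_partial_rcons; apply: fm => //; rewrite size_rcons.
have fjZ := smooth_partial (fold_dir j) fZ.
apply: le_trans (hDj _ (C * m) (smooth_mulmap oZ fjZ) _ (hC _ _ fjZ m0 fj) s sk z Qz) _.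
  exact: mulr_ge0.
rewrite mulrA ler_wpM2r// (bigD1 j)//= addrCA lerDl addr_ge0//.
by apply: sumr_ge0 => i _; apply: mulr_ge0 => //; have [] := hD i.
Qed.

End Product.

(** * Distributions applied to a function with parameters *)

Section Pairing.
Context {R : realType} {K : numFieldType} {emb : R -> K}.
Context {hK : scalar_field emb} {d : nat}.
Local Notation V := 'rV[R]_d.
Local Notation V2 := 'rV[R]_(d + d).
Local Notation nrm := (@nrm R K emb).
Local Notation partial := (@partial R K emb _).
Local Notation iter_partial := (@iter_partial R K emb _).
Local Notation smooth_on := (@smooth_on R K emb _).
Local Notation cn_le := (@cn_le R K emb _).
Local Notation dquot := (@dquot R K emb _).
Local Notation distr U := (dual (smoothfun emb U)).
Local Notation pd i f x l :=
  (dquot i f x h @[h --> (0 : R)^'] --> (l : K^o)).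
Implicit Types (X Y Z L : set V) (W Q : set V2) (x y : V) (z : V2).

Lemma cn_bounded n (A U : set 'rV[R]_n) k (F : 'rV[R]_n -> K^o) : smooth_on U F ->
  compacts_in U A -> exists2 M, 0 <= M & cn_le A k F M.
Proof.
move=> FW [cA AW]; elim: k F FW => [|k ih] F FW.
  have [M M0 hM] := compact_bound cA (fun t At => smooth_cont FW (AW t At)).
  by exists M => // s; rewrite leqn0 size_eq0 => /eqP -> z; exact: hM.
have [M M0 hM] := ih F FW.
have /choice[D hD] i : exists D, 0 <= D /\ cn_le A k (partial i F) D.
  by have [D D0 hD] := ih _ (smooth_partial i FW); exists D.
have s0 : 0 <= \sum_i D i by rewrite sumr_ge0// => i _; have [] := hD i.
exists (M + \sum_i D i); first exact: addr_ge0.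
move=> s sk z Az; case/lastP: s sk => [_|s i].
  by apply: le_trans (hM [::] (leq0n _) z Az) _; rewrite lerDl.
rewrite size_rcons ltnS iter_partial_rcons => sk.
apply: le_trans ((hD i).2 s sk z Az) _.
rewrite (bigD1 i)//= addrCA lerDl addr_ge0// sumr_ge0// => j _.
by have [] := hD j.
Qed.

Lemma continuous_row_mx : continuous (fun p : V * V => row_mx p.1 p.2 : V2).
Proof.
move=> p; apply: (@cvg_rV _ _ _ (nbhs p) (nbhs_filter p)) => k.
rewrite -[row_mx p.1 p.2]/((fun p => row_mx p.1 p.2) p).
case: (fintype.splitP k) => i ki.
  have -> : k = lshift d i by exact: val_inj.
  have -> : (fun t : V * V => (row_mx t.1 t.2 : V2) 0 (lshift d i)) = fun t => t.1 0 i.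
    by apply/funext => t; rewrite row_mxEl.
  rewrite row_mxEl; apply: (@cvg_comp _ _ _ fst (fun x : V => x 0 i) _ (nbhs p.1)).
    exact: cvg_fst.
  exact: (@coord_continuous R 1 d 0 i p.1).
have -> : k = rshift d i by exact: val_inj.
have -> : (fun t : V * V => (row_mx t.1 t.2 : V2) 0 (rshift d i)) = fun t => t.2 0 i.
  by apply/funext => t; rewrite row_mxEr.
rewrite row_mxEr; apply: (@cvg_comp _ _ _ snd (fun x : V => x 0 i) _ (nbhs p.2)).
  exact: cvg_snd.
exact: (@coord_continuous R 1 d 0 i p.2).
Qed.

Definition row_set L L' : set V2 := [set row_mx p.1 p.2 | p in L `*` L'].

Lemma row_set_compact L L' : compact L -> compact L' -> compact (row_set L L').
Proof.
move=> cL cL'; apply: continuous_compact; last exact: compact_setX.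
by apply: continuous_subspaceT; exact: continuous_row_mx.
Qed.

Definition slice (F : V2 -> K^o) x : V -> K^o := fun y => F (row_mx x y).

Lemma dquot_slice i F x y : dquot i (slice F x) y = dquot (rshift d i) F (row_mx x y).
Proof. by apply/funext => h; rewrite /Defs.dquot /slice row_mx_line_r. Qed.

Lemma iter_slice s F x :
  iter_partial s (slice F x) = slice (iter_partial [seq rshift d i | i <- s] F) x.
Proof.
elim: s => //= i s ih; apply/funext => y; rewrite ih.
by rewrite /slice /Defs.partial -dquot_slice.
Qed.

Context {X Y : set V} {W : set V2}.
Hypotheses (oX : open X) (oY : open Y) (oW : open W).
Hypothesis XYW : forall x y, X x -> Y y -> W (row_mx x y).
Local Notation restr := (to_smooth emb Y).

Lemma smooth_slice F x : X x -> smooth_on W F -> smooth_on Y (slice F x).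
Proof.
move=> Xx FW y; rewrite (interior_open oY) => Yy s; rewrite iter_slice.
have Wxy : W° (row_mx x y) by rewrite interior_open//; exact: XYW.
have [Fc Fd] := FW _ Wxy [seq rshift d i | i <- s].
split; last by move=> i; rewrite dquot_slice; exact: Fd.
apply: (@continuous_comp _ _ _ (fun y => row_mx x y)) => //.
apply: (@continuous_comp _ _ _ (fun y => (x, y)) (fun p : V * V => row_mx p.1 p.2)).
  move=> A [[P Q] /= [Px Qy] PQA]; apply: (@filterS _ (nbhs y) _ _ _ _ Qy) => y1 Qy1.
  by apply: PQA; split=> //=; exact: nbhs_singleton Px.
exact: continuous_row_mx.
Qed.

Definition pairing (S : distr Y) F : V -> K^o := fun x => S (restr (slice F x)).

Lemma iter_restr_slice F x y s : X x -> Y y -> smooth_on W F ->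
  iter_partial s (restr (slice F x)) y =
  iter_partial [seq rshift d i | i <- s] F (row_mx x y).
Proof.
move=> Xx Yy FW; rewrite iter_to_smooth ?iter_slice//; first exact: smooth_slice.
by rewrite interior_open.
Qed.

Lemma pairing_dominated (S : distr Y) F L k C x m : compacts_in Y L -> dominated L k C S ->
  smooth_on W F -> X x -> 0 <= m -> cn_le (row_set [set x] L) k F m ->
  nrm (pairing S F x) <= C * m.
Proof.
move=> [cL LY] hS FW Xx m0 Fm; apply: hS => // s sk y Ly.
rewrite iter_restr_slice//; last by rewrite -(interior_open oY); exact: LY.
by apply: Fm; rewrite ?size_map//; exists (x, y).
Qed.

(** On the compact set L the derivatives of F(x', .) converge uniformly to those of
    F(x, .) as x' tends to x. *)
Lemma pairing_continuous (S : distr Y) F x : smooth_on W F -> X x ->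
  {for x, continuous (pairing S F)}.
Proof.
move=> FW Xx; have [L [k [C [cL C0 hS]]]] := dual_dominated S.
have LY y : L y -> Y y by move=> /cL.2; rewrite interior_open.
apply: (iffRL (@cvg_nrmP _ _ emb _ _ (nbhs x) (nbhs_filter x) (pairing S F) (pairing S F x))).
move=> e e0; have C1 : 0 < C + 1 by rewrite ltr_wpDl.
have e1 : 0 < e / (C + 1) by rewrite divr_gt0.
have H (s : seq 'I_d) : \forall x' \near x, forall y, L y ->
    nrm (iter_partial [seq rshift d i | i <- s] F (row_mx x' y) -
         iter_partial [seq rshift d i | i <- s] F (row_mx x y)) <= e / (C + 1).
  pose H : V2 -> K^o := iter_partial [seq rshift d i | i <- s] F.
  apply: (iffLR (compact_near_coveringP L) cL.1 V (nbhs x) (fun x' y =>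
    nrm (H (row_mx x' y) - H (row_mx x y)) <= e / (C + 1))) => y Ly.
  have Hc : {for row_mx x y, continuous H}.
    apply: (smooth_cont (smooth_iter _ FW)); rewrite interior_open//.
    by apply: XYW => //; exact: LY.
  have e2 : 0 < e / (C + 1) / 2 by rewrite divr_gt0.
  move/(cvg_nrmP (emb := emb)) : Hc => /(_ _ e2) Hc.
  have [[P Q] /= [Px Qy] PQ] := @continuous_row_mx (x, y) _ Hc.
  exists (Q, P) => // -[y' x'] /= [Qy' Px'].
  have H1 := PQ (x', y') (conj Px' Qy').
  have H2 := PQ (x, y') (conj (nbhs_singleton Px) Qy').
  rewrite /= in H1 H2.
  rewrite (_ : _ - _ = (H (row_mx x' y') - H (row_mx x y)) -
    (H (row_mx x y') - H (row_mx x y))); last by ring.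
  by apply: le_trans (nrmB _ _) _; lra.
have near_X : \forall x' \near x, X x' by apply: open_nbhs_nbhs.
apply: (@filterS2 _ _ (nbhs_filter x) _ _ _ _ near_X (near_all_seq k (nbhs_filter x) H)).
move=> x' Xx' Hx'; rewrite /pairing -dualB.
apply: (@le_lt_trans _ _ (C * (e / (C + 1)))); last first.
  by rewrite mulrA ltr_pdivrMr// [C * e]mulrC ltr_pM2l// ltrDl.
apply: hS => [|s sk y Ly]; first exact: ltW.
have Yy := LY y Ly.
by rewrite iter_smoothB ?interior_open// !iter_restr_slice//; exact: Hx'.
Qed.

(** The difference quotient of F in x converges to the partial derivative together
    with all derivatives in y, uniformly on L: by the mean value inequality the
    error is controlled by second derivatives of F in x. Here Schwarz's theorem
    exchanges derivatives in x and in y. *)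
Lemma pairing_pd (S : distr Y) F x i : smooth_on W F -> X x ->
  pd i (pairing S F) x (pairing S (partial (lshift d i) F) x).
Proof.
move=> FW Xx; have [L [k [C [cL C0 hS]]]] := dual_dominated S.
have LY y : L y -> Y y by move=> /cL.2; rewrite interior_open.
have [r r0 rX] := nbhs_cbox (open_nbhs_nbhs (conj oX Xx)).
have cQ : compacts_in W (row_set (cbox x r) L).
  split; first by apply: row_set_compact; [exact: cbox_compact|case: cL].
  by rewrite interior_open// => _ [[x' y] [/= /rX Xx' /LY Yy] <-]; exact: XYW.
have [M M0 hM] := cn_bounded (k + 2) FW cQ.
have Fi := smooth_partial (lshift d i) FW.
pose G h := restr (slice F (x + h *: delta_mx 0 i)).
pose G' := restr (slice (partial (lshift d i) F) x).
have line h : `|h| <= r -> cbox x r (x + h *: delta_mx 0 i).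
  move=> hr j; rewrite addZdirE addrC addKr; apply: le_trans hr.
  by case: (j == i); rewrite ?mulr1// mulr0 normr0.
have key h : `|h| <= r -> nrm (S (G h) - S (G 0) - emb h * S G') <= C * (4 * M * h ^+ 2).
  move=> hr; rewrite -dualZ -!dualB; apply: hS => [|s sk y Ly].
    by rewrite mulr_ge0 ?sqr_ge0// mulr_ge0.
  have Yy := LY y Ly; have Yy' : Y° y by rewrite interior_open.
  have Xh t : `|t| <= r -> X (x + t *: delta_mx 0 i) by move=> /line/rX.
  rewrite !iter_smoothB// iter_smoothZ// !iter_restr_slice//; last first.
  - exact: Xh.
  - by apply: Xh; rewrite normr0 ltW.
  pose s' := [seq rshift d i | i <- s]; rewrite -/s' scale0r addr0.
  pose H : V2 -> K^o := iter_partial s' F.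
  have HW : smooth_on W H by exact: smooth_iter.
  have Wxy t : `|t| <= r -> W° (row_mx (x + t *: delta_mx 0 i) y).
    by move=> /Xh Xt; rewrite interior_open//; exact: XYW.
  have Wxy0 : W° (row_mx x y) by rewrite interior_open//; exact: XYW.
  have sE : iter_partial s' (partial (lshift d i) F) (row_mx x y) =
      partial (lshift d i) H (row_mx x y).
    rewrite -iter_partial_rcons -[RHS]/(iter_partial (lshift d i :: s') F _).
    by apply: (iter_partial_perm FW Wxy0); rewrite perm_rcons.
  rewrite sE -/H.
  have tr t : 0 <= t <= 1 -> `|t * h| <= r.
    move=> /andP[t0 t1]; apply: le_trans hr; rewrite normrM ger0_norm//.
    by rewrite ler_piMl.
  have HiW := smooth_partial (lshift d i) HW.
  have HiiE t : `|t| <= r -> nrm (partial (lshift d i) (partial (lshift d i) H)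
      (row_mx (x + t *: delta_mx 0 i) y)) <= M.
    move=> tr'; apply: (hM (lshift d i :: lshift d i :: s')).
      by rewrite /= size_map addn2 !ltnS.
    by exists (x + t *: delta_mx 0 i, y) => //; split => //=; exact: line.
  have osc t : 0 <= t <= 1 ->
      nrm (partial (lshift d i) H (row_mx (x + (t * h) *: delta_mx 0 i) y) -
           partial (lshift d i) H (row_mx x y)) <= 2 * M * `|h|.
    move=> t01; have th := tr t t01.
    have := @mvt_line R K emb hK _ (lshift d i) (partial (lshift d i) H)
      (fun s => partial (lshift d i) (partial (lshift d i) H)
        (row_mx x y + (s * (t * h)) *: delta_mx 0 (lshift d i))) (row_mx x y) (t * h) 0 M.
    rewrite mulr0 subr0 row_mx_line_l => mvt.
    apply: le_trans (mvt _ _) _.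
    - move=> u u01; apply: smooth_pd HiW _.
      rewrite row_mx_line_l; apply: Wxy; case/andP: u01 => u0 u1.
      by apply: le_trans th; rewrite normrM ger0_norm// ler_piMl.
    - move=> u u01; rewrite subr0 row_mx_line_l; apply: HiiE; case/andP: u01 => u0 u1.
      by apply: le_trans th; rewrite normrM ger0_norm// ler_piMl.
    rewrite ler_wpM2l ?mulr_ge0// normrM; case/andP: t01 => t0 t1.
    by rewrite ger0_norm// ler_piMl.
  have := @mvt_line R K emb hK _ (lshift d i) H
      (fun s => partial (lshift d i) H
        (row_mx x y + (s * h) *: delta_mx 0 (lshift d i))) (row_mx x y) h
      (partial (lshift d i) H (row_mx x y)) (2 * M * `|h|).
  rewrite row_mx_line_l => mvt; apply: le_trans (mvt _ _) _.
  - move=> t t01; apply: smooth_pd HW _; rewrite row_mx_line_l; apply: Wxy.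
    exact: tr.
  - by move=> t t01; rewrite row_mx_line_l; exact: osc.
  by rewrite -(real_normK (num_real h)) le_eqVlt; apply/orP; left; apply/eqP; ring.
apply/cvg_nrmP => e e0.
have D0 : 0 < C * (4 * M) + 1 by rewrite ltr_wpDl// mulr_ge0// mulr_ge0.
apply/dnbhs0P; exists (Num.min r (e / (C * (4 * M) + 1))) => [|h h0].
  by rewrite lt_min r0 divr_gt0.
rewrite lt_min => /andP[/ltW hr he].
have := key h hr; rewrite /G scale0r addr0 -/(pairing S F x) => kh.
have h0' : 0 < `|h| by rewrite normr_gt0.
rewrite /Defs.dquot -/(pairing _ _ _) -(ltr_pM2r h0') -[X in _ * X < _](nrm_emb (emb := emb)).
rewrite -nrmM (_ : (_ - _) * _ = S (restr (slice F (x + h *: delta_mx 0 i))) -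
  pairing S F x - emb h * S G'); last first.
  by rewrite /pairing /GRing.scale /= -/G'; field; rewrite emb_eq0.
apply: le_lt_trans kh _; rewrite -(real_normK (num_real h)) expr2 !mulrA ltr_pM2r//.
move: he; rewrite ltr_pdivlMr// => he; apply: le_lt_trans he.
by rewrite (_ : `|h| * _ = C * 4 * M * `|h| + `|h|) ?lerDl//; ring.
Qed.

(** By [pairing_pd] the functions x |-> S_y F(x,y) contain their own derivatives. *)
Lemma pairing_smooth (S : distr Y) F : smooth_on W F -> smooth_on X (pairing S F).
Proof.
move=> FW; apply: (smooth_coind (P := fun g => exists2 F, smooth_on W F & g = pairing S F));
  last by exists F.
move=> _ [{FW}F FW ->]; split=> [x|i]; first by rewrite interior_open//; exact: pairing_continuous.
exists (pairing S (partial (lshift d i) F)).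
  by exists (partial (lshift d i) F) => //; exact: smooth_partial.
by move=> x; rewrite interior_open//; exact: pairing_pd.
Qed.

Lemma iter_pairing (S : distr Y) F s x : smooth_on W F -> X x ->
  iter_partial s (pairing S F) x =
  pairing S (iter_partial [seq lshift d i | i <- s] F) x.
Proof.
move=> FW; elim: s x => //= i s ih x Xx; have Xx' : X° x by rewrite interior_open.
rewrite [LHS]/(partial _ _ _) /Defs.partial.
have E y : X° y -> iter_partial s (pairing S F) y =
    pairing S (iter_partial [seq lshift d i | i <- s] F) y.
  by rewrite interior_open//; exact: ih.
rewrite (dquot_local emb i E Xx'); apply: pd_lim; apply: pairing_pd => //.
exact: smooth_iter.
Qed.

Lemma pairing_bound (S : distr Y) F L L1 k k' C m : compacts_in Y L -> L1 `<=` X ->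
  dominated L k C S -> smooth_on W F -> 0 <= m ->
  cn_le (row_set L1 L) (k + k') F m -> cn_le L1 k' (pairing S F) (C * m).
Proof.
move=> cL L1X hS FW m0 Fm s sk x L1x; rewrite iter_pairing//; last exact: L1X.
apply: (pairing_dominated cL hS) => //; [exact: smooth_iter|exact: L1X|].
move=> t tk _ [[_ y] [/= -> Ly] <-]; rewrite -iter_partial_cat; apply: Fm.
  by rewrite size_cat size_map leq_add.
by exists (x, y).
Qed.

End Pairing.

(** * Bernstein polynomials *)

Section BernsteinRing.
Context {A : comNzRingType}.
Implicit Types (t a : A) (c : nat -> A).

Definition fwd_diff c : nat -> A := fun k => c k.+1 - c k.

(** De Casteljau's recursion (1 - t) B_n(c) + t B_n(shift of c), written with the
    difference of c. In this form the operator makes sense for coefficients in any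
    commutative ring, and B_(n+1)(c) has the derivative (n+1) B_n(difference of c). *)
Fixpoint bern n t c : A :=
  if n is m.+1 then bern m t c + t * bern m t (fwd_diff c) else c 0%N.

Lemma eq_bern n t c c' : (forall k, (k <= n)%N -> c k = c' k) ->
  bern n t c = bern n t c'.
Proof.
elim: n c c' => [|n ih] c c' cc' /=; first exact: cc'.
congr (_ + _ * _); apply: ih => k kn; first by apply: cc'; rewrite ltnW.
by rewrite /fwd_diff !cc'// ltnW.
Qed.

Lemma bern_linear n t a c c' :
  bern n t (fun k => a * c k + c' k) = a * bern n t c + bern n t c'.
Proof.
elim: n c c' => [//|n ih] c c' /=.
rewrite ih (_ : fwd_diff _ = fun k => a * fwd_diff c k + fwd_diff c' k) ?ih; first by ring.
by apply/funext => k; rewrite /fwd_diff; ring.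
Qed.

Lemma bern_shift n t c :
  bern n t (fun k => c k.+1) = bern n t c + bern n t (fwd_diff c).
Proof.
rewrite -[bern n t c]mul1r [RHS]addrC [1 * _]mul1r -[bern n t (fwd_diff c)]mul1r -bern_linear.
by apply: eq_bern => k _; rewrite /fwd_diff mul1r subrK.
Qed.

Lemma bernS n t c : bern n.+1 t c =
  (1 - t) * bern n t c + t * bern n t (fun k => c k.+1).
Proof. by rewrite bern_shift /=; ring. Qed.

Lemma bern_cst n t a : bern n t (fun=> a) = a.
Proof.
elim: n a => [//|n ih] a /=; rewrite ih (_ : fwd_diff _ = fun=> 0) ?ih ?mulr0 ?addr0//.
by apply/funext => k; rewrite /fwd_diff subrr.
Qed.

(** Moments up to order two, which control the approximation error. *)
Lemma bern_quadratic n t (a b e : A) :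
  bern n t (fun k => a + b * k%:R + e * k%:R ^+ 2) =
  a + b * (n%:R * t) + e * (n%:R * t * (1 - t) + (n%:R * t) ^+ 2).
Proof.
elim: n a b e => [|n ih] a b e /=; first by rewrite !mul0r !(mulr0, addr0, expr0n).
rewrite ih (_ : fwd_diff _ = fun k => (b + e) + 2 * e * k%:R + 0 * k%:R ^+ 2).
  by rewrite ih -natr1; ring.
by apply/funext => k; rewrite /fwd_diff -natr1; ring.
Qed.

End BernsteinRing.

Section BernsteinEstimate.
Context {R : realType} {K : numFieldType} {emb : R -> K}.
Context {hK : scalar_field emb}.
Local Notation nrm := (@nrm R K emb).

Lemma bern_bound n (t : R) (c : nat -> K) (m : nat -> R) : 0 <= t <= 1 ->
  (forall k, (k <= n)%N -> nrm (c k) <= m k) -> nrm (bern n (emb t) c) <= bern n t m.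
Proof.
move=> /andP[t0 t1]; elim: n c m => [|n ih] c m cm; first exact: cm.
rewrite !bernS; apply: le_trans (nrmD _ _) _.
rewrite -[X in X - emb t](emb1 (emb := emb)) -embB !nrmM !nrm_emb !ger0_norm ?subr_ge0//.
apply: lerD; apply: ler_wpM2l => //; rewrite ?subr_ge0//; apply: ih => k kn.
  by apply: cm; rewrite ltnW.
exact: cm.
Qed.

Definition derives (u v : R -> K) : Prop := forall t,
  (emb h)^-1 * (u (t + h) - u t) @[h --> (0 : R)^'] --> (v t : K^o).

Definition quot (h : R) (u : R -> K) : R -> K := fun t => (emb h)^-1 * (u (t + h) - u t).

Lemma derives_quot h (u v : R -> K) : derives u v -> derives (quot h u) (quot h v).
Proof.
move=> uv t; rewrite /quot.
have E : (fun s => (emb s)^-1 * ((emb h)^-1 * (u (t + s + h) - u (t + s)) -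
    (emb h)^-1 * (u (t + h) - u t))) = (fun s => (emb h)^-1 *
    ((emb s)^-1 * (u (t + h + s) - u (t + h)) - (emb s)^-1 * (u (t + s) - u t))).
  by apply/funext => s; rewrite [t + s + h]addrAC; ring.
rewrite E; apply: cvgMK; first exact: cvg_cst.
by apply: (@cvgB _ K^o); exact: uv.
Qed.

(** Each of the r difference quotients is taken in turn; by the mean value inequality
    each of them costs a factor of 2. *)
Lemma iter_quot r h (u : nat -> R -> K) (A : K) e t : 0 < h ->
  (forall j, derives (u j) (u j.+1)) ->
  (forall s, t <= s <= t + r%:R * h -> nrm (u r s - A) <= e) ->
  nrm (iter r (quot h) (u 0%N) t - A) <= 2 ^+ r * e.
Proof.
move=> h0; elim: r u e t => [|r ih] u e t du uA.
  by rewrite expr0 mul1r; apply: uA; rewrite mul0r addr0 lexx.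
rewrite iterSr exprSr -mulrA; apply: (ih (fun j => quot h (u j))).
  by move=> j; exact: derives_quot.
move=> s /andP[ts st].
have := @mvt_ineq R K emb hK (fun x => u r x - emb x * A) (fun x => u r.+1 x - A) s (s + h) e.
rewrite lerDl (ltW h0) => /(_ isT) mvt.
have {}mvt : nrm (u r (s + h) - emb (s + h) * A - (u r s - emb s * A)) <= 2 * e * h.
  rewrite -[X in _ <= _ * X](addrK s h) [h + s]addrC; apply: mvt.
    move=> x _.
    apply: (cvg_near_eq (g := fun s => (emb s)^-1 * (u r (x + s) - u r x) - A)).
      apply: filterS near0_neq => y y0; rewrite embD; field.
      by rewrite emb_eq0.
    by apply: (@cvgB _ K^o); [exact: du|exact: cvg_cst].
  move=> x /andP[sx xs]; apply: uA; rewrite (le_trans ts)//=.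
  apply: le_trans xs _; rewrite -natr1 mulrDl mul1r addrA lerD2r//.
rewrite -(ler_pM2r h0) -[X in nrm _ * X](gtr0_norm h0) -(nrm_emb (emb := emb)) -nrmM.
apply: le_trans _ mvt; rewrite le_eqVlt; apply/orP; left; apply/eqP; congr nrm.
by rewrite /quot embD; field; rewrite emb_eq0 gt_eqF.
Qed.

Lemma iter_fwd_diff r h (u : R -> K) a k : h != 0 ->
  iter r fwd_diff (fun k => u (a + k%:R * h)) k =
  emb h ^+ r * iter r (quot h) u (a + k%:R * h).
Proof.
move=> h0; elim: r k => [|r ih] k; first by rewrite mul1r.
rewrite !iterS /fwd_diff !ih -natr1 mulrDl mul1r addrA exprS.
move: (iter r (quot h) u) => v; rewrite /quot.
by field; rewrite emb_eq0.
Qed.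

Lemma falling_ratio n r : (0 < n)%N ->
  0 <= 1 - (n ^_ r)%:R / (n%:R ^+ r : R) <= (r ^ 2)%:R / n%:R.
Proof.
move=> n0; have n0' : (0 : R) < n%:R by rewrite ltr0n.
have nr0 q : (0 : R) < n%:R ^+ q by rewrite exprn_gt0.
elim: r => [|r /andP[ih1 ih2]].
  by rewrite ffactn0 expr0 divr1 subrr mul0r lexx.
set p := (n ^_ r)%:R / _ in ih1 ih2.
have p01 : 0 <= p <= 1.
  by apply/andP; split; [rewrite divr_ge0 ?ler0n// ltW|rewrite -subr_ge0].
have E : (n ^_ r.+1)%:R / n%:R ^+ r.+1 = p * ((n - r)%:R / n%:R).
  by rewrite ffactnSr natrM exprSr /p; field; rewrite !gt_eqF.
rewrite E; have q1 : (n - r)%:R / n%:R <= 1 :> R.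
  by rewrite ler_pdivrMr// mul1r ler_nat leq_subr.
have q0 : 0 <= (n - r)%:R / n%:R :> R by rewrite divr_ge0.
have q2 : 1 - r%:R / n%:R <= (n - r)%:R / n%:R :> R.
  rewrite -[X in X - _](divff (lt0r_neq0 n0')) -mulrBl ler_pM2r ?invr_gt0//.
  by rewrite lerBlDr -natrD ler_nat; lia.
case/andP: p01 => p0 p1; apply/andP; split.
  by rewrite subr_ge0 mulr_ile1.
have : p * ((n - r)%:R / n%:R) >= p * (1 - r%:R / n%:R) by rewrite ler_wpM2l.
have : p * (r%:R / n%:R) <= r%:R / n%:R by rewrite ler_piMl// divr_ge0.
have : (r ^ 2)%:R / n%:R + r%:R / n%:R <= (r.+1 ^ 2)%:R / n%:R :> R.
  by rewrite -mulrDl ler_pM2r ?invr_gt0// -natrD ler_nat; lia.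
lra.
Qed.

Lemma derives_lipschitz (u v : R -> K) a b m s t : derives u v ->
  (forall x, a <= x <= b -> nrm (v x) <= m) -> a <= s <= b -> a <= t <= b ->
  nrm (u s - u t) <= 2 * m * `|s - t|.
Proof.
move=> uv vm; wlog ts : s t / t <= s => [H|/andP[_ sb] /andP[ta _]].
  have [ts|/ltW st] := leP t s; first exact: H.
  by rewrite nrm_distC distrC => sab tab; exact: H.
rewrite ger0_norm ?subr_ge0//; apply: (mvt_ineq (v := v)) => // x /andP[tx xs].
by apply: vm; rewrite (le_trans ta tx) (le_trans xs sb).
Qed.

(** The r-th derivative of the n-th Bernstein polynomial of u is a Bernstein operator
    of degree n - r for coefficients that are close to the r-th derivative of u at
    the nodes. The error at a node is at most a small constant plus a multiple of the
    squared distance of the node from the point; [bern_quadratic] computes its mean. *)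
Lemma bern_derivative r (a l m e : R) : 0 < l -> 0 <= m -> 0 < e ->
  exists n0, forall n, (n0 <= n)%N -> forall u : nat -> R -> K,
    (forall j, derives (u j) (u j.+1)) ->
    (forall s, a <= s <= a + l -> nrm (u r s) <= m) ->
    (forall s, a <= s <= a + l -> nrm (u r.+1 s) <= m) ->
    forall t, 0 <= t <= 1 ->
    nrm (emb l^-1 ^+ r * (n ^_ r)%:R * bern (n - r) (emb t)
      (iter r fwd_diff (fun k => u 0%N (a + k%:R * (l / n%:R)))) - u r (a + l * t)) <= e.
Proof.
move=> l0 m0 e0; pose D := 2 ^+ r * (2 * m).
have D0 : 0 <= D by rewrite mulr_ge0 ?exprn_ge0// mulr_ge0.
(* With this q the part of the error that does not tend to 0 is at most e / 4. *)
pose q := e / (4 * (D * l + 1)).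
have Dl0 : 0 <= D * l by rewrite mulr_ge0// ltW.
have q0 : 0 < q by rewrite divr_gt0// mulr_gt0// ltr_wpDl.
pose C := D * r%:R * l + D * l * (r ^ 2 + 1)%:R / q + (r ^ 2)%:R * m.
have C0 : 0 <= C.
  by rewrite !addr_ge0// ?mulr_ge0 ?(ltW l0) ?ler0n ?invr_ge0 ?(ltW q0).
exists ((Num.trunc (2 * C / e)).+1 + r)%N => n nn0 u du um um1 t t01.
have rn : (r <= n)%N by apply: leq_trans nn0; rewrite leq_addl.
have n0 : (0 < n)%N by apply: leq_trans nn0; rewrite addSn.
have n0' : (0 : R) < n%:R by rewrite ltr0n.
have Cn : C / n%:R <= e / 2.
  rewrite ler_pdivrMr// mulrC -ler_pdivrMr ?divr_gt0// invf_div.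
  rewrite mulrA [C * 2]mulrC; apply/ltW/(lt_le_trans (truncnS_gt _)).
  by rewrite ler_nat; apply: leq_trans nn0; rewrite leq_addr.
pose h := l / n%:R; have h0 : 0 < h by rewrite divr_gt0.
pose G := u r (a + l * t); pose Q k := iter r (quot h) (u 0%N) (a + k%:R * h).
pose rho : R := (n ^_ r)%:R / n%:R ^+ r.
have -> : emb l^-1 ^+ r * (n ^_ r)%:R * bern (n - r) (emb t)
      (iter r fwd_diff (fun k => u 0%N (a + k%:R * (l / n%:R)))) = 
      emb rho * bern (n - r) (emb t) Q.
  rewrite (@eq_bern _ _ _ _ (fun k => emb h ^+ r * Q k + 0)); last first.
    by move=> k _; rewrite addr0 -/h iter_fwd_diff// gt_eqF.
  rewrite bern_linear bern_cst addr0 mulrA; congr (_ * _).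
  have embX x j : emb (x ^+ j) = emb x ^+ j.
    by elim: j => [|j ih]; rewrite ?expr0 ?emb1// !exprS embM ih.
  rewrite -!embX -emb_nat -!embM; congr emb; rewrite /rho /h exprMn !exprVn.
  by field; rewrite !gt_eqF// exprn_gt0.
have in_seg k s : (k <= n - r)%N -> a + k%:R * h <= s <= a + k%:R * h + r%:R * h ->
    a <= s <= a + l.
  move=> kn /andP[s1 s2]; apply/andP; split.
    by apply: le_trans s1; rewrite lerDl mulr_ge0// ltW.
  apply: le_trans s2 _; rewrite -addrA -mulrDl lerD2l /h mulrCA ler_piMr ?(ltW l0)//.
  by rewrite ler_pdivrMr// mul1r -natrD ler_nat addnC -leq_subRL.
have tseg : a <= a + l * t <= a + l.
  case/andP: t01 => t0 t1; rewrite lerDl mulr_ge0 ?(ltW l0)//= lerD2l.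
  by rewrite ler_piMr// ltW.
pose M k := (D * (l * q + r%:R * h + l * t ^+ 2 / q)) +
  (- 2 * D * l * t / (q * n%:R)) * k%:R + (D * l / (q * n%:R ^+ 2)) * k%:R ^+ 2.
have QG k : (k <= n - r)%N -> nrm (Q k - G) <= M k.
  move=> kn; set x := k%:R / n%:R - t.
  (* Trades the distance for its square, at the cost of the small constant q. *)
  have xq : `|x| <= q + x ^+ 2 / q.
    rewrite -(ler_pM2r q0) mulrDl divfK ?gt_eqF//.
    have := sqr_ge0 (`|x| - q); rewrite sqrrB real_normK ?num_real// expr2.
    by have := mulr_ge0 (normr_ge0 x) (ltW q0); lra.
  have -> : M k = 2 ^+ r * (2 * m * (l * (q + x ^+ 2 / q) + r%:R * h)).
    by rewrite /M /x /D /h; field; rewrite !gt_eqF.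
  apply: iter_quot => // s sk; have sseg := in_seg k s kn sk.
  apply: le_trans (derives_lipschitz (du r) um1 sseg tseg) _.
  apply: ler_wpM2l; first by rewrite mulr_ge0.
  rewrite (_ : s - _ = (s - (a + k%:R * h)) + l * x); last first.
    by rewrite /x /h; field; rewrite gt_eqF.
  apply: le_trans (ler_normD _ _) _; rewrite addrC; apply: lerD.
    by rewrite normrM gtr0_norm// ler_wpM2l// ltW.
  by case/andP: sk => s1 s2; rewrite ger0_norm ?subr_ge0// lerBlDl.
have BG : nrm (bern (n - r) (emb t) Q - G) <= bern (n - r) t M.
  have -> : bern (n - r) (emb t) Q - G = bern (n - r) (emb t) (fun k => Q k - G).
    rewrite (@eq_bern _ _ _ (fun k => Q k - G) (fun k => 1 * Q k + (- G))).
      by rewrite bern_linear bern_cst mul1r.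
    by move=> k _; rewrite mul1r.
  exact: bern_bound.
have Mle : bern (n - r) t M <= e / 4 + (D * r%:R * l + D * l * (r ^ 2 + 1)%:R / q) / n%:R.
  rewrite /M bern_quadratic natrB//; case/andP: t01 => t0 t1.
  have H1 : D * (l * q) <= e / 4.
    rewrite mulrA /q -[leRHS]mulr1; rewrite (_ : D * l * _ = e / 4 * (D * l / (D * l + 1))).
      rewrite ler_wpM2l ?divr_ge0 ?(ltW e0)// ler_pdivrMr ?ltr_wpDl//.
      by rewrite mul1r lerDl.
    by field; rewrite gt_eqF// ltr_wpDl.
  have H2 : t ^+ 2 * (r%:R / n%:R) ^+ 2 + (n%:R - r%:R) * t * (1 - t) / n%:R ^+ 2
      <= (r ^ 2 + 1)%:R / n%:R.
    have n1 : n%:R^-1 <= 1 :> R by rewrite invf_le1// ler1n.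
    have t2 : t ^+ 2 <= 1 by rewrite expr_le1.
    rewrite [leRHS](_ : _ = r%:R ^+ 2 / n%:R + n%:R^-1); last first.
      by rewrite natrD natrX mulrDl mul1r.
    apply: lerD.
      rewrite expr_div_n mulrA [t ^+ 2 * _]mulrC -mulrA ler_wpM2l ?sqr_ge0//.
      rewrite expr2 invfM mulrA -[leRHS]mul1r ler_wpM2r ?invr_ge0 ?(ltW n0')//.
      by rewrite mulr_ile1 ?invr_ge0 ?(ltW n0') ?sqr_ge0.
    rewrite ler_pdivrMr ?exprn_gt0// expr2 mulKf ?gt_eqF//.
    have tt : 0 <= t * (1 - t) <= 1.
      by rewrite mulr_ge0 ?subr_ge0// mulr_ile1 ?subr_ge0// lerBlDr lerDl.
    rewrite -mulrA; case/andP: tt => tt0 tt1.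
    apply: le_trans (_ : n%:R * (t * (1 - t)) <= _); first by rewrite ler_wpM2r// lerBlDr lerDl.
    by rewrite ler_piMr// ltW.
  have H3 : D * l / q * (t ^+ 2 * (r%:R / n%:R) ^+ 2 +
      (n%:R - r%:R) * t * (1 - t) / n%:R ^+ 2) <= D * l / q * ((r ^ 2 + 1)%:R / n%:R).
    by rewrite ler_wpM2l// divr_ge0// ltW.
  rewrite [leLHS](_ : _ = D * (l * q) + D * r%:R * l / n%:R + D * l / q *
    (t ^+ 2 * (r%:R / n%:R) ^+ 2 + (n%:R - r%:R) * t * (1 - t) / n%:R ^+ 2)); last first.
    by rewrite /h; field; rewrite !gt_eqF.
  rewrite [leRHS](_ : _ = e / 4 + D * r%:R * l / n%:R +
    D * l / q * ((r ^ 2 + 1)%:R / n%:R)); last by field; rewrite !gt_eqF.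
  by rewrite !lerD.
have /andP[rho0 rho1] := falling_ratio r n0; rewrite -/rho in rho0 rho1.
have rho_ge0 : 0 <= rho by rewrite divr_ge0 ?ler0n// exprn_ge0// ltW.
rewrite (_ : _ - _ = emb rho * (bern (n - r) (emb t) Q - G) - emb (1 - rho) * G);
  last by rewrite -/G embB emb1; ring.
apply: le_trans (nrmB _ _) _; rewrite !nrmM !nrm_emb !ger0_norm//.
have H4 : rho * nrm (bern (n - r) (emb t) Q - G) <= bern (n - r) t M.
  apply: le_trans BG; rewrite ler_piMl ?nrm_ge0//; lra.
have H5 : (1 - rho) * nrm G <= (r ^ 2)%:R * m / n%:R.
  by rewrite mulrAC; apply: ler_pM => //; [exact: nrm_ge0|exact: um].
have : C / n%:R = (D * r%:R * l + D * l * (r ^ 2 + 1)%:R / q) / n%:R + (r ^ 2)%:R * m / n%:R.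
  by rewrite /C !mulrDl.
lra.
Qed.

End BernsteinEstimate.

Section Density.
Context {R : realType} {K : numFieldType} {emb : R -> K}.
Context {hK : scalar_field emb} {d : nat}.
Local Notation V := 'rV[R]_d.
Local Notation nrm := (@nrm R K emb).
Local Notation dquot := (@dquot R K emb d).
Local Notation partial := (@partial R K emb d).
Local Notation iter_partial := (@iter_partial R K emb d).
Local Notation smooth_on := (@smooth_on R K emb d).
Local Notation cn_le := (@cn_le R K emb d).
Local Notation dir i := (delta_mx 0 i : V).
Local Notation pd i f x l :=
  (dquot i f x h @[h --> (0 : R)^'] --> (l : K^o)).
Implicit Types (U L : set V) (x y : V) (f g : V -> K^o).

Lemma pd_eq i f x (l m : K) : pd i f x l -> l = m -> pd i f x m.
Proof. by move=> + <-. Qed.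

Lemma iter_partialB U f g s x : smooth_on U f -> smooth_on U g -> U° x ->
  iter_partial s (f - g) x = iter_partial s f x - iter_partial s g x :> K.
Proof.
move=> fU gU Ux; have := iter_partialP (-1) s gU fU Ux.
rewrite scaleN1r addrC => ->.
by rewrite -[LHS]/(-1 * iter_partial s g x + iter_partial s f x) mulN1r addrC.
Qed.

Lemma cn_le_chain U L k f g h m m' : smooth_on U f -> smooth_on U g -> smooth_on U h ->
  L `<=` U° -> cn_le L k (f - g) m -> cn_le L k (g - h) m' -> cn_le L k (f - h) (m + m').
Proof.
move=> fU gU hU LU fg gh s sk x Lx; have Ux := LU x Lx.
have := fg s sk x Lx; have := gh s sk x Lx; rewrite !(iter_partialB _ _ _ Ux)// => h1 h2.
rewrite (_ : _ - _ = (iter_partial s f x - iter_partial s g x) +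
  (iter_partial s g x - iter_partial s h x)); last by ring.
by apply: le_trans (nrmD _ _) _; apply: lerD.
Qed.

Definition setc x (i : 'I_d) (c : R) : V := \row_k (if k == i then c else x 0 k).

Lemma setcE x i c k : setc x i c 0 k = if k == i then c else x 0 k.
Proof. by rewrite mxE. Qed.

Lemma setc_id x i : setc x i (x 0 i) = x.
Proof. by apply/rowP => k; rewrite setcE; case: eqP => [->|]. Qed.

Lemma setc_line_same x i h c : setc (x + h *: dir i) i c = setc x i c.
Proof.
by apply/rowP => k; rewrite !setcE addZdirE; case: eqP => // _; rewrite mulr0 addr0.
Qed.

Lemma setc_line_other x i j h c : j != i ->
  setc (x + h *: dir j) i c = setc x i c + h *: dir j.
Proof.
move=> ji; apply/rowP => k; rewrite !setcE !addZdirE setcE.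
by have [->|//] := eqVneq k i; rewrite eq_sym (negbTE ji) mulr0 addr0.
Qed.

Lemma setc_add x i c h : setc x i (c + h) = setc x i c + h *: dir i.
Proof.
apply/rowP => k; rewrite addZdirE !setcE.
by case: eqP => _; rewrite ?mulr1// mulr0 addr0.
Qed.

Lemma pd_setc_same f i c x : pd i (fun x => f (setc x i c)) x 0.
Proof.
apply: pd_near; apply: nearW => h.
by rewrite /Defs.dquot setc_line_same subrr scaler0.
Qed.

Lemma dquot_setc f i j c x : j != i ->
  dquot j (fun x => f (setc x i c)) x = dquot j f (setc x i c).
Proof. by move=> ji; apply/funext => h; rewrite /Defs.dquot setc_line_other. Qed.

Lemma continuous_setc i c : continuous (fun x => setc x i c).
Proof.
move=> x; apply: (@cvg_rV _ _ _ (nbhs x) (nbhs_filter x)) => k.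
have [->|ki] := eqVneq k i.
  have -> : (fun t => setc t i c 0 i) = (fun=> c).
    by apply/funext => t; rewrite setcE eqxx.
  by rewrite setcE eqxx; exact: cvg_cst.
have -> : (fun t => setc t i c 0 k) = (fun t : V => t 0 k).
  by apply/funext => t; rewrite setcE (negbTE ki).
by rewrite setcE (negbTE ki); exact: (@coord_continuous R 1 d 0 k x).
Qed.

Lemma smooth_setc f i c : smooth_on setT f -> smooth_on setT (fun x => f (setc x i c)).
Proof.
move=> fS; apply: (smooth_coind (P := fun g => exists2 f, smooth_on setT f &
  g = fun x => f (setc x i c))); last by exists f.
move=> _ [{fS}f fS ->]; split=> [x _|j].
  apply: continuous_comp; first exact: continuous_setc.
  by apply: (smooth_cont fS); rewrite interiorT.
have [->|ji] := eqVneq j i.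
  exists (fun=> 0); last by move=> x _; exact: pd_setc_same.
  by exists (fun=> 0) => //; exact: smooth_cst.
exists (fun x => partial j f (setc x i c)).
  by exists (partial j f) => //; exact: smooth_partial.
by move=> x _; rewrite dquot_setc//; apply: (smooth_pd fS); rewrite interiorT.
Qed.

(** * The Bernstein operator in one coordinate *)

Context {M : R}.
Hypothesis M0 : 0 < M.

(** Maps the interval [-M, M] of the i-th coordinate to [0, 1]. *)
Definition rescale (i : 'I_d) x : R := (2 * M)^-1 * (x 0 i + M).

(** Coefficients that are functions of x: later, f with the i-th coordinate replaced by
    a node, which does not depend on x_i any more. *)
Definition bern_fun i n (c : nat -> V -> K^o) : V -> K^o :=
  fun x => bern n (emb (rescale i x)) (fun k => c k x).

Lemma bern_funS i n c : bern_fun i n.+1 c =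
  bern_fun i n c + (bern_fun i n (fun k => c k.+1 - c k) : V -> K) *
    ((fun x => emb (rescale i x)) : V -> K).
Proof. by apply/funext => x; rewrite /bern_fun /= mulrC. Qed.

Lemma pd_rescale_coord i j x :
  pd j (fun x => emb (rescale i x)) x (emb (2 * M)^-1 * (i == j)%:R).
Proof.
apply: pd_near; apply: filterS near0_neq => h h0.
rewrite /Defs.dquot /rescale addZdirE /GRing.scale /= -embB -emb_nat -embV -!embM.
by congr emb; field; rewrite h0 gt_eqF.
Qed.

Lemma continuous_rescale i : continuous (fun x => emb (rescale i x) : K^o).
Proof.
move=> x; apply: (@cvg_emb _ _ _ _ _ (nbhs x) (nbhs_filter x) (rescale i) (rescale i x)).
apply: (@cvgM R); first exact: cvg_cst.
by apply: (@cvgD _ R^o); [exact: (@coord_continuous R 1 d 0 i x)|exact: cvg_cst].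
Qed.

Lemma smooth_rescale i U : smooth_on U (fun x => emb (rescale i x)).
Proof.
have -> : (fun x => emb (rescale i x)) = ((fun=> emb (2 * M)^-1) : V -> K) *
    ((fun x => emb (x 0 i)) + (fun=> emb M)).
  by apply/funext => x; rewrite /rescale embM embD.
apply: smoothM; first exact: smooth_cst.
by apply: smoothD; [exact: smooth_coord|exact: smooth_cst].
Qed.

Lemma bern_fun_smooth i n (c : nat -> V -> K^o) U :
  (forall k, smooth_on U (c k)) -> smooth_on U (bern_fun i n c).
Proof.
elim: n c => [|n ih] c cU; first exact: cU.
rewrite bern_funS; apply: smoothD; first exact: ih.
apply: smoothM; last exact: smooth_rescale.
by apply: ih => k; exact: smoothB.
Qed.

Lemma pd_bern_other i j n (c : nat -> V -> K^o) (l : nat -> K) x : j != i ->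
  (forall k, pd j (c k) x (l k)) -> pd j (bern_fun i n c) x (bern n (emb (rescale i x)) l).
Proof.
move=> ji; elim: n c l => [|n ih] c l cl; first exact: cl.
rewrite bern_funS; apply: pdD; first exact: ih.
have H : pd j (bern_fun i n (fun k => c k.+1 - c k)) x (bern n (emb (rescale i x)) (fwd_diff l)).
  by apply: ih => k; apply: pdB; exact: cl.
apply: pd_eq (pdM (@continuous_rescale i x) H (@pd_rescale_coord i j x)) _.
by rewrite [i == j]eq_sym (negbTE ji) !mulr0 addr0 mulrC.
Qed.

Lemma pd_bern_same i n (c : nat -> V -> K^o) x : (forall k, pd i (c k) x 0) ->
  pd i (bern_fun i n c) x (emb (2 * M)^-1 * n%:R *
    bern n.-1 (emb (rescale i x)) (fwd_diff (fun k => c k x))).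
Proof.
elim: n c => [|n ih] c c0.
  by rewrite mulr0 mul0r; exact: c0.
rewrite bern_funS.
have H : forall k, pd i (c k.+1 - c k) x 0.
  by move=> k; apply: pd_eq (pdB (c0 k.+1) (c0 k)) (subrr 0).
apply: pd_eq (pdD (ih c c0) (pdM (@continuous_rescale i x) (ih _ H) (@pd_rescale_coord i i x))) _.
rewrite eqxx mulr1 /bern_fun [n.+1.-1]/=.
case: n {ih} => [|n]; first by rewrite !mulr0 !mul0r !add0r mulr1 mulrC.
rewrite /= -[n.+2%:R]natr1; rewrite -/(fwd_diff (fun k => c k x)).
ring.
Qed.

Lemma pdZ i f x (a l : K) : pd i f x l -> pd i (fun x => a * f x) x (a * l).
Proof.
move=> fl; rewrite /Defs.dquot.
under eq_fun do rewrite -mulrBr scalerAr.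
by apply: cvgMK fl; exact: cvg_cst.
Qed.

Lemma pd_iter_fwd_diff r j (c : nat -> V -> K^o) (l : nat -> K) x :
  (forall k, pd j (c k) x (l k)) ->
  forall k, pd j (fun x => iter r fwd_diff (fun k => c k x : K) k) x (iter r fwd_diff l k).
Proof.
move=> cl; elim: r => [|r ih] k; first exact: cl.
exact: (pdB (ih k.+1) (ih k)).
Qed.

Lemma iter_fwd_diff0 r k : iter r fwd_diff (fun=> 0 : K) k = 0.
Proof. by elim: r k => // r ih k; rewrite iterS /fwd_diff !ih subrr. Qed.

Definition node n (k : nat) : R := - M + k%:R * (2 * M / n%:R).

Definition bern_coord i n f : V -> K^o :=
  bern_fun i n (fun k x => f (setc x i (node n k))).

Lemma bern_coord_smooth i n f : smooth_on setT f -> smooth_on setT (bern_coord i n f).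
Proof. by move=> fS; apply: bern_fun_smooth => k; exact: smooth_setc. Qed.

(** Derivatives in the direction i act on the Bernstein polynomial, the others on f. *)
Lemma iter_bern_coord i n f s x : smooth_on setT f ->
  iter_partial s (bern_coord i n f) x =
  emb (2 * M)^-1 ^+ count_mem i s * (n ^_ count_mem i s)%:R *
  bern (n - count_mem i s) (emb (rescale i x)) (iter (count_mem i s) fwd_diff
    (fun k => iter_partial (seq.filter (predC1 i) s) f (setc x i (node n k)))) :> K.
Proof.
move=> fS; elim: s x => [|j s ih] x.
  by rewrite /= subn0 ffactn0 expr0 !mul1r.
rewrite -[LHS]/(partial j (iter_partial s (bern_coord i n f)) x).
rewrite [count_mem i (j :: s)]/= [seq.filter (predC1 i) (j :: s)]/=.
move: ih; set r := count_mem i s; set g := iter_partial (seq.filter (predC1 i) s) f => ih.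
have gS : smooth_on setT g by exact: smooth_iter.
pose A := emb (2 * M)^-1 ^+ r * (n ^_ r)%:R.
pose c k y : K^o := iter r fwd_diff (fun k => g (setc y i (node n k)) : K) k.
have E : iter_partial s (bern_coord i n f) = fun x => A * bern_fun i (n - r) c x.
  by apply/funext => y; rewrite ih.
rewrite E; apply: pd_lim; have [->|ji] := eqVneq j i.
  have c0 k : pd i (c k) x 0.
    have h k' : pd i (fun y => g (setc y i (node n k'))) x 0 by exact: pd_setc_same.
    apply: pd_eq (@pd_iter_fwd_diff r i (fun k y => g (setc y i (node n k))) (fun=> 0) x h k) _.
    exact: iter_fwd_diff0.
  apply: (pd_eq (@pdZ _ _ _ A _ (@pd_bern_same i (n - r) c x c0))).
  rewrite add1n subnS ffactnSr natrM exprSr /A iterS.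
  by rewrite -/g; ring.
pose l := iter r fwd_diff (fun k => partial j g (setc x i (node n k)) : K).
have cl k : pd j (c k) x (l k).
  apply: (@pd_iter_fwd_diff r j (fun k y => g (setc y i (node n k)))) => k'.
  by rewrite dquot_setc//; apply: (smooth_pd gS); rewrite interiorT.
exact: (pd_eq (@pdZ _ _ _ A _ (@pd_bern_other i j (n - r) c l x ji cl))).
Qed.

Lemma perm_split_dir i (s : seq 'I_d) :
  perm_eq s (nseq (count_mem i s) i ++ seq.filter (predC1 i) s).
Proof.
rewrite -(perm_filterC (pred1 i)) perm_cat// (_ : seq.filter _ _ = nseq (count_mem i s) i)//.
elim: s => //= j s ih; have [->|ji] := eqVneq j i; first by rewrite ih add1n.
by rewrite ih add0n.
Qed.

Lemma setc_cbox x i c : cbox 0 M x -> - M <= c <= M -> cbox 0 M (setc x i c).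
Proof.
move=> xM cM j; rewrite setcE mxE subr0; case: eqP => _; first by rewrite ler_norml.
by have := xM j; rewrite mxE subr0.
Qed.

(** [bern_derivative] for each number r of derivatives in the direction i, after these
    have been moved to the front. *)
Lemma bern_coord_approx i k f e : smooth_on setT f -> 0 < e ->
  exists n, cn_le (cbox 0 M) k (bern_coord i n f - f) e.
Proof.
move=> fS e0.
have cL : compacts_in setT (cbox (0 : V) M).
  by split; [exact: cbox_compact|rewrite interiorT].
have [m m0 hm] := cn_bounded k.+1 fS cL.
have M2 : 0 < 2 * M by rewrite mulr_gt0.
have /choice[n0 hn0] r := @bern_derivative R K emb hK r (- M) (2 * M) m e M2 m0 e0.
pose n := (\max_(r < k.+1) n0 r)%N; exists n => s sk x xM.
have Tx : (@setT V)° x by rewrite interiorT.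
rewrite (iter_partialB _ (bern_coord_smooth _ _ fS) fS Tx) iter_bern_coord//.
set r := count_mem i s; set s' := seq.filter _ s.
have rk : (r < k.+1)%N by rewrite ltnS (leq_trans (count_size _ _) sk).
pose u j xi : K := iter_partial (nseq j i ++ s') f (setc x i xi).
have sE : (r + size s' = size s)%N.
  by rewrite (perm_size (perm_split_dir i s)) size_cat size_nseq.
have seg xi : - M <= xi <= - M + 2 * M -> cbox 0 M (setc x i xi).
  by move=> h; apply: setc_cbox => //; move: h; rewrite (_ : - M + 2 * M = M)//; ring.
have xM' : - M <= x 0 i <= M by have := xM i; rewrite mxE subr0 ler_norml.
have n0n : (n0 r <= n)%N by exact: (@leq_bigmax _ (fun r : 'I_k.+1 => n0 r) (Ordinal rk)).
have du j : derives (emb := emb) (u j) (u j.+1).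
  move=> t; have Tt : (@setT V)° (setc x i t) by rewrite interiorT.
  have := smooth_pd (i := i) (smooth_iter (nseq j i ++ s') fS) Tt.
  apply: cvg_near_eq; apply: nearW => h.
  by rewrite /u /Defs.dquot setc_add.
have ule q xi : (q + size s' <= k.+1)%N -> - M <= xi <= - M + 2 * M -> nrm (u q xi) <= m.
  move=> qk xiM; apply: hm; last exact: seg.
  by rewrite size_cat size_nseq.
have t01 : 0 <= rescale i x <= 1.
  have Mx : 0 <= x 0 i + M by case/andP: xM' => h _; rewrite -lerBlDr sub0r.
  rewrite /rescale mulr_ge0 ?invr_ge0 ?(ltW M2)//= ler_pdivrMl// mulr1.
  by case/andP: xM' => _ h; rewrite mulr2n mulrDl mul1r lerD2r.
have := hn0 r n n0n u du (fun xi => ule r xi _) (fun xi => ule r.+1 xi _) (rescale i x) t01.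
rewrite /u /= (_ : - M + 2 * M * rescale i x = x 0 i); last first.
  by rewrite /rescale mulVKf ?gt_eqF//; ring.
rewrite setc_id -(iter_partial_perm fS Tx (perm_split_dir i s)); apply.
  by rewrite sE (leq_trans sk).
by rewrite addSn sE ltnS.
Qed.

(** The class between smooth functions, j = 0, and polynomials, j = d, that is reached
    when the Bernstein operator has been applied in the first j coordinates. *)
Inductive semipoly (j : nat) : (V -> K^o) -> Prop :=
| SemiBase g : smooth_on setT g ->
    (forall x y, (forall i : 'I_d, (j <= i)%N -> x 0 i = y 0 i) -> g x = g y) ->
    semipoly j g
| SemiCoord i : semipoly j (fun x => emb (x 0 i))
| SemiAdd f g : semipoly j f -> semipoly j g -> semipoly j (f + g)
| SemiMul f g : semipoly j f -> semipoly j g -> semipoly j ((f : V -> K) * (g : V -> K)).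

Lemma semipoly_smooth j f : semipoly j f -> smooth_on setT f.
Proof.
elim=> {f} [g gS _|i|f g _ fS _ gS|f g _ fS _ gS] //; first exact: smooth_coord.
- exact: smoothD.
- exact: smoothM.
Qed.

Lemma semipoly_cst j (a : K) : semipoly j (fun=> a).
Proof. by apply: SemiBase => //; exact: smooth_cst. Qed.

Lemma semipolyN j f : semipoly j f -> semipoly j (- f).
Proof.
move=> fj; have -> : - f = ((fun=> -1) : V -> K) * (f : V -> K).
  by apply/funext => x; rewrite -[RHS]/(-1 * f x : K) mulN1r.
by apply: SemiMul fj; exact: semipoly_cst.
Qed.

Lemma semipoly_setc (i : 'I_d) f c : semipoly i f -> semipoly i.+1 (fun x => f (setc x i c)).
Proof.
elim=> {f} [g gS gi|k|f g _ fS _ gS|f g _ fS _ gS].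
- apply: SemiBase => [|x y xy]; first exact: smooth_setc.
  apply: gi => k ik; rewrite !setcE; case: eqP => // /eqP ki.
  by apply: xy; rewrite ltn_neqAle ik andbT; apply: contra ki => /eqP ?; apply/eqP/val_inj.
- have [ki|ki] := eqVneq k i.
    have -> : (fun x => emb (setc x i c 0 k)) = (fun=> emb c).
      by apply/funext => x; rewrite setcE ki eqxx.
    exact: semipoly_cst.
  have -> : (fun x => emb (setc x i c 0 k)) = (fun x => emb (x 0 k)).
    by apply/funext => x; rewrite setcE (negbTE ki).
  exact: SemiCoord.
- exact: (SemiAdd fS gS).
- exact: (SemiMul fS gS).
Qed.

Lemma semipoly_bern (i : 'I_d) n f : semipoly i f -> semipoly i.+1 (bern_coord i n f).
Proof.
move=> fi; suff H (c : nat -> V -> K^o) : (forall k, semipoly i.+1 (c k)) ->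
    semipoly i.+1 (bern_fun i n c).
  by apply: H => k; exact: semipoly_setc.
elim: n c => [|n ih] c cS; first exact: cS.
rewrite bern_funS; apply: SemiAdd; first exact: ih.
apply: SemiMul.
  by apply: ih => k; apply: SemiAdd; [exact: cS|apply: semipolyN; exact: cS].
have -> : (fun x => emb (rescale i x)) = ((fun=> emb (2 * M)^-1) : V -> K) *
    (((fun x => emb (x 0 i)) : V -> K^o) + ((fun=> emb M) : V -> K^o)).
  by apply/funext => x; rewrite /rescale embM embD.
apply: SemiMul; first exact: semipoly_cst.
by apply: SemiAdd; [exact: SemiCoord|exact: semipoly_cst].
Qed.

(** One coordinate after the other, with an error of at most e / (d + 1) each. *)
Lemma semipoly_dense_box k f e : smooth_on setT f -> 0 < e ->
  exists2 p, semipoly d p & cn_le (cbox 0 M) k (p - f) e.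
Proof.
move=> fS e0; pose e1 := e / (d%:R + 1).
have d1 : (0 : R) < d%:R + 1 by rewrite ltr_wpDl.
have e10 : 0 < e1 by rewrite divr_gt0.
have H j : (j <= d)%N -> exists2 p, semipoly j p & cn_le (cbox 0 M) k (p - f) (j%:R * e1).
  elim: j => [_|j ih jd].
    exists f.
      apply: SemiBase => // x y xy; congr f; apply/rowP => i; exact: xy.
    move=> s _ x _; rewrite subrr iter_partial0 nrm0 mul0r//.
  have [p pj pf] := ih (ltnW jd).
  have [n hn] := bern_coord_approx (Ordinal jd) k (semipoly_smooth pj) e10.
  exists (bern_coord (Ordinal jd) n p); first exact: (@semipoly_bern (Ordinal jd)).
  rewrite -natr1 mulrDl mul1r [_ * e1 + _]addrC.
  have bS := bern_coord_smooth (Ordinal jd) n (semipoly_smooth pj).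
  have LU : cbox (0 : V) M `<=` (@setT V)° by rewrite interiorT.
  exact: (cn_le_chain bS (semipoly_smooth pj) fS LU hn pf).
have [p pd pf] := H d (leqnn d).
exists p => //; apply: cn_le_trans pf; rewrite mulrCA ler_piMr ?(ltW e0)//.
by rewrite ler_pdivrMr// mul1r lerDl.
Qed.

End Density.

(** * Polynomials are dense in C^infty(R^d) *)

Section Tensor.
Context {R : realType} {K : numFieldType} {emb : R -> K}.
Context {hK : scalar_field emb} {d : nat}.
Local Notation V := 'rV[R]_d.
Local Notation nrm := (@nrm R K emb).
Local Notation smooth_on := (@smooth_on R K emb d).
Local Notation cn_le := (@cn_le R K emb d).
Implicit Types (U L : set V) (x y : V) (f g : V -> K^o).

Lemma compact_cbox L : compact L -> exists2 M : R, 0 < M & L `<=` cbox 0 M.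
Proof.
move=> cL; have /choice[m hm] i : exists m, 0 <= m /\ forall x, L x -> nrm (emb (x 0 i)) <= m.
  have [m m0 hm] := compact_bound cL (fun x _ => @continuous_coord R K emb hK d i x).
  by exists m.
have s0 : 0 <= \sum_i m i by apply: sumr_ge0 => i _; have [] := hm i.
exists (\sum_i m i + 1) => [|x Lx i]; first by rewrite ltr_wpDl.
rewrite mxE subr0 (bigD1 i)//=.
have [_ /(_ x Lx)] := hm i; rewrite nrm_emb => /le_trans; apply.
rewrite -addrA lerDl addr_ge0// sumr_ge0// => j _; by have [] := hm j.
Qed.

(** The functions on R^d x R^d for which Fubini's theorem is immediate. *)
Inductive tensor : (V -> V -> K) -> Prop :=
| TensorMul (u v : V -> K^o) : smooth_on setT u -> smooth_on setT v ->
    tensor (fun x y => u x * v y)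
| TensorAdd F G : tensor F -> tensor G -> tensor (fun x y => F x y + G x y).

Lemma tensor_mul F G : tensor F -> tensor G -> tensor (fun x y => F x y * G x y).
Proof.
move=> tF tG; elim: tF => {F} [u v uS vS|F F' _ ih _ ih'].
  elim: tG => {G} [u' v' uS' vS'|G G' _ ih _ ih'].
    have -> : (fun x y => u x * v y * (u' x * v' y)) =
        (fun x y => ((u : V -> K) * (u' : V -> K)) x * ((v : V -> K) * (v' : V -> K)) y).
      by apply/funext => x; apply/funext => y; rewrite mulrACA.
    by apply: TensorMul; exact: smoothM.
  have -> : (fun x y => u x * v y * (G x y + G' x y)) =
      (fun x y => u x * v y * G x y + u x * v y * G' x y).
    by apply/funext => x; apply/funext => y; rewrite mulrDr.
  exact: TensorAdd ih ih'.
have -> : (fun x y => (F x y + F' x y) * G x y) =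
    (fun x y => F x y * G x y + F' x y * G x y).
  by apply/funext => x; apply/funext => y; rewrite mulrDl.
exact: TensorAdd ih ih'.
Qed.

(** Since the i-th coordinate of xy is x_i y_i. *)
Lemma semipoly_tensor p : semipoly (emb := emb) d p -> tensor (fun x y => p (hadamard x y)).
Proof.
elim=> {p} [g _ gc|i|f g _ tf _ tg|f g _ tf _ tg].
- have -> : (fun x y => g (hadamard x y)) = (fun x y => (g 0 : K) * 1).
    apply/funext => x; apply/funext => y; rewrite mulr1; apply: gc => i.
    by rewrite leqNgt ltn_ord.
  by apply: (TensorMul (u := fun=> g 0) (v := fun=> 1)); exact: smooth_cst.
- have -> : (fun x y => emb (hadamard x y 0 i)) = (fun x y => emb (x 0 i) * emb (y 0 i)).
    by apply/funext => x; apply/funext => y; rewrite mxE embM.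
  by apply: (TensorMul (u := fun x => emb (x 0 i)) (v := fun x => emb (x 0 i)));
    exact: smooth_coord.
- exact: (TensorAdd tf tg).
- exact: (tensor_mul tf tg).
Qed.

Lemma tensor_dense L k f e : compact L -> smooth_on setT f -> 0 < e ->
  exists p, [/\ smooth_on setT p, tensor (fun x y => p (hadamard x y)) & cn_le L k (p - f) e].
Proof.
move=> cL fS e0; have [M M0 LM] := compact_cbox cL.
have [p pd pf] := semipoly_dense_box M0 k fS e0.
exists p; split; [exact: semipoly_smooth pd|exact: semipoly_tensor|].
exact: cn_le_sub LM (leqnn k) pf.
Qed.

End Tensor.

(** * Multiplicative convolution *)

Section Convolution.
Context {R : realType} {K : numFieldType} {emb : R -> K}.
Context {hK : scalar_field emb} {d : nat}.
Local Notation V := 'rV[R]_d.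
Local Notation smooth_on := (@smooth_on R K emb d).
Local Notation cn_le := (@cn_le R K emb d).
Local Notation distr U := (dual (smoothfun emb U)).
Implicit Types (X Y Z L : set V) (x y : V).

(** The multiplicative convolution of S with a smooth function. *)
Definition conv Y (S : distr Y) (f : V -> K^o) : V -> K^o :=
  fun x => S (to_smooth emb Y (fun y => f (hadamard x y))).

Definition prod_set L L' : set V := mulmap @` row_set L L'.

Lemma prod_setP L L' x y : L x -> L' y -> prod_set L L' (hadamard x y).
Proof.
by move=> Lx Ly; exists (row_mx x y); [exists (x, y)|rewrite mulmap_row].
Qed.

Lemma prod_set_compact L L' : compact L -> compact L' -> compact (prod_set L L').
Proof.
move=> cL cL'; apply: continuous_compact; last exact: row_set_compact.
by apply: continuous_subspaceT; exact: continuous_mulmap.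
Qed.

Lemma conv_pairing Y (S : distr Y) f : conv S f = pairing S (f \o mulmap).
Proof.
apply/funext => x; rewrite /conv /pairing; congr (S (to_smooth emb Y _)).
by apply/funext => y; rewrite /slice /= mulmap_row.
Qed.

Context {X Y Z : set V}.
Hypotheses (oX : open X) (oY : open Y) (oZ : open Z).
Hypothesis XYZ : forall x y, X x -> Y y -> Z (hadamard x y).

Let XYW x y : X x -> Y y -> (mulmap @^-1` Z) (row_mx x y).
Proof. by move=> Xx Yy; rewrite /preimage /= mulmap_row; exact: XYZ. Qed.

Lemma prod_set_in L L1 : compacts_in X L1 -> compacts_in Y L ->
  compacts_in Z (prod_set L1 L).
Proof.
move=> [cL1 LX] [cL LY]; split; first exact: prod_set_compact.
rewrite interior_open// => _ [_ [[x y] [/= L1x Ly] <-] <-]; rewrite mulmap_row.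
by apply: XYZ; [rewrite -(interior_open oX); exact: LX|
  rewrite -(interior_open oY); exact: LY].
Qed.

Lemma conv_smooth (S : distr Y) f : smooth_on Z f -> smooth_on X (conv S f).
Proof.
move=> fZ; rewrite conv_pairing.
apply: (pairing_smooth oX oY (open_mulmap oZ)); first exact: XYW.
exact: smooth_mulmap.
Qed.

(** D depends on S only through L, k and C, hence is uniform for equicontinuous sets
    of distributions. *)
Lemma conv_bound L L1 k k' C : compacts_in X L1 -> compacts_in Y L -> 0 <= C ->
  exists2 D, 0 <= D & forall S : distr Y, dominated L k C S ->
    forall f m, smooth_on Z f -> 0 <= m ->
    cn_le (prod_set L1 L) (k + k') f m -> cn_le L1 k' (conv S f) (D * m).
Proof.
move=> cL1 cL C0.
have L1X : L1 `<=` X by move=> x /cL1.2; rewrite interior_open.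
have LY : L `<=` Y by move=> x /cL.2; rewrite interior_open.
have QZ : row_set L1 L `<=` mulmap @^-1` Z.
  by move=> _ [[x y] [/= /L1X Xx /LY Yy] <-]; exact: XYW.
have [D D0 hD] := cn_mulmap (k + k') oZ (row_set_compact cL1.1 cL.1) QZ.
exists (C * D) => [|S hS f m fZ m0 fm]; first exact: mulr_ge0.
rewrite conv_pairing -mulrA.
apply: (pairing_bound oX oY (open_mulmap oZ) XYW cL L1X hS).
- exact: smooth_mulmap.
- exact: mulr_ge0.
- exact: hD.
Qed.

Lemma hadamard_smooth (f : V -> K^o) x : smooth_on Z f -> X x ->
  smooth_on Y (fun y => f (hadamard x y)).
Proof.
move=> fZ Xx; have -> : (fun y => f (hadamard x y)) = slice (f \o mulmap) x.
  by apply/funext => y; rewrite /slice /= mulmap_row.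
exact: (smooth_slice oY (open_mulmap oZ) XYW Xx (smooth_mulmap oZ fZ)).
Qed.

Lemma conv_linear (S : distr Y) a (f g : V -> K^o) x : smooth_on Z f -> smooth_on Z g ->
  X x -> conv S (a *: f + g) x = a * conv S f x + conv S g x :> K.
Proof.
move=> fZ gZ Xx; rewrite /conv -dual_linear -to_smoothP; do ?exact: hadamard_smooth.
by [].
Qed.

End Convolution.

Section Fubini.
Context {R : realType} {K : numFieldType} {emb : R -> K}.
Context {hK : scalar_field emb} {d : nat}.
Local Notation V := 'rV[R]_d.
Local Notation nrm := (@nrm R K emb).
Local Notation smooth_on := (@smooth_on R K emb d).
Local Notation cn_le := (@cn_le R K emb d).
Local Notation distr U := (dual (smoothfun emb U)).
Context {X Y Z : set V}.
Hypotheses (oX : open X) (oY : open Y) (oZ : open Z).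
Hypothesis XYZ : forall x y, X x -> Y y -> Z (hadamard x y).

Let YXZ y x : Y y -> X x -> Z (hadamard y x).
Proof. by move=> Yy Xx; rewrite hadamardC; exact: XYZ. Qed.

Lemma smooth_setT U (f : V -> K^o) : smooth_on setT f -> smooth_on U f.
Proof. by apply: smooth_sub => y _; rewrite interiorT. Qed.

Lemma tensor_fubini (T : distr X) (S : distr Y) F : tensor (emb := emb) F ->
  [/\ forall x, smooth_on setT (F x), forall y, smooth_on setT (F^~ y),
      smooth_on setT (fun x => S (to_smooth emb Y (F x))),
      smooth_on setT (fun y => T (to_smooth emb X (F^~ y))) &
      T (to_smooth emb X (fun x => S (to_smooth emb Y (F x)))) =
      S (to_smooth emb Y (fun y => T (to_smooth emb X (F^~ y))))].
Proof.
have mulS U (u : V -> K^o) a : smooth_on U u -> to_smooth emb U (a *: u) = a *: to_smooth emb U u.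
  move=> uU; have := to_smoothP a uU (@smooth_on0 _ _ emb _ U); rewrite addr0 => ->.
  rewrite (_ : to_smooth emb U 0 = 0) ?addr0//; apply: smoothfunP => x Ux.
  by rewrite to_smoothE//; exact: smooth_on0.
have addS U (u v : V -> K^o) : smooth_on U u -> smooth_on U v ->
    to_smooth emb U (u + v) = to_smooth emb U u + to_smooth emb U v.
  by move=> uU vU; have := to_smoothP 1 uU vU; rewrite !scale1r.
elim=> {F} [u v uS vS|F G tF [F1 F2 FS FT FE] tG [G1 G2 GS GT GE]].
  have E1 x : to_smooth emb Y (fun y => u x * v y) = u x *: to_smooth emb Y v.
    by rewrite -mulS//; exact: smooth_setT.
  have E2 y : to_smooth emb X (fun x => u x * v y) = v y *: to_smooth emb X u.
    rewrite -mulS; last exact: smooth_setT.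
    by congr (to_smooth emb X _); apply/funext => x; rewrite mulrC.
  have E3 : (fun x => S (to_smooth emb Y (fun y => u x * v y))) = S (to_smooth emb Y v) *: u.
    by apply/funext => x; rewrite E1 dualZ mulrC.
  have E4 : (fun y => T (to_smooth emb X (fun x => u x * v y))) = T (to_smooth emb X u) *: v.
    by apply/funext => y; rewrite E2 dualZ mulrC.
  split.
  - by move=> x; rewrite -[X in smooth_on _ X]/(u x *: v); exact: smoothZ.
  - move=> y; have -> : (fun x => u x * v y) = v y *: u.
      by apply/funext => x; rewrite mulrC.
    exact: smoothZ.
  - by rewrite E3; exact: smoothZ.
  - by rewrite E4; exact: smoothZ.
  - by rewrite E3 E4 !mulS; [rewrite !dualZ mulrC|exact: smooth_setT|exact: smooth_setT].
have E3 : (fun x => S (to_smooth emb Y (fun y => F x y + G x y))) =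
    (fun x => S (to_smooth emb Y (F x))) + (fun x => S (to_smooth emb Y (G x)) : K^o).
  by apply/funext => x; rewrite addS; [rewrite dualD|exact: smooth_setT..].
have E4 : (fun y => T (to_smooth emb X (fun x => F x y + G x y))) =
    (fun y => T (to_smooth emb X (F^~ y))) + (fun y => T (to_smooth emb X (G^~ y)) : K^o).
  by apply/funext => y; rewrite (addS _ (F^~ y) (G^~ y));
    [rewrite dualD|exact: smooth_setT..].
split.
- by move=> x; rewrite -[X in smooth_on _ X]/((F x : V -> K^o) + G x); exact: smoothD.
- by move=> y; rewrite -[X in smooth_on _ X]/((F^~ y : V -> K^o) + G^~ y); exact: smoothD.
- by rewrite E3; exact: smoothD.
- by rewrite E4; exact: smoothD.
- by rewrite E3 E4 !addS ?dualD ?FE ?GE//; exact: smooth_setT.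
Qed.

(** Both sides are continuous in f on C^infty(Z), uniformly in terms of the derivatives
    on one compact set. They agree for polynomials by [tensor_fubini], and polynomials
    are dense. *)
Lemma fubini (T : distr X) (S : distr Y) (f : smoothfun emb Z) :
  T (to_smooth emb X (conv S f)) = S (to_smooth emb Y (conv T f)).
Proof.
have [L1 [k1 [C1 [cL1 C10 hT]]]] := dual_dominated T.
have [L [k [C [cL C0 hS]]]] := dual_dominated S.
have [D D0 hD] := @conv_bound _ _ _ _ _ _ _ _ oX oY oZ XYZ _ _ k k1 _ cL1 cL C0.
have [D1 D10 hD1] := @conv_bound _ _ _ _ _ _ _ _ oY oX oZ YXZ _ _ k1 k _ cL cL1 C10.
have QE : prod_set L L1 = prod_set L1 L.
  apply/seteqP; split=> _ [_ [[x y] [/= Lx Ly] <-] <-]; rewrite mulmap_row hadamardC;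
  exact: prod_setP.
have cQ := prod_set_in oX oY oZ XYZ cL1 cL.
have QZ : prod_set L1 L `<=` Z by move=> z /cQ.2; rewrite interior_open.
have [loc [W [F [_ [oW QW WZ] locE _ _]]]] :=
  @localization _ _ emb _ _ setT Z _ openT oZ (@subsetT _ _) cQ.1 QZ.
apply/eqP; rewrite -subr_eq0; apply/eqP; apply: (nrm_small0 (emb := emb)) => e e0.
have DD : 0 < C1 * D + C * D1 + 1 by rewrite ltr_wpDl// addr_ge0// mulr_ge0.
pose e1 := e / (C1 * D + C * D1 + 1).
have e10 : 0 < e1 by rewrite divr_gt0.
have locS : smooth_on setT (loc f) by exact: smoothfun_smooth.
have [p [pS tp pf]] := tensor_dense (k + k1) cQ.1 locS e10.
have pZ : smooth_on Z p by exact: smooth_setT.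
pose g : V -> K^o := (f : V -> K^o) - p.
have fZ := smoothfun_smooth f.
have gZ : smooth_on Z g by exact: smoothB.
have gm : cn_le (prod_set L1 L) (k + k1) g e1.
  move=> s sk x Qx; have Wx := QW x Qx.
  have E y : W° y -> ((loc f : V -> K^o) - p) y = g y.
    by move=> /interior_subset Wy; rewrite -[LHS]/(loc f y - p y) locE.
  rewrite -(iter_partial_local emb s E) ?interior_open//.
  have Tx : (@setT V)° x by rewrite interiorT.
  rewrite (iter_partialB _ locS pS Tx) nrm_distC -(iter_partialB _ pS locS Tx); exact: pf.
have fE : (f : V -> K^o) = 1 *: g + p.
  by apply/funext => x; rewrite scale1r -[RHS]/(f x - p x + p x) subrK.
have eX : to_smooth emb X (conv S f) = to_smooth emb X (conv S g) + to_smooth emb X (conv S p).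
  apply: smoothfunP => x Xx; have Xx' : X x by rewrite -(interior_open oX).
  rewrite smoothfunDE !to_smoothE//; do ?exact: (conv_smooth oX oY oZ XYZ).
  by rewrite fE (conv_linear oY oZ XYZ S 1 gZ pZ Xx') mul1r.
have eY : to_smooth emb Y (conv T f) = to_smooth emb Y (conv T g) + to_smooth emb Y (conv T p).
  apply: smoothfunP => x Yx; have Yx' : Y x by rewrite -(interior_open oY).
  rewrite smoothfunDE !to_smoothE//; do ?exact: (conv_smooth oY oX oZ YXZ).
  by rewrite fE (conv_linear oX oZ YXZ T 1 gZ pZ Yx') mul1r.
have [_ _ _ _] := tensor_fubini T S tp.
have -> : (fun y => T (to_smooth emb X (fun x => p (hadamard x y)))) = conv T p.
  apply/funext => y; rewrite /conv; congr (T (to_smooth emb X _)).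
  by apply/funext => x; rewrite hadamardC.
rewrite -/(conv S p) => pE; rewrite eX eY !dualD pE.
rewrite opprD addrACA subrr addr0; apply: le_trans (nrmB _ _) _.
have H1 : nrm (T (to_smooth emb X (conv S g))) <= C1 * (D * e1).
  apply: hT; first by rewrite mulr_ge0// ltW.
  apply: (cn_le_local cL1.2 _ (hD S hS g e1 gZ (ltW e10) gm)) => y Xy.
  by rewrite to_smoothE//; exact: (conv_smooth oX oY oZ XYZ).
have H2 : nrm (S (to_smooth emb Y (conv T g))) <= C * (D1 * e1).
  apply: hS; first by rewrite mulr_ge0// ltW.
  have gm' : cn_le (prod_set L L1) (k1 + k) g e1 by rewrite QE addnC.
  apply: (cn_le_local cL.2 _ (hD1 T hT g e1 gZ (ltW e10) gm')) => y Yy.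
  by rewrite to_smoothE//; exact: (conv_smooth oY oX oZ YXZ).
apply: le_trans (lerD H1 H2) _.
rewrite (_ : _ + _ = e * ((C1 * D + C * D1) / (C1 * D + C * D1 + 1))); last first.
  by rewrite /e1; ring.
rewrite ler_piMr ?(ltW e0)//.
by rewrite ler_pdivrMr// mul1r lerDl.
Qed.

End Fubini.

(** * Exhaustions and sets of dilations *)

Section Exhaustions.
Context {R : realType} {d : nat}.
Local Notation V := 'rV[R]_d.
Implicit Types (L Z : set V) (x y : V).

Lemma continuous_hadamard : continuous (fun p : V * V => hadamard p.1 p.2).
Proof.
move=> p; have -> : (fun p : V * V => hadamard p.1 p.2) =
    mulmap \o (fun p : V * V => row_mx p.1 p.2).
  by apply/funext => q; rewrite /= mulmap_row.
by apply: continuous_comp; [exact: continuous_row_mx|exact: continuous_mulmap].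
Qed.

Lemma near_hadamard x y Z : open Z -> Z (hadamard x y) ->
  exists A B, [/\ nbhs x A, nbhs y B & forall x' y', A x' -> B y' -> Z (hadamard x' y')].
Proof.
move=> oZ Zxy; have := @continuous_hadamard (x, y) Z.
case=> [|[A B] /= [Ax By] AB]; first exact: open_nbhs_nbhs.
by exists A, B; split=> // x' y' Ax' By'; exact: (AB (x', y')).
Qed.

Lemma continuous_scal y : continuous (fun x : V => hadamard x y).
Proof.
move=> x; apply: (@cvg_rV _ _ _ (nbhs x) (nbhs_filter x)) => i.
have -> : (fun t : V => hadamard t y 0 i) = (fun t : V => t 0 i * y 0 i).
  by apply/funext => t; rewrite mxE.
rewrite mxE; apply: (@cvgM R); last exact: cvg_cst.
exact: (@coord_continuous R 1 d 0 i x).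
Qed.

(** By compactness of L. *)
Lemma dilations_open L Z : compact L -> open Z -> open (dilations L Z).
Proof.
move=> cL oZ; rewrite openE => x xLZ.
apply: (iffLR (compact_near_coveringP L) cL V (nbhs x) (fun x' y => Z (hadamard x' y))).
move=> y Ly; have [A [B [Ax By AB]]] := near_hadamard oZ (xLZ y Ly).
by exists (B, A) => // -[y' x'] /= [By' Ax']; exact: AB.
Qed.

Lemma dilations_closed L Z : closed Z -> closed (dilations L Z).
Proof.
move=> cZ; have -> : dilations L Z = \bigcap_(y in L) [set x | Z (hadamard x y)].
  by apply/seteqP; split.
apply: closed_bigI => y _.
exact: (closed_comp (fun x _ => @continuous_scal y x) cZ).
Qed.

(** A point without zero coordinates acts invertibly by multiplication. *)
Lemma nonzero_dense y (A : set V) : nbhs y A -> exists2 y', A y' & forall i, y' 0 i != 0.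
Proof.
move=> /nbhs_rV[e e0 eA].
exists (\row_i (if y 0 i == 0 then e / 2 else y 0 i)); last first.
  by move=> i; rewrite mxE; case: ifPn => // _; rewrite gt_eqF// divr_gt0.
apply: eA => i; rewrite mxE; case: eqP => [->|_]; last by rewrite subrr normr0.
by rewrite subr0 ger0_norm ?divr_ge0 ?(ltW e0)// ltr_pdivrMr// ltr_pMr// ltr1n.
Qed.

Definition coord_inv y : V := \row_i (y 0 i)^-1.

Lemma hadamardK y x : (forall i, y 0 i != 0) -> hadamard (hadamard x y) (coord_inv y) = x.
Proof. by move=> y0; apply/rowP => i; rewrite !mxE mulfK. Qed.

Lemma hadamardVK y x : (forall i, y 0 i != 0) -> hadamard (hadamard x (coord_inv y)) y = x.
Proof. by move=> y0; apply/rowP => i; rewrite !mxE mulfVK. Qed.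

Section Exh.
Context {Omega : set V} {omega : nat -> set V}.
Hypothesis exh : exhaustion Omega omega.

Lemma exh_cover y : Omega y -> exists n, omega n y.
Proof. by case: exh => _ _ _ <- [n _ ny]; exists n. Qed.

Lemma exh_open n : open (omega n).
Proof. by case: exh => + _ _ _; apply. Qed.

Lemma exh_closure_compact n : compact (closure (omega n)).
Proof. by case: exh => _ + _ _; apply. Qed.

Lemma exh_closure_sub n : closure (omega n) `<=` omega n.+1.
Proof. by case: exh => _ _ + _; apply. Qed.

Lemma exh_sub n : omega n `<=` Omega.
Proof. by case: exh => _ _ _ <- x nx; exists n. Qed.

Lemma exh_closure_in n : closure (omega n) `<=` Omega.
Proof. exact: subset_trans (@exh_closure_sub n) (@exh_sub _). Qed.

Lemma exh_mono m n : (m <= n)%N -> omega m `<=` omega n.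
Proof.
elim: n => [|n ih]; first by rewrite leqn0 => /eqP ->.
rewrite leq_eqVlt => /orP[/eqP -> //|]; rewrite ltnS => /ih mn x /mn nx.
by apply: exh_closure_sub; exact: subset_closure.
Qed.

Lemma exh_compact L : compact L -> L `<=` Omega -> exists n, L `<=` omega n.
Proof.
rewrite compact_cover => cL LO.
have [||D _ LD] := cL nat setT omega.
- by move=> n _; exact: exh_open.
- by move=> x /LO; case: exh => _ _ _ <- [n _ nx]; exists n.
exists (\max_(n <- finmap.enum_fset D) n)%N => x /LD[n nD nx].
by apply: exh_mono nx; exact: leq_bigmax_seq.
Qed.

Lemma exh_dilations_open n : open Omega -> open (dilations (closure (omega n)) Omega).
Proof. by move=> oO; apply: dilations_open oO; exact: exh_closure_compact. Qed.

Lemma dilations_exh n : dilations Omega Omega `<=` dilations (closure (omega n)) Omega.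
Proof. by move=> eta h x /exh_closure_in; exact: h. Qed.

Lemma exh_mul n x y : omega n x -> dilations (closure (omega n)) Omega y ->
  Omega (hadamard x y).
Proof. by move=> nx yn; rewrite hadamardC; apply: yn; exact: subset_closure. Qed.

Lemma exh_mul' n x y : dilations (closure (omega n)) Omega x -> omega n y ->
  Omega (hadamard x y).
Proof. by move=> xn ny; apply: xn; exact: subset_closure. Qed.

End Exh.
End Exhaustions.

(** * The operator N_T *)

Section Operators.
Context {R : realType} {K : numFieldType} {emb : R -> K}.
Context {hK : scalar_field emb} {d : nat}.
Local Notation V := 'rV[R]_d.
Local Notation smooth_on := (@smooth_on R K emb d).
Local Notation cn_le := (@cn_le R K emb d).
Local Notation distr U := (dual (smoothfun emb U)).
Local Notation distrT := (dual (smoothfun emb (@setT V))).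
Context {Omega : set V} {omega : nat -> set V}.
Hypothesis oO : open Omega.
Hypothesis exh : exhaustion Omega omega.
Local Notation U n := (dilations (closure (omega n)) Omega).
Implicit Types (L : set V) (x y : V).

Let oU n : open (U n). Proof. exact: (exh_dilations_open exh). Qed.
Let oom n : open (omega n). Proof. exact: (exh_open exh). Qed.

Lemma distr_on_supp (A : set V) (T : distr_on emb A) : supp (distr_on_val T) `<=` A.
Proof. by have /set_mem[] := valP T. Qed.

Lemma extension_restr (A A' : set V) (T : distrT) (g : smoothfun emb A) : open A' ->
  open A -> supp T `<=` A' -> A' `<=` A ->
  extension A' T (to_smooth emb A' g) = extension A T g.
Proof.
move=> oA' oA TA' A'A; have TA := subset_trans TA' A'A.
have [loc [W [F [_ [oW TW WA] locE _ _]]]] :=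
  localization (emb := emb) openT oA (@subsetT _ _) (@supp_compact _ _ emb hK _ T) TA.
rewrite (extensionE (G := loc g) oA TA oW TW) => [|x Wx _]; last exact: locE.
apply: (extensionE oA' TA' oW TW) => x Wx Ax; rewrite locE// to_smoothE ?interior_open//.
by apply: smoothfun_sub; rewrite !interior_open.
Qed.

Section OneDistribution.
Context (T : distrT).
Hypothesis TV : supp T `<=` dilations Omega Omega.

Let TU n : supp T `<=` U n.
Proof. exact: subset_trans TV (dilations_exh exh (n := n)). Qed.

(** The function y |-> T_x f(xy) on Omega, for f in C^infty(Omega). The set of those x
    with xy in Omega is an open neighbourhood of supp T that depends on y. *)
Definition dual_conv (f : V -> K^o) : V -> K^o := fun y =>
  extension (dilations [set y] Omega) T
    (to_smooth emb (dilations [set y] Omega) (fun x => f (hadamard x y))).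

(** On omega_n the neighbourhood may be taken to be U_n, independently of y. *)
Lemma dual_convE n f y : smooth_on Omega f -> omega n y ->
  dual_conv f y = conv (extension (U n) T) f y.
Proof.
move=> fO ny; have cy : compact [set y] by exact: compact_set1.
have oD : open (dilations [set y] Omega) by exact: dilations_open.
have UD : U n `<=` dilations [set y] Omega.
  by move=> x xn _ ->; apply: xn; exact: subset_closure.
have TD := subset_trans (@TU n) UD.
have fy : smooth_on (dilations [set y] Omega) (fun x => f (hadamard x y)).
  have -> : (fun x => f (hadamard x y)) = (fun x => f (hadamard y x)).
    by apply/funext => x; rewrite hadamardC.
  apply: (@hadamard_smooth _ _ _ _ _ [set y] _ Omega) => //.
  by move=> _ x -> xD; rewrite hadamardC; exact: xD.
rewrite /dual_conv /conv -(extension_restr _ (@oU n) oD (@TU n) UD).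
congr (extension _ _ _); apply: smoothfunP => x; rewrite interior_open// => Ux.
rewrite !to_smoothE ?interior_open//; first by rewrite hadamardC.
- by apply: (hadamard_smooth (X := omega n) (Y := U n) (Z := Omega)) => // x' y'; exact: exh_mul.
- exact: UD.
- by apply: smoothfun_sub; rewrite !interior_open.
Qed.

Lemma conv_ext_smooth n f : smooth_on Omega f ->
  smooth_on (omega n) (conv (extension (U n) T) f).
Proof. by move=> fO; apply: (conv_smooth (@oom n) (@oU n) oO (exh_mul (omega := omega) (n := n))). Qed.

Lemma dual_conv_smooth f : smooth_on Omega f -> smooth_on Omega (dual_conv f).
Proof.
move=> fO; apply: smooth_glue => y; rewrite interior_open// => Oy.
have [n ny] := exh_cover exh Oy.
exists (omega n); first exact: open_nbhs_nbhs.
apply: smooth_eq (conv_ext_smooth (n := n) fO) => z; rewrite interior_open// => nz.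
exact/esym/dual_convE.
Qed.

Definition dual_conv_op (f : smoothfun emb Omega) : smoothfun emb Omega :=
  to_smooth emb Omega (dual_conv f).

Lemma dual_conv_opE n (f : smoothfun emb Omega) y : omega n y ->
  dual_conv_op f y = conv (extension (U n) T) f y.
Proof.
move=> ny; have fO := smoothfun_smooth f.
rewrite /dual_conv_op to_smoothE; first exact: dual_convE.
  exact: dual_conv_smooth.
by rewrite interior_open//; exact: (exh_sub exh ny).
Qed.

Lemma dual_conv_op_linear : linear dual_conv_op.
Proof.
move=> a f g; apply: smoothfunP => y; rewrite interior_open// => Oy.
have [n ny] := exh_cover exh Oy.
rewrite smoothfunDE smoothfunZE !(dual_conv_opE _ ny).
exact: (conv_linear (@oU n) oO (exh_mul (omega := omega) (n := n)) _ _
  (smoothfun_smooth f) (smoothfun_smooth g) ny).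
Qed.

(** A compact subset of Omega is contained in some omega_n, where [conv_bound] applies. *)
Lemma dual_conv_op_bound L k : compacts_in Omega L ->
  exists L' k' D, [/\ compacts_in Omega L', 0 <= D &
    forall (f : smoothfun emb Omega) m, 0 <= m -> cn_le L' k' f m ->
      cn_le L k (dual_conv_op f) (D * m)].
Proof.
move=> cL; have LO : L `<=` Omega by move=> x /cL.2; rewrite interior_open.
have [n Ln] := exh_compact exh cL.1 LO.
have cLn : compacts_in (omega n) L by split; [case: cL|rewrite interior_open].
have [L2 [k2 [C [cL2 C0 hT]]]] := dual_dominated (extension (U n) T).
have [D D0 hD] := conv_bound (@oom n) (@oU n) oO (exh_mul (omega := omega) (n := n)) k2 k cLn cL2 C0.
exists (prod_set L L2), (k2 + k)%N, D; split=> //.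
  exact: (prod_set_in (@oom n) (@oU n) oO (exh_mul (omega := omega) (n := n)) cLn cL2).
move=> f m m0 fm.
apply: (cn_le_local cLn.2 _ (hD _ hT f m (smoothfun_smooth f) m0 fm)) => y.
by rewrite interior_open// => ny; rewrite (dual_conv_opE _ ny).
Qed.

Lemma Nop_subproof (S : distr Omega) :
  linear (fun f => S (dual_conv_op f) : K^o) /\ continuous (fun f => S (dual_conv_op f) : K^o).
Proof.
have ul : linear (fun f => S (dual_conv_op f) : K^o).
  by move=> a f g; rewrite dual_conv_op_linear dual_linear.
split=> //; have [L [k [C [cL C0 hS]]]] := dual_dominated S.
have [L' [k' [D [cL' D0 hD]]]] := dual_conv_op_bound k cL.
apply: (dominated_continuous (k := k') (C := C * D) ul cL'); first exact: mulr_ge0.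
by move=> f m m0 fm; rewrite -mulrA; apply: hS; [exact: mulr_ge0|exact: hD].
Qed.

(** N_T as the transpose of f |-> T_x f(xy), a continuous map of C^infty(Omega). *)
Definition Nop (S : distr Omega) : distr Omega :=
  MkDual (Nop_subproof S).1 (Nop_subproof S).2.

Lemma NopE S f : Nop S f = S (dual_conv_op f).
Proof. by []. Qed.

Lemma Nop_linear : linear Nop.
Proof. by move=> a S S'; apply: dualP. Qed.

Lemma Nop_continuous : continuous Nop.
Proof.
move=> S W /(dual_nbhs_basis (emb := emb))[B [e [bB e0 BW]]].
have bB' : bounded_subset (dual_conv_op @` B).
  apply/smooth_boundedP => L k cL.
  have [L' [k' [D [cL' D0 hD]]]] := dual_conv_op_bound k cL.
  have [m hm] := (smooth_boundedP B).1 bB L' k' cL'.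
  exists (D * Num.max m 0) => _ [f Bf <-]; apply: hD; first by rewrite le_max lexx orbT.
  by apply: cn_le_trans (hm f Bf); rewrite le_max lexx.
have := dual_nbhs (emb := emb) (hK := hK) S bB' e0.
move=> H; change (nbhs S (Nop @^-1` W)); apply: (@filterS _ (nbhs S) (nbhs_filter S) _ _ _ H) => S' h; apply: BW => f Bf.
by rewrite !NopE; apply: h; exists f.
Qed.

(** By Fubini's theorem for T and S. *)
Lemma Nop_mconv : is_mconv_op T Nop.
Proof.
move=> S F; rewrite /mconv -/(conv S F).
have XYZ : forall x y : V, (@setT V) x -> Omega y -> (@setT V) (hadamard x y) by [].
have := fubini openT oO openT XYZ T S F; rewrite /conv => ->.
rewrite NopE; congr (S _); apply: smoothfunP => y Oy'.
have Oy : Omega y by rewrite -(interior_open oO).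
have FO : smooth_on Omega (to_smooth emb Omega F) by exact: smoothfun_smooth.
have [n ny] := exh_cover exh Oy.
have FS := smoothfun_smooth F.
have Fx x : smooth_on setT (fun y => F (hadamard x y)).
  exact: (hadamard_smooth openT openT (X := setT) (Z := setT)).
rewrite to_smoothE//; last first.
  by apply: (conv_smooth oO openT openT (Z := setT)).
rewrite (dual_conv_opE _ ny) /conv; apply/esym.
apply: (extensionE (@oU n) (@TU n) (@oU n) (@TU n)) => x Ux _.
rewrite !to_smoothE ?interiorT ?interior_open//.
- exact: testfun_smooth.
- by rewrite hadamardC; apply: exh_mul' Ux ny.
- by apply: (hadamard_smooth (X := omega n) (Y := U n) (Z := Omega)) FO ny => //; exact: exh_mul.
Qed.

End OneDistribution.
End Operators.

(** * Point masses *)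

Section Deltas.
Context {R : realType} {K : numFieldType} {emb : R -> K}.
Context {hK : scalar_field emb} {d : nat}.
Local Notation V := 'rV[R]_d.
Local Notation distr U := (dual (smoothfun emb U)).
Local Notation testfun := (smoothfun emb (@setT V)).
Local Notation distrT := (dual (smoothfun emb (@setT V))).
Implicit Types (U L : set V) (x y : V).

Lemma eval_subproof U y :
  linear (fun f : contfun K U => f y : K^o) /\ continuous (fun f : contfun K U => f y : K^o).
Proof.
split=> // f; have [Uy|Uy] := pselect (U° y); last first.
  have -> : (fun f : contfun K U => f y : K^o) = cst 0.
    by apply/funext => g; have /set_mem[_ ->] := valP g.
  exact: cst_continuous.
apply: (iffRL (@cvg_nrmP _ _ emb _ _ (nbhs f) (nbhs_filter f) _ _)) => e e0.
have cy : compacts_in U [set y] by split; [exact: compact_set1|move=> _ ->].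
have H := cont_nbhs (emb := emb) (hK := hK) f cy e0.
by apply: (@filterS _ (nbhs f) (nbhs_filter f) _ _ _ H) => g; apply.
Qed.

Definition dirac_measure U y : dual (contfun K U) :=
  MkDual (eval_subproof U y).1 (eval_subproof U y).2.

Lemma dirac_bounded U L : compacts_in U L ->
  bounded_subset [set dirac_measure U y | y in L].
Proof.
move=> cL; apply/(dual_boundedP (emb := emb)) => B bB.
have [m hm] := cont_bounded (emb := emb) bB cL.
by exists m => _ f [y Ly <-] Bf; exact: hm.
Qed.

Lemma measure_distr_linear U : linear (measure_distr emb U).
Proof. by move=> a mu nu; apply: dualP. Qed.

Lemma measure_distr_continuous U : continuous (measure_distr emb U).
Proof.
move=> mu W /(dual_nbhs_basis (emb := emb))[B [e [bB e0 BW]]].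
have bB' : bounded_subset (@Defs.incl R K emb d U @` B).
  apply: bounded_image bB => [a f|]; last exact: incl_continuous.
  exact/val_inj.
have H := dual_nbhs (emb := emb) (hK := hK) mu bB' e0.
change (nbhs mu (measure_distr emb U @^-1` W)).
apply: (@filterS _ (nbhs mu) (nbhs_filter mu) _ _ _ H) => nu h; apply: BW => f Bf.
by apply: h; exists f.
Qed.

Lemma linear_scale (E F : preTopologicalLmodType K) (u : E -> F) a f :
  linear u -> u (a *: f) = a *: u f.
Proof.
move=> ul; have u0 : u 0 = 0 by have := ul (-1) 0 0; rewrite scaler0 addr0 scaleN1r addNr.
by have := ul a f 0; rewrite u0 !addr0.
Qed.

Lemma measure_distr_bounded U (B : set (dual (contfun K U))) :
  bounded_subset B -> bounded_subset (measure_distr emb U @` B).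
Proof.
apply: bounded_image => [a f|]; first exact/linear_scale/measure_distr_linear.
exact: measure_distr_continuous.
Qed.

Definition scal y (f : testfun) : testfun :=
  to_smooth emb setT (fun x => f (hadamard x y)).

Lemma scalE y f x : scal y f x = f (hadamard x y).
Proof.
rewrite /scal to_smoothE ?interiorT//.
have -> : (fun x => f (hadamard x y)) = (fun x => f (hadamard y x)).
  by apply/funext => z; rewrite hadamardC.
by apply: (hadamard_smooth (X := setT) (Y := setT) (Z := setT)) => //;
  [exact: openT|exact: openT|exact: smoothfun_smooth].
Qed.

Lemma scalK y f : (forall i, y 0 i != 0) -> scal y (scal (coord_inv y) f) = f.
Proof. by move=> y0; apply: smoothfunP => x _; rewrite !scalE hadamardK. Qed.

Lemma mconv_dirac U (T : distrT) y f : open U -> U y ->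
  mconv T (measure_distr emb U (dirac_measure U y)) f = T (scal y f).
Proof.
move=> oU Uy; rewrite /mconv /scal; congr (T (to_smooth _ _ _)); apply/funext => x.
rewrite /= to_smoothE ?interior_open//.
apply: (hadamard_smooth (X := setT) (Y := U) (Z := setT)) => //; first exact: openT.
exact: smoothfun_smooth.
Qed.

Context {Omega : set V}.
Hypothesis oO : open Omega.
Local Notation delta y := (measure_distr emb Omega (dirac_measure Omega y)).

(** As (N_T delta_y) f = T_x f(xy), and x |-> xy is invertible. *)
Lemma op_dirac (T : distrT) (N : distr Omega -> distr Omega) y f : is_mconv_op T N ->
  Omega y -> (forall i, y 0 i != 0) ->
  T f = N (delta y) (to_smooth emb Omega (scal (coord_inv y) f)).
Proof.
move=> TN Oy y0; rewrite -TN (mconv_dirac _ _ oO Oy); congr (T _).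
by rewrite scalK.
Qed.

(** One point of Omega without zero coordinates determines T, by [op_dirac]. *)
Lemma mconv_op_inj (T T' : distrT) (N : distr Omega -> distr Omega) : Omega !=set0 ->
  is_mconv_op T N -> is_mconv_op T' N -> T = T'.
Proof.
move=> [y0 Oy0] TN TN'; have [y Oy y1] := nonzero_dense (open_nbhs_nbhs (conj oO Oy0)).
by apply: dualP => f; rewrite (op_dirac f TN Oy y1) (op_dirac f TN' Oy y1).
Qed.

End Deltas.

(** * Equicontinuity and the support of T *)

Section Equicontinuity.
Context {R : realType} {K : numFieldType} {emb : R -> K}.
Context {hK : scalar_field emb} {d : nat}.
Local Notation V := 'rV[R]_d.
Local Notation nrm := (@nrm R K emb).
Local Notation cn_le := (@cn_le R K emb d).
Local Notation distr U := (dual (smoothfun emb U)).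
Local Notation distrT := (dual (smoothfun emb (@setT V))).
Context {Omega : set V} {omega : nat -> set V}.
Hypothesis oO : open Omega.
Hypothesis exh : exhaustion Omega omega.

(** Otherwise some S_n in B' and g_n have |S_n g_n| > n + 1 while the
    derivatives of g_n of order at most n are at most 1 on omega_n. But then
    {g_n} is bounded, so that the numbers S_n g_n are bounded. *)
Lemma equicontinuous (B' : set (distr Omega)) : bounded_subset B' ->
  exists L k C, [/\ compacts_in Omega L, 0 <= C & forall S, B' S -> dominated L k C S].
Proof.
move=> bB; apply: contrapT => nh.
have cO n : compacts_in Omega (closure (omega n)).
  split; first exact: (exh_closure_compact exh).
  by rewrite interior_open//; exact: (exh_closure_in exh).
have /choice[g hg] n : exists g : smoothfun emb Omega, cn_le (closure (omega n)) n g 1 /\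
    exists2 S, B' S & n.+1%:R < nrm (S g).
  apply: contrapT => ng; apply: nh; exists (closure (omega n)), n, (n.+1%:R^-1)^-1.
  split=> [//||]; first by rewrite invrK ler0n.
  move=> S BS; apply: dominated_scaling => // [a f|f fe]; first exact: dualZ.
  have n0 : (0 : R) < n.+1%:R by rewrite ltr0n.
  rewrite leNgt; apply/negP => Sf; apply: ng; exists (emb n.+1%:R *: f); split.
    have := cn_leZ (emb n.+1%:R) (cO n) fe.
    by rewrite nrm_emb gtr0_norm// mulfV ?gt_eqF//; exact.
  by exists S => //; rewrite dualZ nrmM nrm_emb gtr0_norm// -[ltLHS]mulr1 ltr_pM2l.
have bg : bounded_subset (range g).
  apply/(smooth_boundedP (emb := emb)) => L k cL.
  have LO : L `<=` Omega by move=> x /cL.2; rewrite interior_open.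
  have [n0 Ln0] := exh_compact exh cL.1 LO.
  have [m hm] : exists m, forall n, (n < maxn n0 k)%N -> cn_le L k (g n) m.
    elim: (maxn n0 k) => [|M [m hm]]; first by exists 0.
    have [m' _ hm'] := cn_bounded k (smoothfun_smooth (g M)) cL.
    exists (Num.max m m') => n; rewrite ltnS leq_eqVlt => /orP[/eqP ->|/hm].
      by apply: cn_le_trans hm'; rewrite le_max lexx orbT.
    by apply: cn_le_trans; rewrite le_max lexx.
  exists (Num.max m 1) => _ [n _ <-].
  have [nM|] := ltnP n (maxn n0 k).
    by apply: cn_le_trans (hm n nM); rewrite le_max lexx.
  rewrite geq_max => /andP[n0n kn]; have [gn _] := hg n.
  apply: cn_le_trans (_ : cn_le L k (g n) 1); first by rewrite le_max lexx orbT.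
  apply: cn_le_sub kn gn => x /Ln0 /(exh_mono exh n0n); exact: subset_closure.
have [m hm] := (dual_boundedP (emb := emb) B').1 bB _ bg.
have [_ [S BS]] := hg (Num.bound `|m|); rewrite ltNge => /negP; apply.
have gr : range g (g (Num.bound `|m|)) by exists (Num.bound `|m|).
apply: le_trans (hm S _ BS gr) _; apply: le_trans (ler_norm m) _; apply: ltW.
have := archi_boundP (normr_ge0 m) => /lt_trans; apply.
by rewrite ltr_nat.
Qed.

(** Near a point y of Omega the measures delta_y' form a bounded set, so all
    N delta_y' are supported in one compact subset L of Omega. If y' has no zero
    coordinates the support of N delta_y' is that of T, multiplied by y'; and
    such y' are dense. *)
Lemma supp_dilations (T : distrT) (N : distr Omega -> distr Omega) : linear N ->
  continuous N -> is_mconv_op T N -> supp T `<=` dilations Omega Omega.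
Proof.
move=> Nl Nc TN eta sT y Oy.
have [r r0 rO] := nbhs_cbox (open_nbhs_nbhs (conj oO Oy)).
have cB : compacts_in Omega (cbox y r) by split; [exact: cbox_compact|rewrite interior_open].
have bD := measure_distr_bounded (hK := hK) (dirac_bounded (emb := emb) (hK := hK) cB).
have bN := bounded_image (u := N) (fun a f => linear_scale a f Nl) (@Nc 0) bD.
have [L [k [C [cL C0 hN]]]] := equicontinuous bN.
have clL : closed L by apply: compact_closed cL.1; exact: norm_hausdorff.
have key y' : cbox y r y' -> (forall i, y' 0 i != 0) -> L (hadamard eta y').
  move=> yy' y'0; apply: contrapT => nL; apply: sT.
  have oL : open (~` L) by exact: closed_openC.
  exists [set x | ~ L (hadamard x y')]; last exact: nL.
    split; first exact: (open_comp (fun x _ => @continuous_scal _ _ y' x) oL).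
    move=> f /= cf fL; rewrite (op_dirac (hK := hK) oO f TN (rO _ yy') y'0).
    have dN : dominated L k C (N (measure_distr emb Omega (dirac_measure Omega y'))).
      by apply: hN; exists (measure_distr emb Omega (dirac_measure Omega y')) => //;
        exists (dirac_measure Omega y') => //; exists y'.
    rewrite -(dual0 (N (measure_distr emb Omega (dirac_measure Omega y')))).
    have oF : open (~` closure [set x | f x != 0]) by exact/closed_openC/closed_closure.
    have oW := open_comp (fun x _ => @continuous_scal _ _ (coord_inv y') x) oF.
    have LO x : L x -> Omega x by move=> /cL.2; rewrite interior_open.
    apply: (dominated_germ cL dN (openI oW oO)) => [x Lx|x [nx Ox]].
      split; last exact: LO.
      by move=> /= /fL /=; rewrite hadamardVK.
    rewrite restrE ?interior_open// scalE; apply/eqP/negPn/negP => fx.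
    by apply: nx => /=; exact: subset_closure.
apply: contrapT => nO; have nLy : ~ L (hadamard eta y).
  by move=> /cL.2; rewrite interior_open.
have oL : open (~` L) by exact: closed_openC.
have oW : open [set y' | ~ L (hadamard eta y')].
  have -> : [set y' | ~ L (hadamard eta y')] = (fun y' => hadamard y' eta) @^-1` (~` L).
    by apply/seteqP; split => y' /=; rewrite hadamardC.
  exact: (open_comp (fun x _ => @continuous_scal _ _ eta x) oL).
have yW : nbhs y [set y' | ~ L (hadamard eta y')] by exact: open_nbhs_nbhs.
have [y' [y'r y'W] y'0] := nonzero_dense (filterI (box_nbhs y r0) yW).
by apply: y'W; apply: key => //; exact: box_cbox.
Qed.

End Equicontinuity.

(** * A cover of V(Q, Omega) by boxes *)

Section AdaptedCover.
Context {R : realType} {d : nat}.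
Local Notation V := 'rV[R]_d.
Context {Omega : set V} {omega : nat -> set V}.
Hypothesis exh : exhaustion Omega omega.
Implicit Types (L Q : set V) (x y : V).

(** The empty set is put in front so that the shells [shell m] in the next proof cover
    V(Q, Omega) from the start, with closure om_(m-1) contained in om_m also for m = 0,
    where m-1 stands for 0. *)
Let om m := if m is m'.+1 then omega m' else set0.

Let exh_om : exhaustion Omega om.
Proof.
split=> [[|m]|[|m]|[|m]|].
- exact: open0.
- exact: (exh_open exh).
- by rewrite closure0; exact: compact0.
- exact: (exh_closure_compact exh).
- by rewrite closure0; exact: sub0set.
- exact: (exh_closure_sub exh).
case: exh => _ _ _ <-; apply/seteqP; split=> x [m _ mx]; last by exists m.+1.
by case: m mx => // m mx; exists m.
Qed.

(** The boxes of index (m, i) cover the compact set of those x in V(Q, closure om_(m+1))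
    that do not map Q to om_m. Such an x maps a point of Q, hence a nearby
    point y without zero coordinates, out of closure om_(m-1); so the products of y
    with points near x leave every compact subset of Omega as m grows. Boxes are
    indexed by natural numbers through a numbering of pairs, and unused numbers get
    no box. *)
Lemma adapted_cover Q O1 y0 : open Omega -> compact Q -> open O1 -> Q `<=` O1 -> Q y0 ->
  (forall i, y0 0 i != 0) ->
  exists p : nat -> option (V * R * V),
  [/\ forall j a r y, p j = Some (a, r, y) ->
        [/\ 0 < r, cbox a (2 * r) `<=` dilations Q Omega, O1 y & forall i, y 0 i != 0],
      forall L, compact L -> L `<=` dilations Q Omega -> exists J W,
        [/\ open W, L `<=` W & forall x, W x -> exists j a r y,
          [/\ (j < J)%N, p j = Some (a, r, y) & cbox a r x]] &
      forall L, compact L -> L `<=` Omega -> exists J W,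
        [/\ open W, L `<=` W & forall j a r y, (J <= j)%N -> p j = Some (a, r, y) ->
          forall x, cbox a (2 * r) x -> ~ W (hadamard x y)]].
Proof.
move=> oO cQ oO1 QO1 Qy0 y00.
pose X m := dilations Q (om m); pose Xc m := dilations Q (closure (om m)).
have oX m : open (X m) by apply: dilations_open cQ _; exact: (exh_open exh_om).
have XXc m : X m `<=` Xc m by move=> x h y /h; exact: subset_closure.
have XcX m : Xc m `<=` X m.+1 by move=> x h y /h; exact: (exh_closure_sub exh_om).
have XcO m : Xc m `<=` dilations Q Omega by move=> x h y /h; exact: (exh_closure_in exh_om).
have oQO : open (dilations Q Omega) by exact: dilations_open.
have cXc m : compact (Xc m).
  apply: (@subclosed_compact _ _ ((fun z => hadamard z (coord_inv y0)) @` closure (om m))).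
  - by apply: dilations_closed; exact: closed_closure.
  - apply: continuous_compact; last exact: (exh_closure_compact exh_om).
    by apply: continuous_subspaceT => z; exact: continuous_scal.
  - by move=> x h; exists (hadamard x y0); [exact: h|exact: hadamardK].
pose shell m := Xc m.+1 `\` X m.
have cshell m : compact (shell m).
  apply: (@subclosed_compact _ _ (Xc m.+1)) => //; last exact: subDsetl.
  by rewrite /shell setDE; apply: closedI; [apply: dilations_closed; exact: closed_closure|exact: open_closedC].
pose good m a r y := [/\ cbox a (2 * r) `<=` dilations Q Omega, O1 y,
  forall i, y 0 i != 0 & forall x, cbox a (2 * r) x -> ~ closure (om m.-1) (hadamard x y)].
have /choice[l hl] m : exists l : seq (V * R * V),
    (forall p, p \in l -> 0 < p.1.2 /\ good m p.1.1 p.1.2 p.2) /\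
    forall x, shell m x -> exists2 p, p \in l & box p.1.1 p.1.2 x.
  apply: finite_box_cover (cshell m) _ => x [xXc nX].
  have [y Qy ny] : exists2 y, Q y & ~ closure (om m.-1) (hadamard x y).
    apply: contrapT => h; apply: nX => y Qy; apply: contrapT => ny; apply: h.
    exists y => // clom; apply: ny; case: m {xXc} clom => [|m] /=.
      by rewrite closure0.
    exact: (exh_closure_sub exh_om).
  have oC : open (~` closure (om m.-1)) by exact/closed_openC/closed_closure.
  have [A [A' [xA yA' AA]]] := near_hadamard oC ny.
  have yO1 : nbhs y O1 by apply: open_nbhs_nbhs; split=> //; exact: QO1.
  have [y' [y'A y'O] y'0] := nonzero_dense (filterI yA' yO1).
  have xU : nbhs x (dilations Q Omega) by apply: open_nbhs_nbhs; split=> //; exact: XcO xXc.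
  have [r r0 rA] := nbhs_cbox (filterI xA xU).
  exists (r / 2), y'; split; first by rewrite divr_gt0.
  have r2 : 2 * (r / 2) = r by rewrite mulrC divfK ?pnatr_eq0.
  rewrite /good r2; split; [by move=> z /rA[]|exact: y'O|exact: y'0|].
  by move=> z /rA[zA _]; exact: AA zA y'A.
pose p j := if (pickle_inv j : option (nat * nat)) is Some mi then onth (l mi.1) mi.2 else None.
have pP j q : p j = Some q -> exists m i, [/\ j = pickle (m, i), (i < size (l m))%N &
    q \in l m].
  rewrite /p; case E : (pickle_inv j) => [[m i]|//] /= lm; exists m, i; split.
  - by have := pickle_invK (T := (nat * nat)%type) j; rewrite E.
  - by rewrite -onthTE lm.
  - by apply/onthP; exists i.
have pE m q : q \in l m -> exists2 i, (i < size (l m))%N & p (pickle (m, i)) = Some q.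
  move=> /onthP[i lmi]; exists i; first by rewrite -onthTE lmi.
  by rewrite /p pickleK_inv.
have bound M : exists J, forall m i, (m < M)%N -> (i < size (l m))%N -> (pickle (m, i) < J)%N.
  exists (\max_(m < M) \max_(i < size (l m)) (pickle (nat_of_ord m, nat_of_ord i)).+1)%N.
  move=> m i mM im.
  apply: leq_trans (leq_bigmax_cond (Ordinal mM) isT).
  exact: (@leq_bigmax_cond _ xpredT (fun i : 'I_(size (l m)) => (pickle (m, nat_of_ord i)).+1)
    (Ordinal im) isT).
exists p; split.
- move=> j a r y /pP[m [i [_ _ /(hl m).1/= [r0 []]]]] => ? ? ? _; split=> //.
- move=> L cL LU; have [||M LM] := exh_compact exh_om (L := prod_set L Q).
  + exact: prod_set_compact.
  + by move=> _ [_ [[x y] /= [Lx Qy] <-] <-]; rewrite mulmap_row; exact: LU.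
  have [J hJ] := bound M; exists J, (X M); split=> //.
    by move=> x Lx y Qy; apply: LM; exact: prod_setP.
  move=> x XMx; suff [m mM sx] : exists2 m, (m < M)%N & shell m x.
    have [[[a r] y] lq xq] := (hl m).2 x sx; have [i im pi] := pE m _ lq.
    by exists (pickle (m, i)), a, r, y; split=> //; [exact: hJ|exact: box_cbox].
  elim: (M) XMx => [|M' ih] XMx; first by have := XMx y0 Qy0.
  have [/ih[m mM sx]|nX] := pselect (X M' x); first by exists m => //; exact: ltnW.
  by exists M' => //; split=> //; exact: XXc.
- move=> L cL LO; have [M LM] := exh_compact exh_om cL LO; have [J hJ] := bound M.+1.
  exists J, (om M); split=> //; first exact: (exh_open exh_om).
  move=> j a r y Jj /pP[m [i [jE im /(hl m).1/= [r0 [_ _ _ far]]]]] x xa omx.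
  have [mM|Mm] := ltnP m M.+1.
    by have := hJ m i mM im; rewrite -jE ltnNge Jj.
  apply: (far x xa); apply: subset_closure; apply: (exh_mono exh_om) omx.
  by case: m Mm {jE im far}.
Qed.

End AdaptedCover.

(** * Estimating T by N_T on point masses *)

Section DiracEstimate.
Context {R : realType} {K : numFieldType} {emb : R -> K}.
Context {hK : scalar_field emb} {d : nat}.
Local Notation V := 'rV[R]_d.
Local Notation nrm := (@nrm R K emb).
Local Notation smooth_on := (@smooth_on R K emb d).
Local Notation cn_le := (@cn_le R K emb d).
Local Notation plateau := (@plateau R K emb d).
Local Notation distr U := (dual (smoothfun emb U)).
Local Notation testfun := (smoothfun emb (@setT V)).
Local Notation distrT := (dual (smoothfun emb (@setT V))).
Implicit Types (L : set V) (x y : V).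

(** Away from F all derivatives of f vanish, and on F they are those of g. *)
Lemma cn_zero_extension L k (F U : set V) (f g : V -> K^o) m : closed F -> F `<=` U° ->
  (forall x, ~ F x -> f x = 0) -> (forall x, U° x -> f x = g x) -> 0 <= m ->
  cn_le F k g m -> cn_le L k f m.
Proof.
move=> clF FU f0 fg m0 gm s sk x _; have [Fx|nFx] := pselect (F x).
  by rewrite (iter_partial_local emb s fg (FU x Fx)); exact: gm.
have oF : open (~` F) by exact: closed_openC.
have E y : (~` F)° y -> f y = (0 : V -> K^o) y by move=> /interior_subset; exact: f0.
by rewrite (iter_partial_local emb s E) ?interior_open// iter_partial0 nrm0.
Qed.

(** [scal y f] is the convolution of delta_y with f, to which [conv_bound] applies. *)
Lemma scal_bounded (B : set testfun) y : bounded_subset B -> bounded_subset (scal y @` B).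
Proof.
move=> bB; apply/(smooth_boundedP (emb := emb)) => L k cL.
pose S : distrT := measure_distr emb setT (dirac_measure (hK := hK) setT y).
have [L' [k' [C [cL' C0 hS]]]] := dual_dominated S.
have XYZ : forall x y : V, (@setT V) x -> (@setT V) y -> (@setT V) (hadamard x y) by [].
have [D D0 hD] := conv_bound (emb := emb) openT openT openT XYZ k' k cL cL' C0.
have cP := prod_set_in openT openT openT XYZ cL cL'.
have [m hm] := (smooth_boundedP (emb := emb) B).1 bB _ (k' + k)%N cP.
exists (D * Num.max m 0) => _ [f Bf <-].
have m0 : 0 <= Num.max m 0 by rewrite le_max lexx orbT.
have fm : cn_le (prod_set L L') (k' + k) f (Num.max m 0).
  by apply: cn_le_trans (hm f Bf); rewrite le_max lexx.
apply: (cn_le_local cL.2 _ (hD S hS f _ (smoothfun_smooth f) m0 fm)) => x _.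
rewrite scalE /conv /= to_smoothE ?interiorT//.
by apply: (hadamard_smooth (X := setT) (Y := setT) (Z := setT)) => //;
  [exact: openT|exact: openT|exact: smoothfun_smooth].
Qed.

Lemma restr_bounded (U U' : set V) (B : set (smoothfun emb U)) : U'° `<=` U° ->
  bounded_subset B -> bounded_subset [set to_smooth emb U' f | f in B].
Proof.
move=> UU bB; apply/(smooth_boundedP (emb := emb)) => L k [cL LU].
have [m hm] := (smooth_boundedP (emb := emb) B).1 bB L k (conj cL (subset_trans LU UU)).
exists m => _ [f Bf <-]; apply: (cn_le_local LU _ (hm f Bf)) => x Ux.
by rewrite to_smoothE//; exact: smoothfun_sub.
Qed.

Section Partition.
Variable p : nat -> option (V * R * V).

Definition plat j : V -> K^o := if p j is Some q then plateau q.1.1 q.1.2 else fun=> 0.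

(** What is left of 1 after the pieces before j have been taken off; it is tracked
    instead of the partial sums, since it is a product and vanishes on the boxes
    before j. *)
Fixpoint remainder j : V -> K^o := if j is j'.+1
  then (remainder j' : V -> K) * ((fun=> 1) - (plat j' : V -> K)) else fun=> 1.

(** A partition of unity where the boxes cover; the pieces telescope, see
    [part_remainder]. *)
Definition part j : V -> K^o := (remainder j : V -> K) * (plat j : V -> K).

Lemma plat_smooth U j : smooth_on U (plat j).
Proof.
by rewrite /plat; case: (p j) => [q|]; [exact: plateau_smooth|exact: smooth_cst].
Qed.

Lemma remainder_smooth U j : smooth_on U (remainder j).
Proof.
elim: j => [|j ih]; first exact: smooth_cst.
apply: smoothM => //; apply: smoothB; [exact: smooth_cst|exact: plat_smooth].
Qed.

Lemma part_smooth U j : smooth_on U (part j).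
Proof. by apply: smoothM; [exact: remainder_smooth|exact: plat_smooth]. Qed.

Lemma part_remainder j x : part j x = (remainder j x : K) - remainder j.+1 x.
Proof.
rewrite -[LHS]/((remainder j x : K) * plat j x).
rewrite -[X in _ - X]/((remainder j x : K) * (1 - (plat j x : K))); ring.
Qed.

Lemma remainder0 J j a r y x : (j < J)%N -> p j = Some (a, r, y) -> 0 < r ->
  cbox a r x -> remainder J x = 0.
Proof.
move=> jJ pj r0 xa; elim: J jJ => // J ih; rewrite ltnS leq_eqVlt => /orP[/eqP <-|/ih J0].
  rewrite -[LHS]/((remainder j x : K) * (1 - (plat j x : K))) /plat pj plateau1//.
  by rewrite subrr mulr0.
by rewrite -[LHS]/((remainder J x : K) * (1 - (plat J x : K))) J0 mul0r.
Qed.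

Lemma part_out j a r y x : p j = Some (a, r, y) -> 0 < r -> ~ cbox a (2 * r) x ->
  part j x = 0.
Proof.
move=> pj r0 xa; rewrite -[LHS]/((remainder j x : K) * plat j x) /plat pj plateau0 ?mulr0//.
by move=> /box_cbox.
Qed.

End Partition.

Context {Omega : set V} {omega : nat -> set V}.
Hypothesis oO : open Omega.
Hypothesis exh : exhaustion Omega omega.
Local Notation U n := (dilations (closure (omega n)) Omega).

(** By partition of unity, g is the sum of the g_j = phi_j g, where phi_j = [part p j]
    lives in a box with a point y_j as in the adapted cover. If g_j(x) = f_j(x y_j),
    then T g_j = (N_T delta_{y_j}) f_j. The set of all the functions 2^(j+1) f_j
    is bounded because only finitely many f_j are nonzero near any compact
    subset of Omega, and if N_T is at most 1 on the pairs delta_{y_j},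
    2^(j+1) f_j, then T g is at most sum_j 2^-(j+1). *)
Lemma dirac_estimate_nonempty n (B : set (smoothfun emb (U n))) : omega n !=set0 ->
  bounded_subset B -> exists B1 B2, [/\ bounded_subset B1, bounded_subset B2 &
    forall (T : distrT) (N : distr Omega -> distr Omega),
      supp T `<=` dilations Omega Omega -> is_mconv_op T N ->
      (forall mu f, B1 mu -> B2 f -> nrm (N (measure_distr emb Omega mu) f) <= 1) ->
      forall g, B g -> nrm (extension (U n) T g) <= 1].
Proof.
move=> [y1 ny1] bB; have oU : open (U n) by exact: (exh_dilations_open exh).
have iU : (U n)° = U n by exact: interior_open.
have [y0 ny0 y00] := nonzero_dense (open_nbhs_nbhs (conj (exh_open exh (n := n)) ny1)).
have [p [pE cover far]] := adapted_cover exh oO (exh_closure_compact exh (n := n))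
  (exh_open exh (n := n.+1)) (exh_closure_sub exh (n := n)) (subset_closure ny0) y00.
pose mul j (g : smoothfun emb (U n)) : V -> K^o := (part p j : V -> K) * (g : V -> K).
have mul_smooth j g : smooth_on (U n) (mul j g).
  by apply: smoothM; [exact: part_smooth|exact: smoothfun_smooth].
have mul_out j a r y g x : p j = Some (a, r, y) -> ~ cbox a (2 * r) x -> mul j g x = 0.
  move=> pj xa; have [r0 _ _ _] := pE _ _ _ _ pj.
  by rewrite /mul -[LHS]/((part p j x : K) * g x) (part_out pj r0 xa) mul0r.
pose P j g : testfun := to_smooth emb setT (mul j g).
have box_in j a r y : p j = Some (a, r, y) -> compacts_in (U n) (cbox a (2 * r)).
  by move=> /pE[_ aU _ _]; split; [exact: cbox_compact|rewrite iU].
have PE j a r y g x : p j = Some (a, r, y) -> P j g x = mul j g x.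
  move=> pj; rewrite to_smoothE ?interiorT//.
  apply: (smooth_extension (@cbox_closed _ _ a (2 * r)) (box_in _ _ _ _ pj).2).
  - move=> z za; have [r0 _ _ _] := pE _ _ _ _ pj; exact: (part_out pj r0 za).
  - exact: part_smooth.
  - exact: smoothfun_smooth.
have P_bounded j a r y : p j = Some (a, r, y) -> bounded_subset (P j @` B).
  move=> pj; apply/(smooth_boundedP (emb := emb)) => L k cL.
  have [C C0 hC] := cn_mul (emb := emb) k (@part_smooth p (U n) j) (box_in _ _ _ _ pj).
  have [m hm] := (smooth_boundedP (emb := emb) B).1 bB _ k (box_in _ _ _ _ pj).
  exists (C * Num.max m 0) => _ [g Bg <-].
  have m0 : 0 <= Num.max m 0 by rewrite le_max lexx orbT.
  apply: (cn_zero_extension (g := mul j g) (@cbox_closed _ _ a (2 * r)) (box_in _ _ _ _ pj).2).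
  - by move=> x xa; rewrite (PE _ _ _ _ _ _ pj) (mul_out _ _ _ _ _ _ pj xa).
  - by move=> x _; rewrite (PE _ _ _ _ _ _ pj).
  - exact: mulr_ge0.
  apply: hC => //; first exact: smoothfun_smooth.
  by apply: cn_le_trans (hm g Bg); rewrite le_max lexx.
pose h j y g := emb (2 ^+ j.+1) *: to_smooth emb Omega (scal (coord_inv y) (P j g)).
pose B2 := [set f | exists j a r y g, [/\ p j = Some (a, r, y), B g & f = h j y g]].
have iO : Omega° = Omega by exact: interior_open.
have bB2 : bounded_subset B2.
  apply/(smooth_boundedP (emb := emb)) => L k cL.
  have [|J [W [oW LW hW]]] := far L cL.1; first by have [_] := cL; rewrite iO.
  have one j : exists m, forall a r y g, p j = Some (a, r, y) -> B g -> cn_le L k (h j y g) m.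
    case pj : (p j) => [[[a r] y]|]; last by exists 0.
    have OT : Omega° `<=` (@setT V)° by rewrite interiorT.
    have bF := restr_bounded OT
      (scal_bounded (coord_inv y) (P_bounded _ _ _ _ pj)).
    have [m hm] := (smooth_boundedP (emb := emb) _).1 bF L k cL.
    exists (nrm (emb (2 ^+ j.+1)) * m) => a' r' y' g [_ _ <-] Bg; apply: cn_leZ => //.
    apply: hm; exists (scal (coord_inv y) (P j g)) => //.
    by exists (P j g) => //; exists g.
  have [m hm] : exists m, forall j a r y g, (j < J)%N -> p j = Some (a, r, y) -> B g ->
      cn_le L k (h j y g) m.
    elim: (J) => [|J' [m hm]]; first by exists 0.
    have [m' hm'] := one J'.
    exists (Num.max m m') => j a r y g; rewrite ltnS leq_eqVlt => /orP[/eqP ->|jJ] pj Bg.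
      by apply: cn_le_trans (hm' a r y g pj Bg); rewrite le_max lexx orbT.
    by apply: cn_le_trans (hm j a r y g jJ pj Bg); rewrite le_max lexx.
  exists (Num.max m 0) => _ [j [a [r [y [g [pj Bg ->]]]]]].
  have [jJ|Jj] := ltnP j J.
    by apply: cn_le_trans (hm j a r y g jJ pj Bg); rewrite le_max lexx.
  have [_ _ _ y_neq0] := pE _ _ _ _ pj.
  have c0 : cn_le L k (0 : V -> K^o) (Num.max m 0).
    by move=> s _ x _; rewrite iter_partial0 nrm0 le_max lexx orbT.
  apply: (cn_le_local (U := W `&` Omega) _ _ c0) => [x Lx|x].
    by rewrite interior_open; [split; [exact: LW|rewrite -iO; exact: cL.2]|exact: openI].
  rewrite interior_open => [[Wx Ox]|]; last exact: openI.
  rewrite /h smoothfunZE restrE ?iO// scalE (PE _ _ _ _ _ _ pj).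
  rewrite (mul_out _ _ _ _ _ _ pj) ?mulr0// => /(hW _ _ _ _ Jj pj); apply.
  by rewrite hadamardVK.
exists (dirac_measure (hK := hK) Omega @` closure (omega n.+1)), B2; split=> //.
  apply: dirac_bounded; split; first exact: (exh_closure_compact exh).
  by rewrite iO; exact: (exh_closure_in exh).
move=> T N TV TN N1 g Bg; pose tau := extension (U n) T.
have TU : supp T `<=` U n by exact: subset_trans TV (dilations_exh exh (n := n)).
have part_small j : nrm (tau (to_smooth emb (U n) (mul j g))) <= (2 ^+ j.+1)^-1.
  have two_gt0 : (0 : R) < 2 ^+ j.+1 by rewrite exprn_gt0.
  case pj : (p j) => [[[a r] y]|]; last first.
    have -> : mul j g = 0.
      apply/funext => x; rewrite /mul -[LHS]/((remainder p j x : K) * plat p j x * g x).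
      by rewrite /plat pj mulr0 mul0r.
    have -> : to_smooth emb (U n) 0 = 0 by exact: (to_smooth_id (0 : smoothfun emb (U n))).
    by rewrite dual0 nrm0 invr_ge0 ltW.
  have [_ _ oy y_neq0] := pE _ _ _ _ pj.
  have Oy : Omega y by exact: (exh_sub exh oy).
  have -> : tau (to_smooth emb (U n) (mul j g)) = T (P j g).
    apply: (extensionE oU TU oU TU) => x Ux _.
    by rewrite (PE _ _ _ _ _ _ pj) to_smoothE// iU.
  rewrite (op_dirac oO (P j g) TN Oy y_neq0).
  have dB1 : (dirac_measure (hK := hK) Omega @` closure (omega n.+1)) (dirac_measure (hK := hK) Omega y).
    by exists y => //; exact: subset_closure.
  have hB2 : B2 (h j y g) by exists j, a, r, y, g.
  have := N1 _ _ dB1 hB2.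
  by rewrite /h dualZ nrmM nrm_emb gtr0_norm// -ler_pdivlMl// mulr1.
have partial_sum J : nrm (tau g - tau (to_smooth emb (U n)
    ((remainder p J : V -> K) * (g : V -> K)))) <= 1 - (2 ^+ J)^-1.
  elim: J => [|J ih].
    have -> : (remainder p 0 : V -> K) * (g : V -> K) = g by apply/funext => x; exact: mul1r.
    by rewrite to_smooth_id subrr nrm0 expr0 invr1 subrr.
  have -> : tau (to_smooth emb (U n) ((remainder p J.+1 : V -> K) * (g : V -> K))) =
      tau (to_smooth emb (U n) ((remainder p J : V -> K) * (g : V -> K))) -
      tau (to_smooth emb (U n) (mul J g)).
    rewrite -dualB; congr (tau _); apply: smoothfunP => x Ux; rewrite smoothfunBE.
    have rS i : smooth_on (U n) ((remainder p i : V -> K) * (g : V -> K)).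
      by apply: smoothM; [exact: remainder_smooth|exact: smoothfun_smooth].
    rewrite !to_smoothE//; rewrite /mul.
    rewrite -[X in _ = _ - X]/((part p J x : K) * g x) part_remainder.
    rewrite -[LHS]/((remainder p J.+1 x : K) * g x).
    rewrite -[X in _ = X - _]/((remainder p J x : K) * g x).
    by rewrite mulrBl subKr.
  rewrite opprB addrCA addrC; apply: le_trans (nrmD _ _) _.
  apply: le_trans (lerD ih (part_small J)) _.
  have two_gt0 : (0 : R) < 2 ^+ J by rewrite exprn_gt0.
  rewrite exprS invfM; lra.
have [L [k [C [cL C0 hL]]]] := dual_dominated tau.
have [|J [W [oW LW WP]]] := cover L cL.1; first by have [_] := cL; rewrite iU.
have := partial_sum J.
have -> : tau (to_smooth emb (U n) ((remainder p J : V -> K) * (g : V -> K))) = 0.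
  rewrite -(dual0 tau); apply: (dominated_germ cL hL (openI oW oU)) => [x Lx|x [Wx Ux]].
    by split; [exact: LW|rewrite -iU; exact: cL.2].
  rewrite to_smoothE ?iU//; last first.
    by apply: smoothM; [exact: remainder_smooth|exact: smoothfun_smooth].
  have [j [a [r [y [jJ pj xa]]]]] := WP x Wx; have [r0 _ _ _] := pE _ _ _ _ pj.
  by rewrite -[LHS]/((remainder p J x : K) * g x) (remainder0 jJ pj r0 xa) mul0r.
rewrite subr0 => /le_trans; apply; rewrite gerBl invr_ge0 exprn_ge0//.
Qed.

(** If omega_n is empty, there are no points to use; then a larger n will do, since
    the sets U_n decrease. *)
Lemma dirac_estimate n (B : set (smoothfun emb (U n))) : Omega !=set0 ->
  bounded_subset B -> exists B1 B2, [/\ bounded_subset B1, bounded_subset B2 &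
    forall (T : distrT) (N : distr Omega -> distr Omega),
      supp T `<=` dilations Omega Omega -> is_mconv_op T N ->
      (forall mu f, B1 mu -> B2 f -> nrm (N (measure_distr emb Omega mu) f) <= 1) ->
      forall g, B g -> nrm (extension (U n) T g) <= 1].
Proof.
move=> [y Oy] bB; have [m my] := exh_cover exh Oy.
pose n' := maxn n m; have oU i : open (U i) by exact: (exh_dilations_open exh).
have UU : U n' `<=` U n.
  move=> eta h x nx; apply: h; apply: closure_subset nx.
  exact: (exh_mono exh (leq_maxl n m)).
have [||B1 [B2 [bB1 bB2 h]]] :=
  @dirac_estimate_nonempty n' [set to_smooth emb (U n') g | g in B].
- by exists y; exact: (exh_mono exh (leq_maxr n m)).
- by apply: restr_bounded bB; rewrite !interior_open.
exists B1, B2; split=> // T N TV TN N1 g Bg.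
have TU : supp T `<=` U n' by exact: subset_trans TV (dilations_exh exh (n := n')).
by rewrite -(extension_restr g (oU n') (oU n) TU UU); apply: (h T N) => //; exists g.
Qed.

End DiracEstimate.

(** * Convergence of operators *)

Section OperatorTopologies.
Context {R : realType} {K : numFieldType} {emb : R -> K}.
Context {hK : scalar_field emb}.
Local Notation nrm := (@nrm R K emb).
Context {E G : preTopologicalLmodType K}.
Local Notation opspace := {family bounded_subset (E := E), E -> dual G}.

(** Neighbourhoods in the space of operators, with the strong topology of the target
    made explicit. *)
Lemma operator_cvg (F : set_system (E -> dual G)) (N0 : E -> dual G) : Filter F ->
  (forall A B e, bounded_subset A -> bounded_subset B -> 0 < e ->
     F [set N : E -> dual G | forall x f, A x -> B f -> nrm (N x f - N0 x f) < e]) ->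
  F --> (N0 : opspace).
Proof.
move=> FF h; apply/fam_cvgP => A bA P /uniform_nbhs[D [entD DP]].
have [B [e [bB e0 BD]]] := dual_entourage_basis (emb := emb) entD.
apply: filterS (h A B e bA bB e0) => N hN; apply: DP => x Ax; apply: BD => f Bf.
exact: hN.
Qed.

Lemma operator_nbhs (N0 : E -> dual G) A B e : bounded_subset A -> bounded_subset B -> 0 < e ->
  nbhs (N0 : opspace) [set N : E -> dual G | forall x f, A x -> B f -> nrm (N x f - N0 x f) < e].
Proof.
move=> bA bB e0; have := dual_entourage (emb := emb) (hK := hK) bB e0.
move=> /(fam_nbhs (fam := bounded_subset (E := E)) (N0 : opspace))/(_ bA).
apply: filterS => N h x f Ax Bf; exact: h.
Qed.

End OperatorTopologies.

(** * The isomorphism *)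

Section Topology.
Context {R : realType} {K : numFieldType} {emb : R -> K}.
Context {hK : scalar_field emb} {d : nat}.
Local Notation V := 'rV[R]_d.
Local Notation nrm := (@nrm R K emb).
Local Notation cn_le := (@cn_le R K emb d).
Local Notation distr U := (dual (smoothfun emb U)).
Local Notation distrT := (dual (smoothfun emb (@setT V))).
Context {Omega : set V} {omega : nat -> set V}.
Hypothesis oO : open Omega.
Hypothesis exh : exhaustion Omega omega.
Local Notation U n := (dilations (closure (omega n)) Omega).
Local Notation distr_V := (distr_on emb (dilations Omega Omega)).

Let oU n : open (U n). Proof. exact: (exh_dilations_open exh). Qed.
Let oom n : open (omega n). Proof. exact: (exh_open exh). Qed.

Lemma restr_sub (A A' : set V) (g : smoothfun emb A) x : A'° `<=` A° -> A'° x ->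
  to_smooth emb A' g x = g x.
Proof. by move=> AA Ax; rewrite to_smoothE//; exact: smoothfun_sub. Qed.

(** By equicontinuity the elements of A come from a single omega_n. For such S the
    number (N_T S) f is, by Fubini's theorem, T applied to x |-> S_y f(xy), a function
    that does not depend on T; as S and f vary in bounded sets, these functions form a
    bounded subset of C^infty(U_n). *)
Lemma Nop_bound (A : set (distr Omega)) (B : set (smoothfun emb Omega)) :
  bounded_subset A -> bounded_subset B ->
  exists n (B' : set (smoothfun emb (U n))), bounded_subset B' /\
    forall S f, A S -> B f -> exists2 g, B' g &
      forall (T : distrT) (TV : supp T `<=` dilations Omega Omega),
        Nop oO exh TV S f = extension (U n) T g.
Proof.
move=> bA bB; have [L [k [C [cL C0 hA]]]] := equicontinuous oO exh bA.
have LO : L `<=` Omega by have [_] := cL; rewrite interior_open.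
have [n Ln] := exh_compact exh cL.1 LO.
have nO := @exh_sub _ _ _ _ exh n.
have [loc [W [F [locl [oW LW Wn] locE cF hloc]]]] :=
  localization (emb := emb) oO (@oom n) nO cL.1 Ln.
have [C1 C10 hC1] := hloc k.
have XYZ : forall x y : V, U n x -> omega n y -> Omega (hadamard x y) by move=> x y; exact: exh_mul'.
exists n, [set g | exists (S' : distr (omega n)) f, [/\ dominated F k (C * C1) S', B f &
  g = to_smooth emb (U n) (conv S' f)]]; split.
  apply/(smooth_boundedP (emb := emb)) => L1 k' cL1.
  have CC : 0 <= C * C1 by exact: mulr_ge0.
  have [D D0 hD] := conv_bound (@oU n) (@oom n) oO XYZ k k' cL1 cF CC.
  have cP := prod_set_in (@oU n) (@oom n) oO XYZ cL1 cF.
  have [m hm] := (smooth_boundedP (emb := emb) B).1 bB _ (k + k')%N cP.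
  exists (D * Num.max m 0) => _ [S' [f [hS' Bf ->]]].
  have m0 : 0 <= Num.max m 0 by rewrite le_max lexx orbT.
  have fm : cn_le (prod_set L1 F) (k + k') f (Num.max m 0).
    by apply: cn_le_trans (hm f Bf); rewrite le_max lexx.
  apply: (cn_le_local cL1.2 _ (hD S' hS' f _ (smoothfun_smooth f) m0 fm)) => x Ux.
  by rewrite to_smoothE//; apply: (conv_smooth (@oU n) (@oom n) oO XYZ); exact: smoothfun_smooth.
move=> S f AS Bf; have [S' SE] := dual_loc S locl cF hloc.
have dS' : dominated F k (C * C1) S'.
  move=> g m m0 gm; rewrite SE -mulrA; apply: hA => //; first exact: mulr_ge0.
  exact: hC1.
exists (to_smooth emb (U n) (conv S' f)); first by exists S', f.
move=> T TV; rewrite (fubini (@oU n) (@oom n) oO XYZ) NopE SE.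
have -> : to_smooth emb (omega n) (conv (extension (U n) T) f) =
    to_smooth emb (omega n) (dual_conv_op T f).
  apply: smoothfunP => y; rewrite interior_open// => ny.
  rewrite [RHS]restr_sub ?interior_open// (dual_conv_opE oO exh TV _ ny) to_smoothE//.
    by apply: (conv_ext_smooth oO exh); exact: smoothfun_smooth.
  by rewrite interior_open.
apply: (dominated_germ cL (hA S AS) oW LW) => x Wx.
rewrite locE// to_smoothE ?interior_open//; last exact: Wn.
by apply: smoothfun_sub; rewrite !interior_open.
Qed.

Lemma extensionB (A : set V) (T T' : distrT) : open A -> supp T `<=` A -> supp T' `<=` A ->
  supp (T - T') `<=` A -> extension A (T - T') = extension A T - extension A T'.
Proof.
move=> oA TA TA' TB; apply: (represents_unique oA (extension_represents oA TB)) => f.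
rewrite -[LHS]/(T f - T' f) (extension_represents oA TA) (extension_represents oA TA').
by [].
Qed.

Lemma mconvP (A : set V) a (T T' : distrT) (S : distr A) f :
  mconv (a *: T + T') S f = a * mconv T S f + mconv T' S f.
Proof. by []. Qed.

Let Nb_map : mconv_op emb Omega ->
  {family bounded_subset (E := distr Omega), distr Omega -> distr Omega} := fun N => N.

Let NCb_map : mconv_op emb Omega -> {family bounded_subset (E := dual (contfun K Omega)),
    dual (contfun K Omega) -> distr Omega} :=
  fun N mu => N (measure_distr emb Omega mu).

Let Nb_map_continuous : continuous (Nb_map : Nb emb Omega -> _).
Proof. exact: initial_continuous. Qed.

Let NCb_map_continuous : continuous (NCb_map : NCb emb Omega -> _).
Proof. exact: initial_continuous. Qed.

Lemma Nop_pred (T : distr_V) : Nop oO exh (distr_on_supp (T := T)) \in mconv_op_pred (emb := emb) (Omega := Omega).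
Proof.
apply/mem_set; split; [exact: Nop_linear|exact: Nop_continuous|].
by exists T; exact: Nop_mconv.
Qed.

Definition op_of (T : distr_proj emb Omega omega) : Nb emb Omega := MConvOp (Nop_pred T).

Lemma op_ofP (T : distr_proj emb Omega omega) :
  is_mconv_op (distr_on_val T) (mconv_op_fun (op_of T)).
Proof. exact: Nop_mconv. Qed.

Lemma op_of_linear : linear (fun T => mconv_op_fun (op_of T)).
Proof.
move=> a T T'; apply/funext => S.
apply: (represents_unique oO (op_ofP (a *: T + T') S)) => f.
rewrite -[LHS]/(mconv (a *: distr_on_val T + distr_on_val T') S f) mconvP.
by rewrite (op_ofP T S f) (op_ofP T' S f).
Qed.

(** By [Nop_bound], a neighbourhood of 0 in E'(U_n) for one n suffices. *)
Lemma op_of_continuous : continuous op_of.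
Proof.
move=> T0; have FF := @fmap_filter _ _ op_of (nbhs T0) (nbhs_filter T0).
apply: (@cvg_initial _ _ Nb_map (op_of @ T0) (op_of T0)).
apply: (@operator_cvg _ _ _ hK _ _ _ _ (fmap_filter Nb_map FF)) => A B e bA bB e0.
have [n [B' [bB' hB']]] := Nop_bound bA bB.
have H := dual_nbhs (emb := emb) (hK := hK) (extension (U n) (distr_on_val T0)) bB' e0.
have pc : continuous (fun T : distr_proj emb Omega omega => extension (U n) (distr_on_val T)).
  move=> T; apply: (@continuous_comp _ _ _
    (proj_map (Omega := Omega) omega : distr_proj emb Omega omega -> _) (fun q => q n)).
    exact: initial_continuous.
  exact: proj_continuous.
apply: (@filterS _ (nbhs T0) (nbhs_filter T0) _ _ _ (pc T0 _ H)) => T hT S f AS Bf.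
by have [g B'g gE] := hB' S f AS Bf; rewrite !gE; exact: hT.
Qed.

Hypothesis Omega0 : Omega !=set0.

Definition distr_of (N : mconv_op emb Omega) : distr_proj emb Omega omega :=
  xget 0 [set T : distr_V | is_mconv_op (distr_on_val T) N].

Lemma distr_ofP (N : mconv_op emb Omega) : is_mconv_op (distr_on_val (distr_of N)) N.
Proof.
have /set_mem[Nl Nc [T TN]] := valP N.
have TV : (T : distrT) \in distr_on_pred (emb := emb) (dilations Omega Omega).
  apply/mem_set; split; first exact: supp_compact.
  exact: (supp_dilations oO exh Nl Nc TN).
rewrite /distr_of; case: xgetP => [T' _ //|/(_ (DistrOn TV))]; by case.
Qed.

Lemma op_ofK : cancel op_of distr_of.
Proof.
move=> T; apply: val_inj; apply: (mconv_op_inj oO Omega0 (distr_ofP _)).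
exact: op_ofP.
Qed.

Lemma distr_ofK : cancel distr_of op_of.
Proof.
move=> N; apply: val_inj; apply/funext => S.
exact: (represents_unique oO (op_ofP (distr_of N) S) (distr_ofP N S)).
Qed.

(** A seminorm of T in some E'(U_n) is estimated by N_T on bounded sets of measures and
    functions, by [dirac_estimate] applied to differences. *)
Lemma distr_of_continuous : continuous (distr_of : NCb emb Omega -> _).
Proof.
move=> N0; have FF := @fmap_filter _ _ distr_of _ (nbhs_filter (N0 : NCb emb Omega)).
apply: (@cvg_initial _ _ (proj_map (emb := emb) (Omega := Omega) omega) _ (distr_of N0)).
apply: (@cvg_prod_topology _ _ _ _ (fmap_filter (proj_map (emb := emb) (Omega := Omega) omega) FF)) => n.
move=> W /(dual_nbhs_basis (emb := emb))[B [e [bB e0 BW]]].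
have e2 : 0 < 2 / e by rewrite divr_gt0.
pose B' : set (smoothfun emb (U n)) := [set emb (2 / e) *: g | g in B].
have bB' : bounded_subset B'.
  apply/(smooth_boundedP (emb := emb)) => L k cL.
  have [m hm] := (smooth_boundedP (emb := emb) B).1 bB L k cL.
  by exists (nrm (emb (2 / e)) * m) => _ [g Bg <-]; apply: cn_leZ cL (hm g Bg).
have [B1 [B2 [bB1 bB2 est]]] := dirac_estimate oO exh Omega0 bB'.
pose N0' : dual (contfun K Omega) -> distr Omega := fun mu => N0 (measure_distr emb Omega mu).
have H := NCb_map_continuous (operator_nbhs (hK := hK) N0' bB1 bB2 ltr01).
apply: (@filterS _ (nbhs (N0 : NCb emb Omega)) (nbhs_filter _) _ _ _ H) => N hN.
apply: BW => g Bg.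
have supp_of N' : supp (distr_on_val (distr_of N')) `<=` dilations Omega Omega.
  exact: distr_on_supp.
have TV : supp (distr_on_val (distr_of N) - distr_on_val (distr_of N0)) `<=`
    dilations Omega Omega.
  exact: (distr_on_supp (T := distr_of N - distr_of N0 : distr_V)).
have TN : is_mconv_op (distr_on_val (distr_of N) - distr_on_val (distr_of N0))
    (fun S => N S - N0 S).
  move=> S f; rewrite -[LHS]/(mconv (distr_on_val (distr_of N)) S f -
    mconv (distr_on_val (distr_of N0)) S f).
  by rewrite (distr_ofP N S f) (distr_ofP N0 S f).
have B'g : B' (emb (2 / e) *: g) by exists g.
have := est _ _ TV TN _ _ B'g.
have VU := dilations_exh exh (n := n).
rewrite (extensionB (@oU n) (subset_trans (supp_of N) VU) (subset_trans (supp_of N0) VU)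
  (subset_trans TV VU)) dualZ nrmM nrm_emb gtr0_norm// => small.
have {}small : 2 / e * nrm (extension (U n) (distr_on_val (distr_of N)) g -
    extension (U n) (distr_on_val (distr_of N0)) g) <= 1.
  by apply: small => mu f B1mu B2f; apply: ltW; exact: hN.
rewrite /proj_map.
have : nrm (extension (U n) (distr_on_val (distr_of N)) g -
    extension (U n) (distr_on_val (distr_of N0)) g) <= e / 2.
  by rewrite -invf_div -[leRHS]mulr1 ler_pdivlMl.
move=> /le_lt_trans; apply; rewrite ltr_pdivrMr//.
by rewrite ltr_pMr// ltr1n.
Qed.

(** Bounded sets of measures are bounded sets of distributions. *)
Lemma Nb_NCb_continuous : continuous (id : Nb emb Omega -> NCb emb Omega).
Proof.
move=> N0; apply: (@cvg_initial _ _ NCb_map (nbhs (N0 : Nb emb Omega)) N0 _).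
apply: operator_cvg => A B e bA bB e0.
have bA' := measure_distr_bounded (emb := emb) (hK := hK) bA.
have H := Nb_map_continuous (operator_nbhs (hK := hK) (Nb_map N0) bA' bB e0).
 apply: (@filterS _ (nbhs (N0 : Nb emb Omega)) (nbhs_filter _) _ _ _ H) => N h mu f Amu Bf; apply: h => //; by exists mu.
Qed.

End Topology.

Theorem theorem3p2 (R : realType) (K : numFieldType) (emb : R -> K)
    (hK : scalar_field emb) (d : nat)
    (Omega : set 'rV[R]_d) (Omega0 : Omega !=set0) (openOmega : open Omega)
    (omega : nat -> set 'rV[R]_d) (exh : exhaustion Omega omega) :
  (exists Phi : distr_proj emb Omega omega -> Nb emb Omega,
    [/\ forall T : distr_proj emb Omega omega,
           is_mconv_op (distr_on_val T) (mconv_op_fun (Phi T)),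
        linear (fun T => mconv_op_fun (Phi T)),
        continuous Phi &
        exists Psi : Nb emb Omega -> distr_proj emb Omega omega,
          [/\ cancel Phi Psi, cancel Psi Phi & continuous Psi]]) /\
  (forall A : set (mconv_op emb Omega),
    @open (Nb emb Omega) A <-> @open (NCb emb Omega) A).
Proof.
have idc := @Nb_NCb_continuous _ _ _ hK _ Omega.
have Phic := @op_of_continuous _ _ _ hK _ _ _ openOmega exh.
have Psic := @distr_of_continuous _ _ _ hK _ _ _ openOmega exh Omega0.
split.
  exists (op_of (hK := hK) openOmega exh); split.
  - exact: op_ofP.
  - exact: op_of_linear.
  - exact: Phic.
  exists (distr_of (omega := omega)); split.
  - exact: (op_ofK (hK := hK)).
  - exact: distr_ofK.
  move=> N; exact: (@continuous_comp (Nb emb Omega) (NCb emb Omega) _ id _ N (idc N) (Psic N)).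
move=> A; split=> oA; last first.
  exact: (open_comp (fun N _ => idc N) oA).
have -> : A = (fun N => op_of (hK := hK) openOmega exh (distr_of (omega := omega) N)) @^-1` A.
  by apply/seteqP; split=> N; rewrite /= distr_ofK.
apply: (open_comp (f := fun N : NCb emb Omega => _) _ oA) => N _.
exact: (@continuous_comp (NCb emb Omega) _ _ _ _ N (Psic N) (Phic _)).
Qed.
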